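(* Let $X=S^3$, $\mathbb{E}^3$ or $\mathbb{H}^3$. Let $\Delta\subset X$ be a finite-volume Coxeter simplex whose Coxeter symbol is linear with edge labels $p,q,r$, let $\Gamma=\{p,q,r\}$ be the group generated by the reflections in the faces of $\Delta$, let $v$ be the vertex of $\Delta$ corresponding to the left-most node of the symbol, with stabiliser $\Gamma_v$ in $\Gamma$, and let $\Sigma=\bigcup_{\gamma\in\Gamma_v}\gamma(\Delta)$ be the resulting Platonic solid, of dihedral angle $2\pi/p$. Then an orientable $X$-manifold $M$ arises by the identification of faces of $\Sigma$ if and only if $\Gamma$ has a subgroup $K$ of orientation-preserving isometries such that (1) $\Gamma_v$ forms a transversal in $\Gamma$ for $K$; (2) if $\{\gamma_S\}$ are the resulting side pairings of $\Sigma$ (with $S$ ranging over the faces of $\Sigma$ and $\gamma_S(S')=S$), then $\gamma_S$ fixes no point of $S'$; and (3) for $x\in\Sigma$ let $[x]$ denote the set of points of $\Sigma$ identified with $x$ under the side pairing; if $x$ lies in the interior of an edge of $\Sigma$, then $[x]$ has cardinality $p$.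
   Context: Coxeter simplex conventions: the symbol of $\Delta$ is a path with four nodes and consecutive edges labelled $p,q,r$. Nodes correspond to the (codimension one) faces of $\Delta$. The faces of two nodes joined by an edge labelled $m$ meet at dihedral angle $\pi/m$, and the faces of two non-adjacent nodes are orthogonal. The vertex corresponding to a node is the vertex of $\Delta$ opposite the face of that node. In the hyperbolic case vertices of $\Delta$ may be ideal, but it is assumed that $v\in X$, so that $\Gamma_v$ is finite. Then $\Sigma$ is a regular solid (possibly with ideal vertices) with $r$-gonal faces, $q$ meeting at each vertex, and dihedral angle $2\pi/p$. The images of $\Sigma$ under $\Gamma$ tessellate $X$. Transversal: $\Gamma_v$ is a transversal for $K$ in $\Gamma$ if it is a non-redundant list of coset representatives of $K$ in $\Gamma$, equivalently $K\cap\Gamma_v=\{1\}$ and $K\Gamma_v=\Gamma$. Side pairings: suppose $\Gamma_v$ is a transversal for $K$, and let $S$ be a (two-dimensional) face of $\Sigma$. Let $\Sigma_S$ be the unique copy of $\Sigma$ in the tessellation with $\Sigma\cap\Sigma_S=S$. There is a unique $\gamma_S\in K$ with $\gamma_S(\Sigma)=\Sigma_S$, and $S'$ is the face of $\Sigma$ with $\gamma_S(S')=S$. The set of points identified with $x\in\Sigma$ is the class of $x$ under the equivalence relation on $\Sigma$ generated by $y\sim\gamma_S(y)$ for all faces $S$ and all $y\in S'$. An $X$-manifold is a quotient of $X$ by a group of isometries acting properly discontinuously and without fixed points. ''An $X$-manifold $M$ arises by the identification of faces of $\Sigma$'' means that $M$ is isometric to $X/K$ for a subgroup $K\le\Gamma$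 acting properly discontinuously and without fixed points on $X$ and having $\Sigma$ as a fundamental region, so that $M$ is obtained from $\Sigma$ by identifying its faces through the elements $\gamma_S$. *)

(* Defs.v *)
From HB Require Import structures.
From Stdlib Require Export Relation_Operators.
From mathcomp Require Export all_boot all_order all_algebra.
From mathcomp Require Export all_classical all_reals all_analysis.

Set Implicit Arguments.
Unset Strict Implicit.
Unset Printing Implicit Defensive.

Import Order.TTheory GRing.Theory Num.Theory.
Import numFieldNormedType.Exports.

Local Open Scope classical_set_scope.
Local Open Scope ring_scope.

Inductive geometry := Spherical | Euclidean | Hyperbolic.

(* All three spaces are realised in R^4 (column vectors), with coordinate 0
   distinguished: S^3 is the unit sphere, E^3 the affine hyperplane x_0 = 1 and
   H^3 the upper sheet of the hyperboloid x_0^2 - x_1^2 - x_2^2 - x_3^2 = 1.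
   Planes of the space are then its nonempty intersections with linear
   hyperplanes, and segments, hulls and dimensions are linear notions. *)
Section Spaces.
Variable R : realType.
Implicit Types (X : geometry) (x y : 'cV[R]_4) (g : 'M[R]_4).
Implicit Types (A S : set 'cV[R]_4) (G H K : set 'M[R]_4).

(* product of the coordinates 1, 2, 3 *)
Definition sdot x y : R :=
  \sum_(i < 3) x (lift ord0 i) 0 * y (lift ord0 i) 0.

Definition space X : set 'cV[R]_4 :=
  match X with
  | Spherical => [set x : 'cV[R]_4 | x 0 0 ^+ 2 + sdot x x = 1]
  | Euclidean => [set x : 'cV[R]_4 | x 0 0 = 1]
  | Hyperbolic => [set x : 'cV[R]_4 | 0 < x 0 0 /\ x 0 0 ^+ 2 - sdot x x = 1]
  end.

Definition arcosh (c : R) : R := ln (c + Num.sqrt (c ^+ 2 - 1)).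

Definition dist X x y : R :=
  match X with
  | Spherical => acos (x 0 0 * y 0 0 + sdot x y)
  | Euclidean => Num.sqrt (sdot (x - y) (x - y))
  | Hyperbolic => arcosh (x 0 0 * y 0 0 - sdot x y)
  end.

(* Every isometry of the space is the restriction of exactly one linear map of
   R^4 (the space spans R^4), so isometries are represented by matrices. *)
Definition isometry X g : Prop :=
  [set g *m x | x in space X] = space X /\
  forall x y, space X x -> space X y -> dist X (g *m x) (g *m y) = dist X x y.

(* At x in the space, R^4 is the sum of the line R x and the tangent space; an
   isometry g respects these decompositions at x and g x, so it preserves
   orientation exactly when det g > 0. *)
Definition orientation_preserving g : Prop := 0 < \det g.

Definition mx_group G : Prop :=
  [/\ forall g, G g -> g \in unitmx, G 1%:M,
      forall g h, G g -> G h -> G (g *m h) & forall g, G g -> G (invmx g)].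

Definition isometry_group X G : Prop :=
  mx_group G /\ forall g, G g -> isometry X g.

Definition translate g A : set 'cV[R]_4 := [set g *m x | x in A].

Definition properly_discontinuous X G : Prop :=
  forall C, C `<=` space X -> compact C ->
    finite_set [set g | G g /\ translate g C `&` C !=set0].

Definition fixed_point_free X G : Prop :=
  forall g x, G g -> g <> 1%:M -> space X x -> g *m x <> x.

Definition orbit G x : set 'cV[R]_4 := [set g *m x | g in G].

Definition orbit_space X G : set (set 'cV[R]_4) := [set orbit G x | x in space X].

Definition orbit_dist X (O O' : set 'cV[R]_4) : R :=
  inf [set d | exists x y, [/\ O x, O' y & d = dist X x y]].

Definition isometric_to_quotient X (M : metricType R) G : Prop :=
  exists f : set 'cV[R]_4 -> M,
    set_bij (orbit_space X G) setT f /\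
    forall O O', orbit_space X G O -> orbit_space X G O' ->
      mdist (f O) (f O') = orbit_dist X O O'.

(* An orientation of the quotient, lifted to the space and compared with the
   standard orientation of the space: a G-equivariant continuous choice of sign
   (as a boolean) at every point. *)
Definition orientable_quotient X G : Prop :=
  exists o : 'cV[R]_4 -> bool,
    (forall x, space X x -> \forall y \near within (space X) (nbhs x), o y = o x) /\
    (forall g x, G g -> space X x -> o (g *m x) = o x (+) (\det g < 0)).

Definition orientable_manifold X (M : metricType R) : Prop :=
  exists G, [/\ isometry_group X G, properly_discontinuous X G,
    fixed_point_free X G, orientable_quotient X G & isometric_to_quotient X M G].

Definition rel_interior X A : set 'cV[R]_4 :=
  [set x | space X x /\ \forall y \near within (space X) (nbhs x), A y].

Definition fundamental_region X K A : Prop :=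
  [/\ A `<=` space X, \bigcup_(k in K) translate k A = space X &
      forall k, K k -> k <> 1%:M ->
        rel_interior X A `&` translate k (rel_interior X A) = set0].

(* T is a non-redundant list of representatives of the cosets K g *)
Definition transversal G K (T : set 'M[R]_4) : Prop :=
  T `<=` G /\
  forall g, G g -> exists! t, T t /\ exists2 k, K k & g = k *m t.

(* d is the linear dimension, so S has dimension d - 1 within the space *)
Definition spans_dim (d : nat) S : Prop :=
  exists B : 'M[R]_(4, d),
    [/\ \rank B = d, forall j, S (col j B) &
        forall x, S x -> exists t : 'cV[R]_d, x = B *m t].

(* the k-dimensional faces of a convex polyhedron A in the space: intersections
   of A with a supporting plane *)
Definition poly_face (k : nat) A S : Prop :=
  exists u : 'rV[R]_4,
    [/\ forall x, A x -> 0 <= (u *m x) 0 0,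
        S = [set x | A x /\ (u *m x) 0 0 = 0] & spans_dim k.+1 S].

Definition in_edge_interior A x : Prop :=
  (exists E, poly_face 1 A E /\ E x) /\ forall W, poly_face 0 A W -> ~ W x.

(* g = gamma_S; the face S' = g^-1(S) it carries to S is paired_face g S *)
Definition side_pairing K A S g : Prop :=
  [/\ poly_face 2 A S, K g & A `&` translate g A = S].

Definition paired_face g S : set 'cV[R]_4 := [set y | S (g *m y)].

Definition pairing_step K A y z : Prop :=
  exists S g, [/\ side_pairing K A S g, paired_face g S y & z = g *m y].

Definition pairing_class K A x : set 'cV[R]_4 :=
  [set y | A y /\ clos_refl_sym_trans _ (pairing_step K A) x y].

(* A simplex is given by the matrix V whose columns are its vertices; an ideal
   vertex is represented by a vector of the light cone.  Hyperbolic simplices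
   all of whose vertices are in the space or ideal are exactly those of finite
   volume; in the other two geometries finite volume is automatic. *)
Definition ideal_point X x : Prop :=
  [/\ X = Hyperbolic, 0 < x 0 0 & x 0 0 ^+ 2 = sdot x x].

Definition nondegenerate X (V : 'M[R]_4) : Prop :=
  V \in unitmx /\ forall i, space X (col i V) \/ ideal_point X (col i V).

Definition simplex X (V : 'M[R]_4) : set 'cV[R]_4 :=
  [set x | space X x /\
     exists t : 'cV[R]_4, (forall i, 0 <= t i 0) /\ x = V *m t].

(* the face opposite to the i-th vertex *)
Definition simplex_face X (V : 'M[R]_4) (i : 'I_4) : set 'cV[R]_4 :=
  [set x | space X x /\
     exists t : 'cV[R]_4, [/\ forall j, 0 <= t j 0, t i 0 = 0 & x = V *m t]].

(* The i-th barycentric coordinate: the linear form that vanishes on the i-th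
   face and is positive on the side of the simplex. *)
Definition face_form (V : 'M[R]_4) (i : 'I_4) : 'rV[R]_4 := row i (invmx V).

(* The inner product of the normal vectors of two planes u x = 0 and w x = 0,
   in terms of the forms u and w.  In E^3 the coordinate 0 of a form is the
   constant term of the equation of the plane and does not contribute. *)
Definition normal_prod X (u w : 'rV[R]_4) : R :=
  match X with
  | Spherical => u 0 0 * w 0 0
  | Euclidean => 0
  | Hyperbolic => - (u 0 0 * w 0 0)
  end + sdot u^T w^T.

Definition dihedral_angle X (V : 'M[R]_4) (i j : 'I_4) : R :=
  let u := face_form V i in
  let w := face_form V j in
  acos (- normal_prod X u w / Num.sqrt (normal_prod X u u * normal_prod X w w)).

(* the linear symbol o--p--o--q--o--r--o, for nodes i < j *)
Definition symbol_label (p q r : nat) (i j : 'I_4) : nat :=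
  if (j == i.+1 :> nat) then nth 2 [:: p; q; r] i else 2.

Definition linear_coxeter_simplex X (V : 'M[R]_4) (p q r : nat) : Prop :=
  nondegenerate X V /\
  forall i j : 'I_4, (i < j)%N ->
    dihedral_angle X V i j = pi / (symbol_label p q r i j)%:R.

(* the reflection in the i-th face: the nontrivial isometry fixing it pointwise *)
Definition face_reflection X (V : 'M[R]_4) (i : 'I_4) g : Prop :=
  [/\ isometry X g, g <> 1%:M & forall x, simplex_face X V i x -> g *m x = x].

Definition coxeter_group X (V : 'M[R]_4) : set 'M[R]_4 :=
  smallest mx_group [set g | exists i, face_reflection X V i g].

Definition stabiliser G x : set 'M[R]_4 := [set g | G g /\ g *m x = x].

(* the vertex of the left-most node *)
Definition apex (V : 'M[R]_4) : 'cV[R]_4 := col ord0 V.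

Definition apex_group X (V : 'M[R]_4) : set 'M[R]_4 :=
  stabiliser (coxeter_group X V) (apex V).

Definition solid X (V : 'M[R]_4) : set 'cV[R]_4 :=
  \bigcup_(g in apex_group X V) translate g (simplex X V).

Definition arises_from_solid X (V : 'M[R]_4) (M : metricType R) : Prop :=
  exists K, [/\ mx_group K /\ K `<=` coxeter_group X V,
    properly_discontinuous X K, fixed_point_free X K,
    fundamental_region X K (solid X V) & isometric_to_quotient X M K].

End Spaces.

(* Main.v *)
(* Let a_i be the unit normal forms of the faces of Delta.  Tits' theorem (each
   a_i g is a nonnegative or a nonpositive combination of the a_j) shows that
   the translates of Delta tile X and that the stabiliser in Gamma of a point of
   Delta is generated by the reflections in the faces through it.

   If Gamma_v is a transversal for K, the translates of Sigma by K tile X, and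
   an element of K fixing a point can be conjugated to k in K fixing a point x
   of Sigma.  If x is interior to Sigma then k = 1 by transversality; if x is
   interior to a face then k is a side pairing, against (2).  If x is interior
   to an edge, the p copies of Sigma around it are k_j Sigma with k_j in K,
   [x] is contained in {k_j^-1 x | j < p}, and (3) says that these points are
   distinct, so k = 1.  Finally, if x is a vertex and k <> 1, then k, being
   orientation preserving, fixes pointwise a line through x, hence a point that
   is not in the orbit of x, and one of the previous cases applies.  Conversely,
   if K acts freely, the points k_j^-1 x are distinct, and consecutive ones are
   related by a side pairing.

   For K to preserve orientation, let M be isometric to both X/G and X/K, with
   X/G orientable.  The resulting isometry X/K -> X/G lifts near each y to an
   isometry h_y, unique up to G; the sign of det h_y is locally constant, hence
   constant, while h_(k y) can be taken to be h_y k^-1. *)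

Require Import Defs.
From mathcomp Require Import ring lra zify.

Set Implicit Arguments.
Unset Strict Implicit.
Unset Printing Implicit Defensive.

Import Order.TTheory GRing.Theory Num.Theory.
Import numFieldNormedType.Exports.

Local Open Scope classical_set_scope.
Local Open Scope ring_scope.

(** * The three geometries *)

(** The three geometries are treated at once through squared chords: [dist] is a strictly increasing
    function [phi] of [chord], and [chord] is quadratic. One obstacle is the Euclidean form, which
    is degenerate; a nondegenerate form [pform X x] attached to each point lets isometries,
    reflections and axes be handled by the same matrix identities. The other obstacle is ideal
    vertices, which are not points of the space: frames and common points of faces are therefore
    positive combinations of at least two vertices, projected radially by [rho]. Conditions (2) and
    (3) speak of faces cut out by supporting planes, Tits' theorem of the walls of Delta. The bridge
    is [in_edge_interiorP], where p, q, r >= 3 makes the relevant cosines positive. In (3) it is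
    known beforehand that [x] lies in a list of p points; having p elements leaves no room for a
    repetition. At a vertex, the orbit being discrete, the points of the fixed line close to the
    vertex avoid its orbit; and Delta contains at most one vertex of Sigma, so they avoid all
    vertices. *)

Section LinearAlgebra.
Variable R : fieldType.

Lemma unitmx_inj n (A : 'M[R]_n) :
  (forall u : 'cV_n, A *m u = 0 -> u = 0) -> A \in unitmx.
Proof.
move=> inj; rewrite -unitmx_tr -row_free_unit -kermx_eq0; apply/eqP/row_matrixP=> i.
rewrite row0; apply: (can_inj (@trmxK _ _ _)); rewrite trmx0; apply: inj.
by apply: (can_inj (@trmxK _ _ _)); rewrite trmx_mul trmxK -row_mul mulmx_ker row0 trmx0.
Qed.

(** The matrix determinant lemma: a product of two block matrices is block triangular in both
    orders, and the diagonal blocks give the two sides. It yields the determinant of a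
    reflection. *)
Lemma det_one_add_mul n (u : 'cV[R]_n) (v : 'rV[R]_n) :
  \det (1%:M + u *m v) = 1 + (v *m u) 0 0.
Proof.
pose A := block_mx (1%:M : 'M[R]_1) (- v) u (1%:M : 'M[R]_n).
have E1 : A *m block_mx 1%:M v 0 1%:M = block_mx 1%:M 0 u (1%:M + u *m v).
  by rewrite mulmx_block !(mulmx0, mul1mx, mulmx1, addr0) subrr addrC.
have E2 : block_mx 1%:M v 0 1%:M *m A = block_mx (1%:M + v *m u) 0 u 1%:M.
  by rewrite mulmx_block !(mul0mx, mul1mx, mulmx1, add0r) addNr.
have := congr1 determinant E1; have := congr1 determinant E2.
rewrite !det_mulmx !(det_ublock, det_lblock) !det1 !mulr1 !mul1r => -> <-.
by rewrite det_mx11 !mxE.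
Qed.

End LinearAlgebra.

Section Geometry.
Variable R : realType.
Implicit Types (X : geometry) (x y z u w : 'cV[R]_4) (g J : 'M[R]_4) (a : 'rV[R]_4).

Definition o1 : 'I_4 := Ordinal (isT : (1 < 4)%N).
Definition o2 : 'I_4 := Ordinal (isT : (2 < 4)%N).
Definition o3 : 'I_4 := Ordinal (isT : (3 < 4)%N).

Lemma ord4P (P : 'I_4 -> Prop) : P 0 -> P o1 -> P o2 -> P o3 -> forall i, P i.
Proof.
move=> P0 P1 P2 P3 [[|[|[|[|//]]]] Hi].
- by rewrite (_ : Ordinal Hi = 0) //; apply: val_inj.
- by rewrite (_ : Ordinal Hi = o1) //; apply: val_inj.
- by rewrite (_ : Ordinal Hi = o2) //; apply: val_inj.
- by rewrite (_ : Ordinal Hi = o3) //; apply: val_inj.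
Qed.

Lemma sum4 (T : nmodType) (F : 'I_4 -> T) : \sum_i F i = F 0 + F o1 + F o2 + F o3.
Proof.
rewrite !big_ord_recr big_ord0 /= add0r.
by congr (F _ + F _ + F _ + F _); apply: val_inj.
Qed.

Lemma sdotE x y :
  sdot x y = x o1 0 * y o1 0 + x o2 0 * y o2 0 + x o3 0 * y o3 0.
Proof.
rewrite /sdot !big_ord_recr big_ord0 /= add0r.
by congr (x _ _ * y _ _ + x _ _ * y _ _ + x _ _ * y _ _); apply: val_inj.
Qed.

Lemma eq_vec4 x y :
  x 0 0 = y 0 0 -> x o1 0 = y o1 0 -> x o2 0 = y o2 0 -> x o3 0 = y o3 0 -> x = y.
Proof. by move=> *; apply/colP; apply: ord4P. Qed.

Lemma mulrow4 a x : (a *m x) 0 0 = a 0 0 * x 0 0 + a 0 o1 * x o1 0 + a 0 o2 * x o2 0 + a 0 o3 * x o3 0.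
Proof. by rewrite mxE sum4. Qed.

(* The curvature.  [nf] is the form induced on differences of points of the
   space and on normals, possibly degenerate; [bf x x = 1] on the space. *)
Definition sg X : R := match X with Spherical => 1 | Euclidean => 0 | Hyperbolic => -1 end.

Definition nf X x y : R := sg X * (x 0 0 * y 0 0) + sdot x y.
Definition bf X x y : R := x 0 0 * y 0 0 + sg X * sdot x y.
Definition chord X x y : R := nf X (x - y) (x - y).

Lemma normal_prodE X a b : normal_prod X a b = nf X a^T b^T.
Proof. by rewrite /normal_prod /nf; case: X => /=; rewrite !mxE; ring. Qed.

Definition upper X x : bool := if X is Spherical then true else 0 < x 0 0.

Lemma space_bf X x : space X x <-> bf X x x = 1 /\ upper X x.
Proof.
rewrite /bf; case: X => /=.
- by rewrite mul1r expr2; split => [->|[]].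
- rewrite mul0r addr0; split=> [->|[/eqP]]; first by rewrite mulr1.
  by rewrite -expr2 sqrf_eq1 => /orP[/eqP//|/eqP ->]; rewrite ltr0N1.
- by rewrite mulN1r expr2; split => [[? ->]//|[-> H]]; split.
Qed.

(* The distance as a function of the squared chord. *)
Definition phi X (t : R) : R :=
  match X with
  | Spherical => acos (1 - t / 2)
  | Euclidean => Num.sqrt t
  | Hyperbolic => arcosh (1 + t / 2)
  end.

Lemma bf_chord X x y : space X x -> space X y -> bf X x y = 1 - sg X * chord X x y / 2.
Proof.
move=> /space_bf[hx px] /space_bf[hy py]; move: hx hy.
rewrite /chord /nf /bf !sdotE !mxE; case: X px py => /= px py hx hy; [lra| |lra].
suff [-> ->] : x 0 0 = 1 /\ y 0 0 = 1 by ring.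
by split; nra.
Qed.

Lemma distE X x y : space X x -> space X y -> dist X x y = phi X (chord X x y).
Proof.
move=> hx hy; have := bf_chord hx hy; case: X hx hy => /= hx hy; rewrite /bf /=.
- by rewrite !mul1r => ->.
- by move=> _; rewrite /chord /nf /= mul0r add0r.
- by rewrite !mulN1r => ->; rewrite mulNr opprK.
Qed.

(** The indefinite form hides the sign of [chord]. Multiplied by [x 0 0 * y 0 0 > 0] it becomes a
    sum of squares, whence nonnegativity, definiteness and the bounds on coordinates. *)
Lemma hyp_identity x y : space Hyperbolic x -> space Hyperbolic y ->
  let d i := x 0 0 * y i 0 - y 0 0 * x i 0 in
  d o1 ^+ 2 + d o2 ^+ 2 + d o3 ^+ 2 + (x 0 0 - y 0 0) ^+ 2 =
  x 0 0 * y 0 0 * chord Hyperbolic x y.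
Proof.
move=> [_ hx] [_ hy] /=.
(* The two added terms are multiples of the equations of the hyperboloid; they make the claim a
   polynomial identity. *)
transitivity (x 0 0 * y 0 0 * chord Hyperbolic x y +
  (x 0 0 ^+ 2 - sdot x x - 1) * (x 0 0 * y 0 0 - y 0 0 ^+ 2) +
  (y 0 0 ^+ 2 - sdot y y - 1) * (x 0 0 * y 0 0 - x 0 0 ^+ 2)).
  by rewrite /chord /nf /= !sdotE !mxE; ring.
by rewrite hx hy subrr !mul0r !addr0.
Qed.

Lemma chord_sym X x y : chord X x y = chord X y x.
Proof. by rewrite /chord /nf !sdotE !mxE; ring. Qed.

Lemma chordxx X x : chord X x x = 0.
Proof. by rewrite /chord /nf !sdotE !mxE; ring. Qed.

Lemma chord_ge0 X x y : space X x -> space X y -> 0 <= chord X x y.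
Proof.
case: X => hx hy.
- by rewrite /chord /nf sdotE /= mul1r -!expr2 !addr_ge0 ?sqr_ge0.
- by rewrite /chord /nf sdotE /= mul0r -!expr2 !addr_ge0 ?sqr_ge0.
- have := hyp_identity hx hy; case: hx => x0 _; case: hy => y0 _ /= h.
  rewrite -(pmulr_rge0 _ (mulr_gt0 x0 y0)) -h.
  by rewrite !addr_ge0 ?sqr_ge0.
Qed.

Lemma sum4_sqr_eq0 (s t v w : R) : s ^+ 2 + t ^+ 2 + v ^+ 2 + w ^+ 2 = 0 ->
  [/\ s = 0, t = 0, v = 0 & w = 0].
Proof.
move=> /eqP; rewrite !paddr_eq0 ?addr_ge0 ?sqr_ge0 // !sqrf_eq0.
by move=> /andP[/andP[/andP[/eqP-> /eqP->] /eqP->] /eqP->].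
Qed.

Lemma chord_eq0 X x y : space X x -> space X y -> chord X x y = 0 -> x = y.
Proof.
case: X => hx hy.
- rewrite /chord /nf sdotE /= !mxE mul1r !addrA -!expr2 => /sum4_sqr_eq0[*].
  by apply: eq_vec4; apply: subr0_eq.
- move: hx hy; rewrite /chord /nf sdotE /= !mxE mul0r -!expr2 => hx hy h.
  have /sum4_sqr_eq0[*] : 0 ^+ 2 + (x o1 0 - y o1 0) ^+ 2 + (x o2 0 - y o2 0) ^+ 2 + (x o3 0 - y o3 0) ^+ 2 = 0.
    by rewrite -[RHS]h; ring.
  by apply: eq_vec4; rewrite ?hx ?hy //; apply: subr0_eq.
- have := hyp_identity hx hy; case: hx => x0 _; case: hy => y0 _ /= + h0.
  rewrite h0 mulr0 => /sum4_sqr_eq0[h1 h2 h3 h4].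
  have e0 : x 0 0 = y 0 0 by apply: subr0_eq.
  move: h1 h2 h3; rewrite e0 => /subr0_eq h1 /subr0_eq h2 /subr0_eq h3.
  by apply: eq_vec4 => //; apply: (mulfI (lt0r_neq0 y0)).
Qed.

(** In the hyperbolic case, with x', u' the spatial parts, orthogonality and Lagrange's identity
    turn [x_0^2 nf u u] into |u'|^2 + |x' × u'|^2. *)
Lemma tangent_ge0 X x u : space X x -> bf X x u = 0 -> 0 <= nf X u u.
Proof.
case: X => hx.
- by rewrite /nf sdotE /= mul1r -!expr2 !addr_ge0 ?sqr_ge0.
- by rewrite /nf sdotE /= mul0r -!expr2 !addr_ge0 ?sqr_ge0.
- case: hx; rewrite /bf /nf !sdotE /=.
  set x0 := x 0 0; set x1 := x o1 0; set x2 := x o2 0; set x3 := x o3 0.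
  set u0 := u 0 0; set u1 := u o1 0; set u2 := u o2 0; set u3 := u o3 0.
  move=> px hx hu; rewrite -(pmulr_rge0 _ (exprn_gt0 2 px)).
  have h1 : x0 * u0 = x1 * u1 + x2 * u2 + x3 * u3 by lra.
  have -> : x0 ^+ 2 * (-1 * (u0 * u0) + (u1 * u1 + u2 * u2 + u3 * u3)) =
   (u1 * u1 + u2 * u2 + u3 * u3) + ((x1 * u2 - x2 * u1) ^+ 2 +
   (x1 * u3 - x3 * u1) ^+ 2 + (x2 * u3 - x3 * u2) ^+ 2).
    have -> : x0 ^+ 2 * (-1 * (u0 * u0) + (u1 * u1 + u2 * u2 + u3 * u3)) =
      x0 ^+ 2 * (u1 * u1 + u2 * u2 + u3 * u3) - (x0 * u0) ^+ 2 by ring.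
    by rewrite h1 (_ : x0 ^+ 2 = 1 + (x1 * x1 + x2 * x2 + x3 * x3)); [ring|lra].
  by rewrite -!expr2 !addr_ge0 ?sqr_ge0.
Qed.

Lemma tangent_eq0 X x u : space X x -> bf X x u = 0 -> nf X u u = 0 -> u = 0.
Proof.
case: X => hx.
- rewrite /nf sdotE /= mul1r !addrA -!expr2 => _ /sum4_sqr_eq0[*].
  by apply: eq_vec4; rewrite mxE.
- move: hx; rewrite /bf /nf sdotE /= !mul0r => ->; rewrite mul1r addr0 add0r => u0 h; rewrite sdotE in h.
  have /sum4_sqr_eq0[*] : 0 ^+ 2 + u o1 0 ^+ 2 + u o2 0 ^+ 2 + u o3 0 ^+ 2 = 0.
    by rewrite -[RHS]h; ring.
  by apply: eq_vec4; rewrite mxE.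
- case: hx; rewrite /bf /nf !sdotE /= => px hx hu h.
  have h1 : x 0 0 * u 0 0 = x o1 0 * u o1 0 + x o2 0 * u o2 0 + x o3 0 * u o3 0 by lra.
  have [u1 u2 u3 _] : [/\ u o1 0 = 0, u o2 0 = 0, u o3 0 = 0 & 0 = 0 :> R].
    apply: sum4_sqr_eq0; apply/eqP; rewrite eq_le !addr_ge0 ?sqr_ge0 // andbT.
    have -> : u o1 0 ^+ 2 + u o2 0 ^+ 2 + u o3 0 ^+ 2 + 0 ^+ 2 =
      - ((x o1 0 * u o2 0 - x o2 0 * u o1 0) ^+ 2 + (x o1 0 * u o3 0 - x o3 0 * u o1 0) ^+ 2 +
      (x o2 0 * u o3 0 - x o3 0 * u o2 0) ^+ 2) + (x 0 0 ^+ 2 * (u o1 0 * u o1 0 + u o2 0 * u o2 0 + u o3 0 * u o3 0) - (x 0 0 * u 0 0) ^+ 2).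
      by rewrite h1 (_ : x 0 0 ^+ 2 = 1 + (x o1 0 * x o1 0 + x o2 0 * x o2 0 + x o3 0 * x o3 0)); [ring|lra].
    rewrite (_ : _ - (x 0 0 * u 0 0) ^+ 2 = x 0 0 ^+ 2 * (-1 * (u 0 0 * u 0 0) + (u o1 0 * u o1 0 + u o2 0 * u o2 0 + u o3 0 * u o3 0))); last by ring.
    by rewrite h mulr0 addr0 oppr_le0 !addr_ge0 ?sqr_ge0.
  apply: eq_vec4; rewrite mxE //; apply: (mulfI (lt0r_neq0 px)).
  by rewrite h1 u1 u2 u3; ring.
Qed.

(** A substitute for the triangle inequality. In the hyperbolic case the vector
    [x + z - (2 + s/2) y] is tangent at y, and the nonnegativity of its norm is exactly this bound;
    otherwise [2 * s] suffices. *)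
Lemma chord_triangle X x y z : space X x -> space X y -> space X z ->
  let s := chord X x y + chord X y z in chord X x z <= 2 * s + s ^+ 2 / 4.
Proof.
move=> hx hy hz /=; set a := chord X x y; set b := chord X y z.
have [XH|XH] : X = Hyperbolic \/ X <> Hyperbolic.
  by case: (X); [right|right|left].
- subst X; have := bf_chord hx hy; have := bf_chord hy hz.
  have := bf_chord hx hz; rewrite -/a -/b /=; set c := chord _ x z => bc bb ba.
  pose v := x + z - (2 + (a + b) / 2) *: y.
  have hxx := proj1 ((space_bf _ _).1 hx); have hyy := proj1 ((space_bf _ _).1 hy).
  have hzz := proj1 ((space_bf _ _).1 hz).
  have hv : bf Hyperbolic y v = 0.
    have -> : bf Hyperbolic y v = bf Hyperbolic x y + bf Hyperbolic y z -
       (2 + (a + b) / 2) * bf Hyperbolic y y.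
      by rewrite /v /bf !sdotE !mxE; ring.
    by rewrite ba bb hyy; lra.
  have := tangent_ge0 hy hv.
  have -> : nf Hyperbolic v v = - bf Hyperbolic x x - bf Hyperbolic z z
     - (2 + (a + b) / 2) ^+ 2 * bf Hyperbolic y y - 2 * bf Hyperbolic x z
     + 2 * (2 + (a + b) / 2) * (bf Hyperbolic x y + bf Hyperbolic y z).
    by rewrite /v /bf /nf !sdotE !mxE /=; ring.
  by rewrite hxx hyy hzz ba bb bc; nra.
- apply: (@le_trans _ _ (2 * (a + b))); last by rewrite lerDl mulr_ge0 ?sqr_ge0 ?invr_ge0.
  rewrite /a /b /chord /nf !sdotE !mxE.
  have s0 : 0 <= sg X by case: (X) XH.
  have H (p q r : R) : (p - r) * (p - r) <= 2 * ((p - q) * (p - q) + (q - r) * (q - r)).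
    by have := sqr_ge0 (p - q - (q - r)); nra.
  have := ler_wpM2l s0 (H (x 0 0) (y 0 0) (z 0 0)).
  have := H (x o1 0) (y o1 0) (z o1 0); have := H (x o2 0) (y o2 0) (z o2 0).
  have := H (x o3 0) (y o3 0) (z o3 0); lra.
Qed.

(** Chords control coordinates, so that chord balls form a basis of neighbourhoods. In the
    hyperbolic case [hyp_identity] bounds [x_0 - z_0] and [x_0 z_j - z_0 x_j], from which
    [x_0 (z_j - x_j)] is recovered. *)
Lemma coord_near X x z i : space X x -> space X z -> chord X x z <= 1 ->
  (z i 0 - x i 0) ^+ 2 <= 16 * (1 + x 0 0 ^+ 2) * chord X x z.
Proof.
move=> hx hz h1; have h0 := chord_ge0 hx hz.
have x20 := sqr_ge0 (x 0 0).
have [XH|XH] : X = Hyperbolic \/ X <> Hyperbolic.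
  by case: (X); [right|right|left].
- subst X; have /= := hyp_identity hx hz; move: (hx) (hz) => [px qx] [pz qz].
  set c := chord _ _ _ in h0 h1 *.
  set x0 := x 0 0 in px qx x20 *; set z0 := z 0 0 in pz *.
  set d1 := x0 * _ - _; set d2 := x0 * z o2 0 - _; set d3 := x0 * z o3 0 - _ => h.
  have hd : (x0 - z0) ^+ 2 <= x0 * z0 * c.
    by rewrite -h lerDr !addr_ge0 ?sqr_ge0.
  have zx : z0 <= 4 * x0.
    rewrite leNgt; apply/negP => lt4.
    have : x0 * z0 * c <= x0 * z0 by apply: ler_piMr; rewrite // mulr_ge0 // ltW.
    by have := mulr_gt0 px pz; nra.
  have hc : x0 * z0 * c <= 4 * x0 ^+ 2 * c.
    by apply: ler_wpM2r => //; nra.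
  have xi : forall i, i != 0 -> x i 0 ^+ 2 <= x0 ^+ 2.
    have -> : x0 ^+ 2 = 1 + sdot x x by lra.
    rewrite sdotE; apply: ord4P => // _; have := sqr_ge0 (x o1 0);
      have := sqr_ge0 (x o2 0); have := sqr_ge0 (x o3 0); lra.
  have K j : j != 0 -> (x0 * z j 0 - z0 * x j 0) ^+ 2 <= 4 * x0 ^+ 2 * c ->
      (z j 0 - x j 0) ^+ 2 <= 16 * (1 + x0 ^+ 2) * c.
    move=> j0 hj; rewrite -(ler_pM2l (exprn_gt0 2 px)).
    have := ler_wpM2r (sqr_ge0 (x j 0)) (le_trans hd hc).
    have e : x0 ^+ 2 * (z j 0 - x j 0) ^+ 2 <=
       2 * (x0 * z j 0 - z0 * x j 0) ^+ 2 + 2 * ((x0 - z0) ^+ 2 * x j 0 ^+ 2).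
      set p := x0 * z j 0 - _; set q := (x0 - z0) * x j 0.
      have -> : x0 ^+ 2 * (z j 0 - x j 0) ^+ 2 = (p - q) ^+ 2 by rewrite /p /q; ring.
      have -> : (x0 - z0) ^+ 2 * x j 0 ^+ 2 = q ^+ 2 by rewrite /q; ring.
      by have := sqr_ge0 (p + q); nra.
    have c0 : 0 <= 4 * x0 ^+ 2 * c by have := mulr_ge0 x20 h0; lra.
    have := ler_wpM2l c0 (xi j j0); have : 0 <= 4 * x0 ^+ 2 * c * x0 ^+ 2 by rewrite mulr_ge0.
    lra.
  have s (p q r t v : R) : p ^+ 2 + q ^+ 2 + r ^+ 2 + t ^+ 2 = v ->
    [/\ p ^+ 2 <= v, q ^+ 2 <= v & r ^+ 2 <= v].
    move=> <-; have := sqr_ge0 p; have := sqr_ge0 q; have := sqr_ge0 r; have := sqr_ge0 t.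
    by split; lra.
  have [s1 s2 s3] := s _ _ _ _ _ h.
  move: i; apply: ord4P; last 3 first.
  + by apply: K => //; apply: le_trans hc.
  + by apply: K => //; apply: le_trans hc.
  + by apply: K => //; apply: le_trans hc.
  rewrite -(opprB (x 0 0)) sqrrN; apply: le_trans (le_trans hd hc) _.
  have := mulr_ge0 x20 h0; nra.
- have s0 : 0 <= sg X by case: (X) XH.
  have e : (z i 0 - x i 0) ^+ 2 <= chord X x z.
    have p j : 0 <= (x j 0 - z j 0) * (x j 0 - z j 0) by rewrite -expr2 sqr_ge0.
    have p0 := mulr_ge0 s0 (p 0); have := p o1; have := p o2; have := p o3.
    rewrite /chord /nf !sdotE !mxE => p3 p2 p1.
    move: i; apply: ord4P; try by rewrite expr2; lra.
    case: (X) XH hx hz p0 => //= _; first by rewrite expr2 !mul1r; lra.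
    by move=> -> ->; rewrite subrr; lra.
  apply: le_trans e _; have := mulr_ge0 x20 h0; nra.
Qed.

Definition base : 'cV[R]_4 := delta_mx 0 0.

Lemma space_base X : space X base.
Proof. by case: X; rewrite /= ?sdotE !mxE /= ?ltr01; try split=> //; ring. Qed.

(** Coordinate 0 of z is [bf X base z], hence an affine function of the chord, and the equation of
    the space bounds the others (in E^3, the chord itself does). Being valid at any distance, it
    serves compactness and counting arguments. *)
Lemma coord_bound X z i : space X z -> `|z i 0| <= 1 + chord X base z / 2.
Proof.
move=> hz; have c0 := chord_ge0 (space_base X) hz.
have bz := bf_chord (space_base X) hz.
have /= b1 : bf X base z = z 0 0 by rewrite /bf sdotE !mxE /=; ring.
have [hzz _] := (space_bf _ _).1 hz.
have [c hc] : {c | c = chord X base z} by exists (chord X base z).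
rewrite -hc in c0 bz *.
have hs : z o1 0 ^+ 2 + z o2 0 ^+ 2 + z o3 0 ^+ 2 <= (1 + c / 2) ^+ 2 /\ z 0 0 ^+ 2 <= (1 + c / 2) ^+ 2.
  have -> : z o1 0 ^+ 2 + z o2 0 ^+ 2 + z o3 0 ^+ 2 = sdot z z by rewrite sdotE; ring.
  move: bz hzz; rewrite b1 /bf; case: (X) hz hc => /= hz hc -> hzz; first by split; nra.
    split; last by nra.
    have -> : sdot z z = c.
      by move: hz => /= hz; rewrite hc /chord /nf !sdotE !mxE /=; ring.
    nra.
  by split; nra.
have c1 : 0 <= 1 + c / 2 by nra.
rewrite -(@ler_pXn2r _ 2) ?nnegrE // ?normr_ge0 // real_normK ?num_real //.
case: hs => + h; have := sqr_ge0 (z o1 0); have := sqr_ge0 (z o2 0); have := sqr_ge0 (z o3 0).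
by move: i; apply: ord4P => //; lra.
Qed.

End Geometry.

(** * A nondegenerate form at each point of the space *)

Section Forms.
Variable R : realType.
Implicit Types (X : geometry) (x y z u w : 'cV[R]_4) (g J : 'M[R]_4) (a : 'rV[R]_4).

Definition Jn X : 'M[R]_4 := diag_mx (\row_j if j == 0 then sg R X else 1).
Definition bl J u w : R := (u^T *m J *m w) 0 0.

Lemma blDl J u u' w : bl J (u + u') w = bl J u w + bl J u' w.
Proof. by rewrite /bl linearD /= !mulmxDl mxE. Qed.
Lemma blDr J u w w' : bl J u (w + w') = bl J u w + bl J u w'.
Proof. by rewrite /bl mulmxDr mxE. Qed.
Lemma blZl J c u w : bl J (c *: u) w = c * bl J u w.
Proof. by rewrite /bl linearZ /= -!scalemxAl mxE. Qed.
Lemma blZr J c u w : bl J u (c *: w) = c * bl J u w.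
Proof. by rewrite /bl -scalemxAr mxE. Qed.
Lemma blNl J u w : bl J (- u) w = - bl J u w.
Proof. by rewrite -scaleN1r blZl mulN1r. Qed.
Lemma blNr J u w : bl J u (- w) = - bl J u w.
Proof. by rewrite -scaleN1r blZr mulN1r. Qed.
Definition blE := (blDl, blDr, blNl, blNr, blZl, blZr).

Lemma trmx11 (A : 'M[R]_1) : A^T = A.
Proof. by apply/matrixP => i j; rewrite mxE !ord1. Qed.

Lemma bl_tr J u w : bl J^T u w = bl J w u.
Proof. by rewrite /bl -[w^T *m J *m u]trmx11 !trmx_mul trmxK mulmxA. Qed.

Lemma bl_mul J g u w : bl J (g *m u) (g *m w) = bl (g^T *m J *m g) u w.
Proof. by rewrite /bl trmx_mul !mulmxA. Qed.

Lemma bl_delta J i j : bl J (delta_mx i 0) (delta_mx j 0) = J i j.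
Proof. by rewrite /bl trmx_delta -mulmxA -rowE -colE !mxE. Qed.

Lemma bl_ext J J' : (forall u w, bl J u w = bl J' u w) -> J = J'.
Proof. by move=> h; apply/matrixP => i j; rewrite -!bl_delta. Qed.

Lemma bl_nondeg J w : J \in unitmx -> (forall u, bl J u w = 0) -> w = 0.
Proof.
move=> hJ h; rewrite -(mulKmx hJ w) (_ : J *m w = 0) ?mulmx0 //.
apply/colP=> i; have := h (delta_mx i 0).
by rewrite /bl trmx_delta -mulmxA -rowE !mxE => ->.
Qed.

Lemma JnE X u w : bl (Jn X) u w = nf X u w.
Proof.
rewrite /bl /nf sdotE /Jn mul_mx_diag mxE sum4 !mxE /=; ring.
Qed.

Lemma Jn_tr X : (Jn X)^T = Jn X. Proof. exact: tr_diag_mx. Qed.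

(* In the Euclidean case [Jn] is degenerate; it is completed by declaring [x] to
   be a unit vector orthogonal to the tangent vectors.  An isometry carries
   [pform X x] to [pform X (g *m x)]. *)
Definition pform X x : 'M[R]_4 :=
  if X is Euclidean then
    let P := 1%:M - x *m delta_mx 0 0 in delta_mx 0 0 + P^T *m Jn X *m P
  else Jn X.

Lemma pformE X x u w : bl (pform X x) u w =
  if X is Euclidean then u 0 0 * w 0 0 + nf X (u - u 0 0 *: x) (w - w 0 0 *: x)
  else nf X u w.
Proof.
case: X; rewrite /= ?JnE //.
have e v : (1%:M - x *m delta_mx 0 0) *m v = v - v 0 0 *: x.
  rewrite mulmxBl mul1mx -mulmxA -rowE; congr (_ - _); apply/colP => i.
  by rewrite mxE big_ord1 !mxE mulrC.
have -> J J' : bl (J + J') u w = bl J u w + bl J' u w.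
  by rewrite /bl mulmxDr mulmxDl mxE.
rewrite -bl_mul !e JnE; congr (_ + _).
by rewrite /bl -mulmxA mxE sum4 !mxE !sum4 !mxE /=; ring.
Qed.

Lemma pform_tr X x : (pform X x)^T = pform X x.
Proof.
apply: bl_ext => u w; rewrite bl_tr !pformE /nf !sdotE; case: X; ring.
Qed.

Lemma pform_sym X x u w : bl (pform X x) u w = bl (pform X x) w u.
Proof. by rewrite -bl_tr pform_tr. Qed.

Definition nu X (t : R) : R :=
  match X with Spherical => 1 | Euclidean => 1 + t | Hyperbolic => -1 end.

Lemma pform_nu X x z : space X x -> space X z -> bl (pform X x) z z = nu X (chord X x z).
Proof.
move=> hx hz; rewrite pformE /nu /chord; case: X hx hz => /= hx hz.
- by rewrite /nf /= mul1r -expr2.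
- by rewrite hz scale1r /nf !sdotE !mxE; ring.
- by case: hz => _ <-; rewrite /nf /=; ring.
Qed.

Lemma pform_chord X x y z : space X y -> space X z ->
  chord X y z = bl (pform X x) (y - z) (y - z).
Proof.
move=> hy hz; rewrite pformE /chord; case: X hy hz => //= hy hz.
by rewrite !mxE hy hz subrr mul0r add0r scale0r subr0.
Qed.

(** The chords alone determine the values of the form on points of the space; this is why a map
    preserving chords is linear. *)
Lemma pform_polar X x y z : space X x -> space X y -> space X z ->
  bl (pform X x) y z = (nu X (chord X x y) + nu X (chord X x z) - chord X y z) / 2.
Proof.
move=> hx hy hz; rewrite -!pform_nu // (pform_chord x hy hz) !blE (pform_sym _ x z y).
by field.
Qed.

Lemma pform_bf X x u : space X x -> bf X x u = 0 <-> bl (pform X x) x u = 0.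
Proof.
move=> hx; rewrite pformE /bf /nf sdotE; case: X hx => /= hx.
- by rewrite !mul1r.
- by rewrite !sdotE !mxE hx mul0r addr0 mul1r (_ : _ + _ = u 0 0)//; ring.
- by rewrite !mulN1r; split=> h; lra.
Qed.

Lemma pform_nf X x u : space X x -> bl (pform X x) x u = 0 ->
  bl (pform X x) u u = nf X u u.
Proof.
move=> hx /(pform_bf _ hx); rewrite pformE /bf; case: X hx => //= hx.
by rewrite hx !mul0r addr0 mul1r => ->; rewrite scale0r subr0 mul0r add0r.
Qed.

Lemma pform_ge0 X x u : space X x -> bl (pform X x) x u = 0 -> 0 <= bl (pform X x) u u.
Proof. by move=> hx h; rewrite pform_nf //; apply: (tangent_ge0 hx); apply/pform_bf. Qed.

Lemma pform_eq0 X x u : space X x -> bl (pform X x) x u = 0 ->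
  bl (pform X x) u u = 0 -> u = 0.
Proof.
move=> hx h; rewrite pform_nf //; apply: (tangent_eq0 hx); exact/pform_bf.
Qed.

Lemma pform_self X x : space X x -> bl (pform X x) x x != 0.
Proof.
move=> hx; rewrite pform_nu // chordxx; case: (X) => //=; rewrite ?oppr_eq0 ?addr0 oner_eq0 //.
Qed.

Lemma pform_unit X x : space X x -> pform X x \in unitmx.
Proof.
move=> hx; apply: unitmx_inj => u hu.
have h w : bl (pform X x) w u = 0 by rewrite /bl -mulmxA hu mulmx0 mxE.
exact: (pform_eq0 hx).
Qed.

(** Even where [Jn X] is singular, [Jn X *m a^T] represents the form a with respect to [pform X x],
    for any x in the plane of a: it is the normal vector of the plane. One formula for reflections
    thus covers the three geometries. *)
Lemma pform_dual X x a : space X x -> (a *m x) 0 0 = 0 ->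
  pform X x *m (Jn X *m a^T) = a^T.
Proof.
move=> hx ha; apply: (can_inj (@trmxK _ _ _)); apply/row_matrixP => k; rewrite !(ord1 k).
have e w : ((pform X x *m (Jn X *m a^T))^T *m w) 0 0 = (a *m w) 0 0.
  have m i' : (Jn X *m a^T) i' 0 = (if i' == 0 then sg R X else 1) * a 0 i'.
    by rewrite /Jn mul_diag_mx !mxE.
  rewrite trmx_mul pform_tr -/(bl _ _ _); move: (Jn X *m a^T) m => b m.
  rewrite pformE /nf !sdotE !mxE !sum4 !m; rewrite mulrow4 in ha; case: X hx ha m => /= hx ha m; [ring| |ring].
  rewrite hx in ha *.
  have a0 : a 0 0 = - (a 0 o1 * x o1 0 + a 0 o2 * x o2 0 + a 0 o3 * x o3 0) by lra.
  by rewrite a0; ring.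
rewrite trmxK; apply/rowP => j; have := e (delta_mx j 0).
by rewrite -!colE !mxE.
Qed.

(** Membership of z in the space, read off from the values s of the form at (z, z) and t at (x, z).
    A matrix carrying the form at x to the form at its image preserves both. *)
Definition member X (s t : R) : Prop :=
  match X with Spherical => s = 1 | Euclidean => t = 1 | Hyperbolic => s = -1 /\ t < 0 end.

Lemma pform_member X x z : space X x ->
  space X z <-> member X (bl (pform X x) z z) (bl (pform X x) x z).
Proof.
move=> hx; rewrite !pformE /nf !sdotE; case: X hx => hx.
- by rewrite /= !sdotE !mul1r expr2.
- by move: hx => /= hx; rewrite !mxE hx; split => h; lra.
- split=> hz.
    have hz1 := chord_ge0 hx hz; have hz2 := bf_chord hx hz.
    move: hz2; rewrite /bf /= => hz2.
    by move: hx hz; rewrite /= !sdotE in hz2 * => -[px qx] [pz qz]; split; lra.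
  move: hz; rewrite /member /= => hz.
  (* If z were on the lower sheet, -z would be in the space, and the product with x would have the
     wrong sign. *)
  have s : 0 < z 0 0.
    rewrite ltNge; apply/negP => nz.
    have [z0|z0] := eqVneq (z 0 0) 0.
      move: hz; rewrite z0 => -[+ _]; have := sqr_ge0 (z o1 0); have := sqr_ge0 (z o2 0).
      have := sqr_ge0 (z o3 0); rewrite !expr2; lra.
    have hz' : space Hyperbolic (- z).
      split; first by rewrite mxE oppr_gt0 lt_neqAle z0.
      by rewrite sdotE !mxE; rewrite expr2; case: hz => hz _; lra.
    have hz1 := chord_ge0 hx hz'; have hz2 := bf_chord hx hz'.
    move: hz2; rewrite /bf /= sdotE !mxE => hz2.
    by case: hz => _; lra.
  by split=> //; rewrite sdotE; case: hz; lra.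
Qed.

End Forms.

(** * Isometries *)

Section Isometries.
Variable R : realType.
Implicit Types (X : geometry) (x y z u w : 'cV[R]_4) (g h J : 'M[R]_4) (a : 'rV[R]_4).

Lemma space_opp x : space Spherical x -> space Spherical (- x).
Proof. by rewrite /= !sdotE !mxE => h; lra. Qed.

Lemma chord_le4 x y : space Spherical x -> space Spherical y -> chord Spherical x y <= 4.
Proof.
move=> hx hy; have := chord_ge0 (space_opp hx) hy; move: hx hy.
by rewrite /chord /nf /= !sdotE !mxE => hx hy h; lra.
Qed.

(** The possible squared chords; on the sphere the largest one, 4, belongs to antipodal points, and
    [phi] is strictly increasing up to there. *)
Definition phi_dom X (t : R) : bool := (0 <= t) && (if X is Spherical then t <= 4 else true).

Lemma chord_dom X x y : space X x -> space X y -> phi_dom X (chord X x y).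
Proof.
move=> hx hy; rewrite /phi_dom chord_ge0 //; case: X hx hy => // hx hy.
exact: chord_le4.
Qed.

Lemma phi_lt X s t : phi_dom X s -> phi_dom X t -> s < t -> phi X s < phi X t.
Proof.
rewrite /phi_dom; case: X => /=; rewrite ?andbT.
- move=> /andP[s0 s4] /andP[t0 t4] st.
  have hs : 1 - s / 2 \in `[(-1 : R), 1] by rewrite in_itv /=; lra.
  have ht : 1 - t / 2 \in `[(-1 : R), 1] by rewrite in_itv /=; lra.
  rewrite -ltr_cos ?acosK //; first by lra.
    by move: ht; rewrite !in_itv /= => ht; rewrite acos_ge0 // acos_lepi.
  by move: hs; rewrite !in_itv /= => hs; rewrite acos_ge0 // acos_lepi.
- by move=> s0 t0 st; rewrite ltr_sqrt // (le_lt_trans s0).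
- move=> s0 t0 st; rewrite /arcosh ltr_ln ?posrE.
  + by apply: ltr_leD; [lra|rewrite ler_wsqrtr //; nra].
  + by apply: ltr_pwDl; [lra|exact: sqrtr_ge0].
  + by apply: ltr_pwDl; [lra|exact: sqrtr_ge0].
Qed.

Lemma phi_le X s t : phi_dom X s -> phi_dom X t -> (phi X s <= phi X t) = (s <= t).
Proof.
move=> hs ht; case: (leP s t) => st.
  by move: st; rewrite le_eqVlt => /orP[/eqP->|st]; rewrite ?lexx // ltW // phi_lt.
by apply/negbTE; rewrite -ltNge; apply: phi_lt.
Qed.

Lemma phi_inj X s t : phi_dom X s -> phi_dom X t -> phi X s = phi X t -> s = t.
Proof. by move=> hs ht e; apply/eqP; rewrite eq_le -!(phi_le hs ht, phi_le ht hs) e lexx. Qed.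

Lemma isometry_space X g x : isometry X g -> space X x -> space X (g *m x).
Proof. by move=> [e _] hx; rewrite -e; exists x. Qed.

Lemma isometry_chord X g x y : isometry X g -> space X x -> space X y ->
  chord X (g *m x) (g *m y) = chord X x y.
Proof.
move=> hg hx hy; apply: (@phi_inj X); do ?exact/chord_dom; do ?exact: isometry_space.
  by apply: chord_dom; apply: isometry_space.
by rewrite -!distE //; [apply: hg.2|exact: isometry_space|exact: isometry_space].
Qed.

Lemma isometryP X g : g \in unitmx ->
  (forall x, space X x -> space X (g *m x)) ->
  (forall x, space X x -> space X (invmx g *m x)) ->
  (forall x y, space X x -> space X y -> chord X (g *m x) (g *m y) = chord X x y) ->
  isometry X g.
Proof.
move=> gU h1 h2 h3; split=> [|x y hx hy]; last by rewrite !distE ?h3 //; apply: h1.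
apply/seteqP; split=> [_ [x hx <-]|x hx]; first exact: h1.
by exists (invmx g *m x); [exact: h2|rewrite mulKVmx].
Qed.

Lemma preserves_member X g x : space X x -> space X (g *m x) ->
  g^T *m pform X (g *m x) *m g = pform X x ->
  (forall z, space X z -> space X (g *m z)) /\
  (forall z y, space X z -> space X y -> chord X (g *m z) (g *m y) = chord X z y).
Proof.
move=> hx hgx hg.
have H z : space X z -> space X (g *m z).
  by move=> /(pform_member _ hx); rewrite -hg -!bl_mul => /(pform_member _ hgx).
split=> // z y hz hy.
rewrite (pform_chord x hz hy) (pform_chord (g *m x) (H _ hz) (H _ hy)) -mulmxBr bl_mul hg //.
Qed.

(** One point is enough: [pform_member] and [pform_chord] express the space and all chords through
    the form at that point. *)
Lemma pform_isometry X g x : space X x -> space X (g *m x) ->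
  g^T *m pform X (g *m x) *m g = pform X x -> isometry X g.
Proof.
move=> hx hgx hg; have [h1 h2] := preserves_member hx hgx hg.
have gU : g \in unitmx.
  by have := pform_unit hx; rewrite -hg unitmx_mul => /andP[].
have hi : invmx g *m (g *m x) = x by rewrite mulKmx.
have hg' : (invmx g)^T *m pform X (invmx g *m (g *m x)) *m invmx g = pform X (g *m x).
  by rewrite hi -hg !mulmxA -trmx_mul mulmxV // trmx1 mul1mx mulmxK.
have [h3 _] := @preserves_member X (invmx g) _ hgx (eq_ind_r _ hx hi) hg'.
exact: isometryP.
Qed.

(** * Radial projection, limits and frames near a point *)

Section Cone.
Variable X : geometry.

(** The vectors with a positive multiple in the space. Segments and perturbations are formed
    linearly in this open cone and brought back by [rho]. *)
Definition cone u : Prop := 0 < bf X u u /\ upper X u.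
Definition rho u : 'cV[R]_4 := (Num.sqrt (bf X u u))^-1 *: u.

Lemma bfZ (c : R) u : bf X (c *: u) (c *: u) = c ^+ 2 * bf X u u.
Proof. by rewrite /bf !sdotE !mxE; ring. Qed.

Lemma rho_space u : cone u -> space X (rho u).
Proof.
move=> [h1 h2]; apply/space_bf; rewrite /rho bfZ exprVn sqr_sqrtr ?ltW // mulVf ?gt_eqF //.
by split=> //; move: h2; rewrite /upper mxE; case: (X) h1 => //= h1 h2; rewrite mulr_gt0 // invr_gt0 sqrtr_gt0.
Qed.

Lemma rho_scale u : cone u -> exists2 c, 0 < c & rho u = c *: u.
Proof. by move=> [h _]; exists (Num.sqrt (bf X u u))^-1; rewrite ?invr_gt0 ?sqrtr_gt0. Qed.

Lemma rho_id x : space X x -> rho x = x.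
Proof. by move=> /space_bf[h _]; rewrite /rho h sqrtr1 invr1 scale1r. Qed.

Lemma space_cone x : space X x -> cone x.
Proof. by move=> /space_bf[h ?]; split=> //; rewrite h. Qed.

Lemma space_scale x (c : R) : 0 <= c -> space X x -> space X (c *: x) -> c = 1.
Proof.
move=> c0 /space_bf[h _] /space_bf[+ _]; rewrite bfZ h mulr1.
by move=> /eqP; rewrite sqrf_eq1 => /orP[/eqP//|/eqP c1]; move: c0; rewrite c1; lra.
Qed.

Lemma space_neq0 x : space X x -> x != 0.
Proof.
move=> /space_bf[h _]; apply/eqP => x0; move: h; rewrite x0 /bf !sdotE !mxE.
by rewrite !mulr0 !addr0 mulr0 addr0 => /eqP; rewrite eq_sym oner_eq0.
Qed.

Section Limits.
Context {T : Type} {F : set_system T} {FF : Filter F} {f : T -> 'cV[R]_4} {x : 'cV[R]_4}.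
Hypothesis fx : f @ F --> x.

Lemma coord_cvg i : (fun t => f t i 0) @ F --> x i 0.
Proof. exact: (cvg_comp _ _ fx (@coord_continuous R 4 1 i 0 x)). Qed.

Lemma bf_cvg : (fun t => bf X (f t) (f t)) @ F --> bf X x x.
Proof.
rewrite (_ : (fun t => _) = (fun t => f t 0 0 * f t 0 0 + sg R X *
  (f t o1 0 * f t o1 0 + f t o2 0 * f t o2 0 + f t o3 0 * f t o3 0))).
  rewrite /bf sdotE; apply: cvgD; first by apply: cvgM; exact: coord_cvg.
  apply: cvgM; first exact: cvg_cst.
  by apply: cvgD; [apply: cvgD|]; apply: cvgM; exact: coord_cvg.
by apply/funext=> u; rewrite /bf sdotE.
Qed.

Lemma chord_cvg y : (fun t => chord X y (f t)) @ F --> chord X y x.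
Proof.
rewrite (_ : (fun t => _) = (fun t => sg R X * ((y 0 0 - f t 0 0) * (y 0 0 - f t 0 0)) +
  ((y o1 0 - f t o1 0) * (y o1 0 - f t o1 0) +
  (y o2 0 - f t o2 0) * (y o2 0 - f t o2 0) + (y o3 0 - f t o3 0) * (y o3 0 - f t o3 0)))).
  have c i : (fun t => y i 0 - f t i 0) @ F --> y i 0 - x i 0.
    by apply: cvgB; [exact: cvg_cst|exact: coord_cvg].
  rewrite /chord /nf sdotE !mxE; apply: cvgD.
    by apply: cvgM; [exact: cvg_cst|apply: cvgM].
  by apply: cvgD; [apply: cvgD|]; apply: cvgM.
by apply/funext=> u; rewrite /chord /nf sdotE !mxE.
Qed.

Lemma row_cvg a : (fun t => (a *m f t) 0 0) @ F --> (a *m x) 0 0.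
Proof.
rewrite (_ : (fun t => _) = (fun t => a 0 0 * f t 0 0 + a 0 o1 * f t o1 0 +
   a 0 o2 * f t o2 0 + a 0 o3 * f t o3 0)).
  by rewrite mulrow4; do 3?apply: cvgD; apply: cvgM; (exact: cvg_cst || exact: coord_cvg).
by apply/funext => u; rewrite mulrow4.
Qed.

Lemma rho_cvg : cone x -> (fun t => rho (f t)) @ F --> rho x.
Proof.
move=> [h _]; apply: cvgZ => //.
apply: cvgV; first by rewrite gt_eqF // sqrtr_gt0.
by apply: (@continuous_cvg _ _ _ _ _ _ (@Num.sqrt R)); [exact: sqrt_continuous|exact: bf_cvg].
Qed.

End Limits.

Lemma near_row_gt0 a x : 0 < (a *m x) 0 0 -> \forall z \near x, 0 < (a *m z) 0 0.
Proof. move=> h; have := @row_cvg _ (nbhs x) (nbhs_filter x) id x (@cvg_id _ (nbhs x)) a.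
by move=> /cvgr_gt /(_ _ h). Qed.

Lemma near_chord x (e : R) : 0 < e -> \forall z \near x, chord X x z < e.
Proof. move=> e0; have := @chord_cvg _ (nbhs x) (nbhs_filter x) id x (@cvg_id _ (nbhs x)) x.
by rewrite chordxx => /cvgr_lt /(_ _ e0). Qed.

Lemma near_cone x : cone x -> \forall z \near x, cone z.
Proof.
move=> [h1 h2]; have n1 : \forall z \near x, 0 < bf X z z.
  by apply: (cvgr_gt _ (bf_cvg (@cvg_id _ (nbhs x)))).
have n2 : \forall z \near x, upper X z.
  rewrite /upper; case: (X) h2 => h2; [by apply: (@filterE _ _ (nbhs_filter x))| |].
    by have := @coord_cvg _ (nbhs x) id x (@cvg_id _ (nbhs x)) 0; move=> /cvgr_gt /(_ _ h2).
  by have := @coord_cvg _ (nbhs x) id x (@cvg_id _ (nbhs x)) 0; move=> /cvgr_gt /(_ _ h2).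
by near=> z; split; near: z.
Unshelve. all: by end_near. Qed.

Lemma line_cvg x u (s0 : R) : (fun s : R => x + s *: u) @ s0 --> x + s0 *: u.
Proof. by apply: cvgD; [exact: cvg_cst|apply: cvgZ; [exact: cvg_id|exact: cvg_cst]]. Qed.

Lemma near_line x u (P : set 'cV[R]_4) : space X x -> (\forall z \near x, P z) ->
  exists2 e : R, 0 < e & forall s, `|s| < e -> cone (x + s *: u) /\ P (rho (x + s *: u)).
Proof.
move=> hx hP.
have xc : cone (x + 0 *: u) by rewrite scale0r addr0; exact: space_cone.
have c1 := @line_cvg x u 0.
have c2 : (fun s : R => rho (x + s *: u)) @ (0 : R) --> x.
  have := @rho_cvg _ _ (nbhs_filter (0 : R)) _ _ c1 xc.
  by rewrite [X in rho (x + X)]scale0r addr0 rho_id.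
have n1 : \forall s \near (0 : R), cone (x + s *: u) by apply: c1; exact: near_cone.
have n2 : \forall s \near (0 : R), P (rho (x + s *: u)) by apply: c2.
have [e /= e0 he] := (nbhs_ballP _ _).1 (filterI n1 n2).
exists e => // s hs; apply: (he s).
by rewrite /ball /= sub0r normrN.
Qed.

(** The columns are positive multiples of those of [s 1 + x (1,1,1,1)], whose determinant is
    [s^3 (s + sum x_i)]. *)
Lemma frame_near x (P : set 'cV[R]_4) : space X x -> (\forall z \near x, P z) ->
  exists2 F : 'M[R]_4, F \in unitmx & forall j, space X (col j F) /\ P (col j F).
Proof.
move=> hx hP.
have H j := near_line (delta_mx j 0) hx hP.
have [e e0 he] : exists2 e : R, 0 < e & forall j s, `|s| < e ->
    cone (x + s *: delta_mx j 0) /\ P (rho (x + s *: delta_mx j 0)).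
  case: (H 0) => t0 p0 h0; case: (H o1) => t1 p1 h1; case: (H o2) => t2 p2 h2.
  case: (H o3) => t3 p3 h3; exists (Num.min (Num.min t0 t1) (Num.min t2 t3)).
    by rewrite !lt_min p0 p1 p2 p3.
  move=> j s; rewrite !lt_min => /andP[/andP[s0 s1] /andP[s2 s3]].
  by move: j; apply: ord4P; auto.
(* Of the candidates [e / 2] and [e / 4] at most one makes the determinant vanish. *)
have [s [s0 hs ss]] : exists s : R, [/\ s != 0, `|s| < e & s + \sum_i x i 0 != 0].
  have [z0|z0] := eqVneq (e / 2 + \sum_i x i 0) 0.
    exists (e / 4); rewrite gtr0_norm ?divr_gt0 //; split; first by rewrite gt_eqF // divr_gt0.
      lra.
    by apply/eqP => z1; lra.
  exists (e / 2); rewrite gtr0_norm ?divr_gt0 //; split => //; first by rewrite gt_eqF // divr_gt0.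
  lra.
exists (\matrix_(i, j) rho (x + s *: delta_mx j 0) i 0); last first.
  move=> j; have [hc hp] := he j s hs.
  have -> : col j (\matrix_(i, j) rho (x + s *: delta_mx j 0) i 0) = rho (x + s *: delta_mx j 0).
    by apply/colP => i; rewrite !mxE.
  by split=> //; apply: rho_space.
have lam j : exists2 c, 0 < c & rho (x + s *: delta_mx j 0) = c *: (x + s *: delta_mx j 0).
  by apply: rho_scale; have [] := he j s hs.
apply: unitmx_inj => u hu.
pose c j := (Num.sqrt (bf X (x + s *: delta_mx j 0) (x + s *: delta_mx j 0)))^-1.
have cn0 j : c j != 0.
  by have [[h _] _] := he j s hs; rewrite /c gt_eqF // invr_gt0 sqrtr_gt0.
pose S := \sum_j c j * u j 0.
have hS i : S * x i 0 + s * (c i * u i 0) = 0.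
  have := congr1 (fun m : 'cV_4 => m i 0) hu; rewrite !mxE => <-.
  transitivity (\sum_j (c j * u j 0 * x i 0 + s * (c j * u j 0) * (j == i)%:R)).
    rewrite big_split /= -mulr_suml; congr (_ + _).
    by rewrite (bigD1 i) //= eqxx mulr1 big1 ?addr0 // => j /negbTE ->; rewrite mulr0.
  by apply: eq_bigr => j _; rewrite !mxE andbT eq_sym -/(c j); ring.
have S0 : S = 0.
  have : (s + \sum_i x i 0) * S = 0.
    rewrite mulrDl mulr_suml {1}/S mulr_sumr -big_split /= big1 // => i _.
    by rewrite -[RHS](hS i); ring.
  by move=> /eqP; rewrite mulf_eq0 (negbTE ss) => /eqP.
apply/colP => i; have := hS i; rewrite S0 mul0r add0r mxE => /eqP.
by rewrite !mulf_eq0 (negbTE s0) (negbTE (cn0 i)) => /eqP.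
Qed.

End Cone.

End Isometries.

(** * Rigidity and extension of isometries; connectedness *)

Section Extension.
Variable R : realType.
Implicit Types (X : geometry) (x y z u w : 'cV[R]_4) (g h J : 'M[R]_4) (a : 'rV[R]_4).

Lemma chord_near X x (P : set 'cV[R]_4) : space X x -> (\forall z \near x, P z) ->
  exists2 e : R, 0 < e & forall z, space X z -> chord X x z < e -> P z.
Proof.
move=> hx hP; have [e /= e0 he] := (nbhs_ballP _ _).1 hP.
have c0 : 0 < 16 * (1 + x 0 0 ^+ 2) by have := sqr_ge0 (x 0 0); lra.
exists (Num.min 1 (e ^+ 2 / (16 * (1 + x 0 0 ^+ 2)))).
  by rewrite lt_min ltr01 divr_gt0 // exprn_gt0.
move=> z hz; rewrite lt_min => /andP[z1 z2]; apply: he.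
split=> // i j; rewrite (ord1 j) /ball /= distrC.
have := coord_near i hx hz (ltW z1) => h.
rewrite -(ltr_pXn2r (_ : (0 < 2)%N)) ?nnegrE ?normr_ge0 ?(ltW e0) //.
rewrite real_normK ?num_real //; apply: le_lt_trans h _.
by rewrite mulrC -ltr_pdivlMr.
Qed.

Lemma isometry_gram X x x' (F F' : 'M[R]_4) : space X x -> space X x' ->
  (forall j, space X (col j F)) -> (forall j, space X (col j F')) ->
  (forall j, chord X x' (col j F') = chord X x (col j F)) ->
  (forall i j, chord X (col i F') (col j F') = chord X (col i F) (col j F)) ->
  F'^T *m pform X x' *m F' = F^T *m pform X x *m F.
Proof.
move=> hx hx' hF hF' h1 h2; apply/matrixP => i j.
rewrite -!bl_delta -!bl_mul -!colE !pform_polar //.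
by rewrite !h1 h2.
Qed.

Lemma col_mul (g F : 'M[R]_4) j : col j (g *m F) = g *m col j F.
Proof. by rewrite !colE mulmxA. Qed.

(** Converse of [pform_isometry]: equal chords give a frame and its image the same Gram matrix, and
    the invertible frame cancels. *)
Lemma isometry_pform X g x : isometry X g -> space X x ->
  g^T *m pform X (g *m x) *m g = pform X x.
Proof.
move=> hg hx; have [F FU hF] := @frame_near R X x setT hx filterT.
have hF' j : space X (col j F) by have [] := hF j.
have hgF j : space X (col j (g *m F)) by rewrite col_mul; apply: isometry_space.
have := isometry_gram hx (isometry_space hg hx) hF' hgF.
rewrite trmx_mul !mulmxA; move=> e.
have {}e : F^T *m (g^T *m pform X (g *m x) *m g) *m F = F^T *m pform X x *m F.
  by rewrite !mulmxA; apply: e => *; rewrite !col_mul isometry_chord.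
by apply: (can_inj (mulKmx (_ : F^T \in unitmx))); rewrite ?unitmx_tr //;
  apply: (can_inj (mulmxK FU)).
Qed.

Lemma isometry_unit X g : isometry X g -> g \in unitmx.
Proof.
move=> hg; have hx := space_base R X.
have := pform_unit hx; rewrite -(isometry_pform hg hx).
by rewrite unitmx_mul => /andP[].
Qed.

Lemma isometry_mul X g h : isometry X g -> isometry X h -> isometry X (g *m h).
Proof.
move=> hg hh; have hx := space_base R X.
have hhx := isometry_space hh hx; have hghx := isometry_space hg hhx.
apply: (pform_isometry hx); rewrite -mulmxA // trmx_mul.
have := isometry_pform hg hhx; have := isometry_pform hh hx.
by move=> <- <-; rewrite !mulmxA.
Qed.

Lemma isometry1 X : isometry X (1%:M : 'M[R]_4).
Proof.
have hx := space_base R X; apply: (pform_isometry hx); rewrite mul1mx //.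
by rewrite trmx1 mul1mx mulmx1.
Qed.

Lemma isometry_inv X g : isometry X g -> isometry X (invmx g).
Proof.
move=> hg; have gU := isometry_unit hg.
have [hs _] := hg.
have hi x : space X x -> space X (invmx g *m x).
  by rewrite -{1}hs => -[y hy <-]; rewrite mulKmx.
apply: isometryP; rewrite ?unitmx_inv ?invmxK //.
  by move=> x; apply: isometry_space.
move=> x y hx hy; rewrite -(isometry_chord hg) ?mulKVmx //; exact: hi.
Qed.

Lemma isometry_ext X x g h (P : set 'cV[R]_4) : space X x -> (\forall z \near x, P z) ->
  (forall z, space X z -> P z -> g *m z = h *m z) -> g = h.
Proof.
move=> hx hP e; have [F FU hF] := frame_near hx hP.
apply: (can_inj (mulmxK FU)); apply/matrixP => i j.
have [h1 h2] := hF j; have := e _ h1 h2; rewrite -!col_mul.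
by move=> /(congr1 (fun m : 'cV_4 => m i 0)); rewrite [LHS]mxE [RHS]mxE.
Qed.

(** Take h to agree with f on a frame inside U. Gram matrices show that h preserves the forms; for
    any other z in U, the difference [f z - h *m z] is orthogonal to the image frame, hence zero. *)
Lemma isometry_extend X x (U : set 'cV[R]_4) (f : 'cV[R]_4 -> 'cV[R]_4) :
  space X x -> (\forall z \near x, U z) ->
  (forall z, space X z -> U z -> space X (f z)) ->
  (forall y z, space X y -> U y -> space X z -> U z -> chord X (f y) (f z) = chord X y z) ->
  exists2 h, isometry X h & forall z, space X z -> U z -> f z = h *m z.
Proof.
move=> hx hU hf hc; have [F FU hF] := frame_near hx hU.
have hF1 j : space X (col j F) by have [] := hF j.
have hF2 j : U (col j F) by have [] := hF j.
have Ux : U x by exact: nbhs_singleton hU.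
pose F' := \matrix_(i, j) f (col j F) i 0.
have cF' j : col j F' = f (col j F) by apply/colP => i; rewrite !mxE.
have hF'1 j : space X (col j F') by rewrite cF'; apply: hf.
have [h hF'] : exists h, h *m F = F' by exists (F' *m invmx F); rewrite mulmxKV.
have hfx := hf _ hx Ux.
have e1 : F'^T *m pform X (f x) *m F' = F^T *m pform X x *m F.
  by apply: isometry_gram => // *; rewrite !cF' hc.
have F'U : F' \in unitmx.
  have : F^T *m pform X x *m F \in unitmx.
    by rewrite !unitmx_mul unitmx_tr FU pform_unit.
  by rewrite -e1 unitmx_mul => /andP[].
have e2 : h^T *m pform X (f x) *m h = pform X x.
  have : F^T *m (h^T *m pform X (f x) *m h) *m F = F^T *m pform X x *m F.
    by rewrite -e1 -hF' trmx_mul !mulmxA.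
  by move=> /(can_inj (mulmxK FU)) /(can_inj (mulKmx _)); apply; rewrite unitmx_tr.
have e3 z : space X z -> U z -> f z = h *m z.
  move=> hz Uz; apply: subr0_eq.
  apply: (bl_nondeg (pform_unit hfx)) => u; rewrite -[u](mulKVmx F'U).
  move: (invmx F' *m u) => {}u.
  have d j : bl (pform X (f x)) (col j F') (f z - h *m z) = 0.
    rewrite blDr blNr [in X in _ - X](_ : col j F' = h *m col j F); last by rewrite -col_mul hF'.
    rewrite bl_mul e2 (pform_polar hfx (hF'1 j) (hf _ hz Uz)) (pform_polar hx (hF1 j) hz).
    by rewrite cF' !hc // subrr.
  rewrite /bl trmx_mul -!mulmxA mxE big1 // => j _.
  have := d j; rewrite /bl tr_col -mulmxA -row_mul.
  by rewrite [X in X = _ -> _]mxE => ->; rewrite mulr0.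
exists h => //; apply: (pform_isometry hx); rewrite -e3 //.
Qed.

(** The segment from x to y, projected by [rho], joins them inside the space; this fails only for
    antipodal points of the sphere. *)
Lemma space_connected X (o : 'cV[R]_4 -> bool) :
  (forall x, space X x -> \forall y \near within (space X) (nbhs x), o y = o x) ->
  forall x y, space X x -> space X y -> o x = o y.
Proof.
move=> ho.
have H x y : space X x -> space X y -> x + y != 0 -> o x = o y.
  move=> hx hy xy.
  have hc t : 0 <= t <= 1 -> cone X (x + t *: (y - x)).
    move=> t01.
    suff: 0 < bf X (x + t *: (y - x)) (x + t *: (y - x)) /\ upper X (x + t *: (y - x)) by [].
    have := bf_chord hx hy.
    have := (space_bf _ _).1 hx; have := (space_bf _ _).1 hy.
    have -> : bf X (x + t *: (y - x)) (x + t *: (y - x)) =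
       (1 - t) ^+ 2 * bf X x x + t ^+ 2 * bf X y y + 2 * t * (1 - t) * bf X x y.
      by rewrite /bf !sdotE !mxE; ring.
    move=> [-> uy] [-> ux] ->.
    have c0 := chord_ge0 hx hy; case/andP: t01 => t0 t1.
    split; last first.
      by move: ux uy; rewrite /upper !mxE; case: (X) => // ux uy; nra.
    (* On the sphere this is smallest at [t = 1/2], with value [1 - chord / 4], which is positive
       because x and y are not antipodal. *)
    rewrite (_ : _ + _ = 1 - t * (1 - t) * (sg R X * chord X x y)); last by field.
    have tt : 0 <= t * (1 - t) by nra.
    have t4 : t * (1 - t) <= 4^-1 by have := sqr_ge0 (t - 2^-1); lra.
    move: c0; case: (X) hx hy => /= hx hy c0; [|lra|nra].
    have : chord Spherical x y < 4.
      rewrite lt_neqAle chord_le4 // andbT; apply/eqP => c4.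
      have := chord_eq0 (space_opp hx) hy; have -> : chord Spherical (- x) y = 4 - chord Spherical x y.
        by move: hx hy; rewrite /chord /nf /= !sdotE !mxE => hx hy; lra.
      by rewrite c4 subrr => /(_ erefl) e; move: xy; rewrite -e subrr eqxx.
    nra.
  pose p t := rho X (x + t *: (y - x)).
  have p0 : p 0 = x by rewrite /p scale0r addr0 rho_id.
  have p1 : p 1 = y by rewrite /p scale1r addrC subrK rho_id.
  have loc (t : R) : 0 <= t <= 1 -> \forall s \near t, o (p s) = o (p t).
    move=> t01; have ct := hc t t01.
    have c1 := @line_cvg R x (y - x) t.
    have c2 := @rho_cvg R X _ _ (nbhs_filter t) _ _ c1 ct.
    have n1 : \forall s \near t, cone X (x + s *: (y - x)) by apply: c1; exact: near_cone.
    have n2 : \forall s \near t, space X (p s) -> o (p s) = o (p t).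
      exact: (c2 _ (ho _ (rho_space ct))).
    near=> s; have h2 : space X (p s) -> o (p s) = o (p t) by near: s.
    by apply: h2; apply: rho_space; near: s.
  pose f t : R := (o (p t))%:R.
  have fc : {within `[0, 1], continuous f}.
    apply: continuous_in_subspaceT => t; rewrite inE /= in_itv /= => t01.
    apply: cvg_near_cst; near=> s; rewrite /f; congr (_ %:R).
    by congr nat_of_bool; near: s; exact: loc.
  (* A boolean read as 0 or 1 never takes the value 1/2. *)
  have := @IVT _ _ 0 1 2^-1 ler01 fc.
  rewrite /f p0 p1; case: (o x); case: (o y) => //= h.
  + have [c _] : exists2 c : R, c \in `[0, 1] & (o (p c))%:R = 2^-1 :> R.
      by apply: h; rewrite ge_min le_max; lra.
    by case: (o _) => /=; lra.
  + have [c _] : exists2 c : R, c \in `[0, 1] & (o (p c))%:R = 2^-1 :> R.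
      by apply: h; rewrite ge_min le_max; lra.
    by case: (o _) => /=; lra.
move=> x y hx hy.
have [xy|xy] := eqVneq (x + y) 0; last exact: H.
have ey : y = - x by apply/eqP; rewrite -addr_eq0 addrC xy.
(* Antipodal points are joined through a third one: [base] or, if x is [base] up to sign, a vector
   orthogonal to it. *)
have [z hz [xz yz]] : exists2 z, space X z & x + z != 0 /\ z + y != 0.
  have XS : X = Spherical.
    have := (space_bf _ _).1 hx; have := (space_bf _ _).1 hy; rewrite ey /upper mxE.
    by case: (X) => // -[_ u1] [_ u2]; move: u1; rewrite oppr_gt0 ltNge ltW.
  rewrite ey; clear H xy ey; have S1 : space Spherical (delta_mx o1 0 : 'cV[R]_4).
    by rewrite /= sdotE !mxE /=; ring.
  have [b|b] := boolP ((x + base R != 0) && (base R - x != 0)).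
    by exists (base R); [exact: space_base|exact/andP].
  exists (delta_mx o1 0); first by rewrite XS.
  have x0 : x 0 0 != 0.
    clear XS; move: b; rewrite negb_and !negbK => /orP[]/eqP/(congr1 (fun m : 'cV_4 => m 0 0));
    rewrite !mxE /= => b; apply/eqP => x0; lra.
  clear XS b; split; apply/eqP => /(congr1 (fun m : 'cV_4 => m 0 0)); rewrite !mxE /= => b;
    move/eqP: x0; lra.
by rewrite (H x z) // (H z y).
Unshelve. all: by end_near. Qed.

End Extension.

(** * Orientation of isometric quotients *)

Section Quotients.
Variable R : realType.
Implicit Types (X : geometry) (x y z u w : 'cV[R]_4) (g h k : 'M[R]_4) (G K : set 'M[R]_4).

Lemma finite_pos_lbound (T : choiceType) (A : set T) (f : T -> R) : finite_set A ->
  (forall t, A t -> 0 < f t) -> exists2 d : R, 0 < d & forall t, A t -> d <= f t.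
Proof.
move=> /finite_seqP[s ->]; elim: s => [|t s IH] /= h; first by exists 1.
have [|d d0 hd] := IH; first by move=> v vs; apply: h; rewrite inE vs orbT.
exists (Num.min (f t) d); first by rewrite lt_min d0 h // inE eqxx.
move=> v; rewrite inE => /orP[/eqP->|vs]; first by rewrite ge_min lexx.
by rewrite ge_min (hd v) // orbT.
Qed.

Lemma chord_tri2 X (e : R) : 0 < e -> exists2 d : R, 0 < d &
  forall x y z, space X x -> space X y -> space X z ->
    chord X x y < d -> chord X y z < d -> chord X x z < e.
Proof.
(* As [s < 2], the bound [2 s + s^2 / 4] is at most [5 s / 2], and [s < 2 e / 5]. *)
move=> e0; exists (Num.min 1 (e / 5)); first by rewrite lt_min ltr01 divr_gt0.
move=> x y z hx hy hz; rewrite !lt_min => /andP[a1 a2] /andP[b1 b2].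
have := chord_triangle hx hy hz; have := chord_ge0 hx hy; have := chord_ge0 hy hz.
set a := chord X x y in a1 a2 *; set b := chord X y z in b1 b2 * => b0 a0 /= h.
apply: (le_lt_trans h); nra.
Qed.

Lemma chord_tri3 X (e : R) : 0 < e -> exists2 d : R, 0 < d &
  forall x y z w, space X x -> space X y -> space X z -> space X w ->
    chord X x y < d -> chord X y z < d -> chord X z w < d -> chord X x w < e.
Proof.
move=> e0; have [d d0 hd] := chord_tri2 X e0; have [c c0 hc] := chord_tri2 X d0.
exists (Num.min c d); first by rewrite lt_min c0.
move=> x y z w hx hy hz hw; rewrite !lt_min => /andP[a1 a2] /andP[b1 b2] /andP[c1 c2].
exact: (hd x z w) (hc _ _ _ hx hy hz a1 b1) c2.
Qed.

Lemma trmx_cvg m n (u : 'M[R]_(m, n)) : (@trmx R m n) @ u --> u^T.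
Proof.
move=> P /= hP; have [e /= e0 he] := (nbhs_ballP _ _).1 hP.
apply/(nbhs_ballP _ _).2; exists e => //= v [_ hv]; apply: he; split=> // i j.
by rewrite !mxE; apply: hv.
Qed.

Lemma closed_preimage (f : 'rV[R]_4 -> R) (D : set R) :
  (forall v : 'rV[R]_4, f @ v --> f v) -> closed D -> closed [set u | D (f u)].
Proof. by move=> fc; apply: closed_comp => u _; exact: fc. Qed.

Lemma chord_ball_compact X z (r : R) : space X z ->
  compact [set w | space X w /\ chord X z w <= r].
Proof.
move=> hz; pose D : set 'rV[R]_4 := [set u | space X u^T /\ chord X z u^T <= r].
have -> : [set w | space X w /\ chord X z w <= r] = trmx @` D.
  apply/seteqP; split=> [w hw|_ [u hu <-] //]; by exists w^T; rewrite /D /= trmxK.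
apply: continuous_compact.
  by apply: continuous_subspaceT => u; exact: trmx_cvg.
apply: bounded_closed_compact.
  pose s := `|chord X (base R) z| + `|r|.
  exists (1 + (2 * s + s ^+ 2 / 4) / 2); split; first by rewrite num_real.
  move=> m hm u [/= hu1 hu2].
  have hb := space_base R X.
  rewrite /Num.norm /= mx_normrE; apply: bigmax_le => /=.
    apply: (le_trans _ (ltW hm)); have s0 : 0 <= s by rewrite addr_ge0.
    by nra.
  move=> [i j] _ /=; rewrite (ord1 i).
  have := coord_bound j hu1; rewrite mxE => /le_trans; apply.
  apply: (le_trans _ (ltW hm)).
  have := chord_triangle hb hz hu1 => /= h.
  have c1 : chord X (base R) z <= `|chord X (base R) z| by rewrite ler_norm.
  have c2 : chord X z u^T <= `|r| by apply: le_trans hu2 _; rewrite ler_norm.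
  have c3 := chord_ge0 hb hz; have c4 := chord_ge0 hz hu1.
  have : chord X (base R) z + chord X z u^T <= s by rewrite lerD.
  move: h; set t := _ + chord X z _; move=> h1 h2.
  have t0 : 0 <= t by rewrite addr_ge0.
  nra.
(* The strict inequality in [upper] is relaxed to a closed condition: the equation of the space
   excludes a zero coordinate 0. *)
have -> : D = [set u | bf X u^T u^T = 1] `&` [set u | if X is Spherical then True else 0 <= u^T 0 0]
    `&` [set u | chord X z u^T <= r].
  apply/seteqP; split=> u; rewrite /D /=.
    move=> [/space_bf[h1 h2] h3]; split=> //; split=> //.
    by move: h2; rewrite /upper; case: (X) => // /ltW.
  move=> [[h1 h2] h3]; split=> //; apply/space_bf; split=> //.
  move: h1 h2; rewrite /bf /upper sdotE; case: (X) => //= h1 h2.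
    by rewrite lt_neqAle h2 andbT; apply/eqP => h; move: h1; rewrite -h; lra.
  rewrite lt_neqAle h2 andbT; apply/eqP => h; move: h1; rewrite -h.
  have := sqr_ge0 (u^T o1 0); have := sqr_ge0 (u^T o2 0); have := sqr_ge0 (u^T o3 0).
  by rewrite !expr2; lra.
apply: closedI; first apply: closedI.
- apply: (@closed_preimage (fun u : 'rV[R]_4 => bf X u^T u^T) _ _ (@closed_eq _ _)).
  by move=> u; apply: (@bf_cvg R X _ _ (nbhs_filter u) _ _ (@trmx_cvg _ _ u)).
- case: (X); first exact: closedT.
    apply: (@closed_preimage (fun u : 'rV[R]_4 => u^T 0 0) _ _ (@closed_ge _ _)).
    by move=> u; apply: (@coord_cvg R _ _ _ _ (@trmx_cvg _ _ u)).
  apply: (@closed_preimage (fun u : 'rV[R]_4 => u^T 0 0) _ _ (@closed_ge _ _)).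
  by move=> u; apply: (@coord_cvg R _ _ _ _ (@trmx_cvg _ _ u)).
- apply: (@closed_preimage (fun u : 'rV[R]_4 => chord X z u^T) _ _ (@closed_le _ _)).
  by move=> u; apply: (@chord_cvg R X _ _ (nbhs_filter u) _ _ (@trmx_cvg _ _ u)).
Qed.

Definition free_action X G := [/\ isometry_group X G, properly_discontinuous X G &
  fixed_point_free X G].

(** Proper discontinuity on the compact chord ball of radius 1 leaves finitely many g to consider,
    and each of them moves z. *)
Lemma orbit_sep X G z : free_action X G -> space X z ->
  exists2 d : R, 0 < d & forall g, G g -> g <> 1%:M -> d <= chord X z (g *m z).
Proof.
move=> [[_ Giso] Gpd Gfree] hz; pose C := [set w | space X w /\ chord X z w <= 1].
have Cz : C z by split=> //; rewrite chordxx.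
have fin := Gpd C (fun w => @proj1 _ _) (@chord_ball_compact X z 1 hz).
pose A := [set g | (G g /\ translate g C `&` C !=set0) /\ g <> 1%:M].
have finA : finite_set A by apply: sub_finite_set fin => g [].
have [|d d0 hd] := finite_pos_lbound finA (f := fun g => chord X z (g *m z)).
  move=> g [[Gg _] g1]; have hgz := isometry_space (Giso g Gg) hz.
  rewrite lt_neqAle chord_ge0 // andbT; apply/eqP => /esym /(chord_eq0 hz hgz) e.
  exact: (Gfree g z Gg g1 hz).
exists (Num.min d 1); first by rewrite lt_min d0 ltr01.
move=> g Gg g1; have hgz := isometry_space (Giso g Gg) hz.
case: (leP (chord X z (g *m z)) 1) => [le1|/ltW lt1]; last by rewrite ge_min lt1 orbT.
rewrite ge_min hd //; split=> //; split=> //.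
by exists (g *m z); split; [exists z|split].
Qed.

Lemma mem_orbit G x : mx_group G -> orbit G x x.
Proof. by move=> [_ G1 _ _]; exists 1%:M; rewrite ?mul1mx. Qed.

Lemma orbit_trans G x g : mx_group G -> G g -> orbit G (g *m x) = orbit G x.
Proof.
move=> [GU G1 GM GV] Gg; apply/seteqP; split=> [_ [h Gh <-]|_ [h Gh <-]].
  by exists (h *m g); rewrite ?mulmxA //; exact: GM.
exists (h *m invmx g); first by apply: GM => //; exact: GV.
by rewrite mulmxA mulmxKV // GU.
Qed.

(** The infimum is attained at the given representatives: a nontrivial k bringing [k *m y'] closer
    to y would move z by less than the separation of its orbit. *)
Lemma orbit_dist_local X G z : free_action X G -> space X z ->
  exists2 e : R, 0 < e & forall y y', space X y -> space X y' ->
    chord X z y < e -> chord X z y' < e ->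
    orbit_dist X (orbit G y) (orbit G y') = dist X y y'.
Proof.
move=> GF hz; have [d d0 hd] := orbit_sep GF hz; case: GF => [[Ggp Giso] _ _].
have [t t0 ht] := chord_tri3 X d0; have [s s0 hs] := chord_tri2 X t0.
exists (Num.min t s); first by rewrite lt_min t0.
move=> y y' hy hy'; rewrite !lt_min => /andP[y1 y2] /andP[y'1 y'2].
have dmin a b : orbit G y a -> orbit G y' b -> dist X y y' <= dist X a b.
  move=> [g Gg <-] [h Gh <-]; have [GU G1 GM GV] := Ggp.
  have hg := isometry_space (Giso _ Gg) hy; have hh := isometry_space (Giso _ Gh) hy'.
  rewrite !distE // phi_le ?chord_dom //.
  pose k := invmx g *m h; have Gk : G k by apply: GM => //; exact: GV.
  have -> : chord X (g *m y) (h *m y') = chord X y (k *m y').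
    have hk := isometry_space (Giso _ Gk) hy'.
    by rewrite -(isometry_chord (Giso _ Gg) hy hk) /k mulmxA mulKVmx // GU.
  have [->|k1] := pselect (k = 1%:M); first by rewrite mul1mx.
  rewrite leNgt; apply/negP => lt1.
  have yy : chord X y y' < t by apply: (hs y z y') => //; rewrite chord_sym.
  have := hd k Gk k1; apply/negP; rewrite -ltNge.
  apply: (ht z y (k *m y') (k *m z)) => //.
  - exact: isometry_space (Giso _ Gk) hy'.
  - exact: isometry_space (Giso _ Gk) hz.
  - exact: lt_trans lt1 yy.
  - by rewrite (isometry_chord (Giso _ Gk)) // chord_sym.
apply/eqP; rewrite eq_le; apply/andP; split.
  apply: ge_inf; first by exists (dist X y y') => _ [a [b [ha hb ->]]]; exact: dmin.
  by exists y, y'; split=> //; exact: mem_orbit.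
apply: lb_le_inf; first by exists (dist X y y'), y, y'; split=> //; exact: mem_orbit.
by move=> _ [a [b [ha hb ->]]]; exact: dmin.
Qed.

Lemma orbit_space_mem X G x : space X x -> orbit_space X G (orbit G x).
Proof. by exists x. Qed.

(** The lifted orientation is constant by connectedness, so equivariance rules out a negative
    determinant. *)
Lemma orientable_det_gt0 X G : isometry_group X G -> orientable_quotient X G ->
  forall g, G g -> 0 < \det g.
Proof.
move=> [[GU _ _ _] Giso] [oo [oc og]] g Gg; have hb := space_base R X.
have hgb := isometry_space (Giso _ Gg) hb.
have := og g _ Gg hb; rewrite (space_connected oc hgb hb).
have := GU g Gg; rewrite unitmxE unitfE.
by case: (ltgtP (\det g) 0) => //=; case: (oo _).
Qed.

(** * Local lifts of an isometry between quotients *)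

Section Transfer.
Variables (X : geometry) (G K : set 'M[R]_4) (M : metricType R).
Hypotheses (GF : free_action X G) (KF : free_action X K).
Hypotheses (Gdet : forall g, G g -> 0 < \det g).
Variables (fG fK : set 'cV[R]_4 -> M).
Hypothesis fGb : set_bij (orbit_space X G) setT fG.
Hypothesis fGd : forall O O', orbit_space X G O -> orbit_space X G O' ->
  mdist (fG O) (fG O') = orbit_dist X O O'.
Hypothesis fKd : forall O O', orbit_space X K O -> orbit_space X K O' ->
  mdist (fK O) (fK O') = orbit_dist X O O'.

Let match_pts y z := fG (orbit G z) = fK (orbit K y).

Lemma match_ex y : exists2 z, space X z & match_pts y z.
Proof.
have [_ _ /(_ (fK (orbit K y)) I)[Q [z hz <-] e]] := fGb.
by exists z.
Qed.

(** An isometry of the whole space that lifts, near y, the map of quotients obtained by passing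
    through M. *)
Definition chart y h := isometry X h /\ exists2 e : R, 0 < e &
  forall y', space X y' -> chord X y y' < e -> match_pts y' (h *m y').

(** Fix z above the image of y. Each y' near y has a match near z, because the orbit distance is an
    infimum below the radius. Near y and z orbit distances are true distances, so these matches form
    a chord-preserving map, which extends. *)
Lemma chart_ex y : space X y -> exists h, chart y h.
Proof.
move=> hy; have [z hz yz] := match_ex y.
have [e e0 he] := orbit_dist_local KF hy; have [e' e'0 he'] := orbit_dist_local GF hz.
(* The cap 1 keeps the radius inside [phi_dom], where [phi] can be compared. *)
pose m := Num.min 1 (Num.min e e'); have m0 : 0 < m by rewrite !lt_min ltr01 e0.
have mdom : phi_dom X m.
  rewrite /phi_dom ltW //=; have : m <= 1 by rewrite /m ge_min lexx.
  by case: (X) => // /le_trans; apply; rewrite ler1n.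
have [[Ggp Giso] _ _] := GF.
have zP y' : space X y' -> chord X y y' < m ->
    exists z', [/\ space X z', match_pts y' z' & chord X z z' < m].
  move=> hy' yy'; have [z1 hz1 m1] := match_ex y'.
  have : orbit_dist X (orbit G z) (orbit G z1) < phi X m.
    rewrite -(fGd (orbit_space_mem G hz) (orbit_space_mem G hz1)) yz m1.
    rewrite (fKd (orbit_space_mem K hy) (orbit_space_mem K hy')).
    have [ye y'e] : chord X y y < e /\ chord X y y' < e.
      by move: yy'; rewrite chordxx e0 /m !lt_min => /and3P[].
    by rewrite he // distE // phi_lt // chord_dom.
  move=> /inf_lt[|d [a [b [[g Gg <-] [h Gh <-] ->]]]].
    by exists (dist X z z1), z, z1; split=> //; exact: mem_orbit.
  have hg := isometry_space (Giso _ Gg) hz; have hh := isometry_space (Giso _ Gh) hz1.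
  have [GU G1 GM GV] := Ggp.
  have Gk : G (invmx g *m h) by apply: GM => //; exact: GV.
  have hk := isometry_space (Giso _ Gk) hz1.
  rewrite distE // => lt1; exists (invmx g *m h *m z1); split=> //.
    by rewrite /match_pts orbit_trans.
  rewrite -(isometry_chord (Giso _ Gg) hz hk) !mulmxA mulmxV ?GU // mul1mx.
  rewrite ltNge; apply/negP => le1; move: lt1; apply/negP; rewrite -leNgt.
  by rewrite phi_le // chord_dom.
have zP' y' : exists z', space X y' -> chord X y y' < m ->
    [/\ space X z', match_pts y' z' & chord X z z' < m].
  have [[hy' yy']|n] := pselect (space X y' /\ chord X y y' < m).
    by have [z' hz'] := zP y' hy' yy'; exists z'.
  by exists 0 => hy' yy'; case: n.
have [f hf] := boolp.choice zP'.
have [||h hi hh] := @isometry_extend R X y (fun y' => chord X y y' < m) f hy (near_chord X y m0).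
- by move=> y' hy' yy'; have [] := hf y' hy' yy'.
- move=> y1 y2 hy1 yy1 hy2 yy2.
  have [h1 m1 c1] := hf _ hy1 yy1; have [h2 m2 c2] := hf _ hy2 yy2.
  apply: (@phi_inj R X); rewrite ?chord_dom // -!distE //.
  have le a : a < m -> a < e /\ a < e' by rewrite /m !lt_min => /and3P[].
  rewrite -he' ?(proj2 (le _ c1)) ?(proj2 (le _ c2)) //.
  rewrite -he ?(proj1 (le _ yy1)) ?(proj1 (le _ yy2)) //.
  rewrite -(fGd (orbit_space_mem G h1) (orbit_space_mem G h2)) m1 m2.
  by rewrite (fKd (orbit_space_mem K hy1) (orbit_space_mem K hy2)).
exists h; split=> //; exists m => // y' hy' yy'.
by rewrite -hh //; have [] := hf _ hy' yy'.
Qed.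

(* [h'] agrees near [y] with elements of [G] applied to [h], and these elements
   are all equal because the orbits of [G] are uniformly separated. *)
Lemma chart_uniq y h h' : space X y -> chart y h -> chart y h' ->
  exists2 g, G g & h' = g *m h.
Proof.
move=> hy [ih [e e0 he]] [ih' [e' e'0 he']].
have [[Ggp Giso] _ _] := GF; have [GU G1 GM GV] := Ggp.
have [_ finj _] := fGb.
have P y' : space X y' -> chord X y y' < e -> chord X y y' < e' ->
    exists2 g, G g & g *m (h *m y') = h' *m y'.
  move=> hy' c1 c2; have := he _ hy' c1; have := he' _ hy' c2.
  rewrite /match_pts => <- e1'.
  have {e1'}e1 : orbit G (h *m y') = orbit G (h' *m y').
    by apply: finj => //; rewrite inE; apply: orbit_space_mem; exact: isometry_space.
  have : orbit G (h *m y') (h' *m y') by rewrite e1; exact: mem_orbit.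
  by case=> g Gg; exists g.
have [||g0 Gg0 eg0] := P y hy; rewrite ?chordxx //.
have hz := isometry_space ih' hy.
have [d d0 hd] := orbit_sep GF hz; have [t t0 ht] := chord_tri2 X d0.
exists g0 => //.
have n : \forall y' \near y, chord X y y' < Num.min t (Num.min e e').
  by apply: near_chord; rewrite !lt_min t0 e0.
apply: (isometry_ext hy n) => y' hy'; rewrite !lt_min => /and3P[c1 c2 c3].
have [g Gg eg] := P y' hy' c2 c3.
rewrite -eg -mulmxA; congr (_ *m _); apply: contrapT => ne.
pose k := g *m invmx g0; have Gk : G k by apply: GM => //; exact: GV.
have k1 : k <> 1%:M.
  by move=> k1; apply: ne; rewrite -[g](mulmxKV (GU _ Gg0)) -/k k1 mul1mx.
have := hd k Gk k1; apply/negP; rewrite -ltNge.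
have hk := Giso _ Gk; have hhy' := isometry_space ih hy'; have hhy := isometry_space ih hy.
have hh'y' := isometry_space ih' hy'.
apply: (ht _ (h' *m y')) => //.
- exact: isometry_space.
- by rewrite isometry_chord.
- rewrite -eg -eg0 /k -!mulmxA mulKmx ?GU // (isometry_chord (Giso _ Gg)) //.
  by rewrite isometry_chord // chord_sym.
Qed.

Lemma chart_sign y h h' : space X y -> chart y h -> chart y h' ->
  (0 < \det h) = (0 < \det h').
Proof.
move=> hy c1 c2; have [g Gg ->] := chart_uniq hy c1 c2.
by rewrite det_mulmx pmulr_rgt0 // Gdet.
Qed.

Lemma transfer_det_gt0 k : K k -> 0 < \det k.
Proof.
move=> Kk; pose o y := `[< exists h, chart y h /\ 0 < \det h >].
have oE y h : space X y -> chart y h -> o y = (0 < \det h).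
  move=> hy c; apply/asboolP/idP => [[h' [c' d']]|d]; last by exists h.
  by rewrite (chart_sign hy c c').
have oc y : space X y -> \forall y' \near within (space X) (nbhs y), o y' = o y.
  move=> hy; have [h c] := chart_ex hy; rewrite (oE y h) //.
  case: c => ih [e e0 he]; have [d d0 hd] := chord_tri2 X e0.
  have n := near_chord X y d0.
  apply: filterS n => y' yy' hy'; apply: oE => //; split=> //; exists d => // y'' hy'' c''.
  by apply: he => //; exact: (hd _ y').
have hb := space_base R X; have [h c] := chart_ex hb.
have [[Kgp Kiso] _ _] := KF; have [KU _ _ KV] := Kgp.
have hkb := isometry_space (Kiso _ Kk) hb.
have c' : chart (k *m base R) (h *m invmx k).
  case: c => ih [e e0 he]; split.
    by apply: isometry_mul => //; apply: isometry_inv; exact: Kiso.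
  exists e => // y' hy' yy'.
  have hk' := isometry_space (isometry_inv (Kiso _ Kk)) hy'.
  rewrite -mulmxA /match_pts -(@orbit_trans K _ (invmx k)) //; last exact: KV.
  apply: he => //; rewrite -(isometry_chord (Kiso _ Kk)) // mulKVmx // KU //.
have := space_connected oc hkb hb; rewrite (oE _ _ hkb c') (oE _ _ hb c).
rewrite det_mulmx det_inv; have := KU k Kk; rewrite unitmxE unitfE => dk.
have dh : \det h != 0 by have := isometry_unit c.1; rewrite unitmxE unitfE.
move: dk dh; case: (ltgtP (\det k) 0) => // k0 _.
case: (ltgtP (\det h) 0) => // h0 _.
  by rewrite nmulr_rgt0 // invr_lt0 k0.
by rewrite pmulr_rgt0 // invr_gt0 ltNge ltW.
Qed.

End Transfer.

Lemma quotient_orientation X G K (M : metricType R) :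
  free_action X G -> free_action X K -> orientable_quotient X G ->
  isometric_to_quotient X M G -> isometric_to_quotient X M K ->
  forall k, K k -> 0 < \det k.
Proof.
move=> GF KF /(orientable_det_gt0 (let: And3 h _ _ := GF in h)) Gdet [fG [fGb fGd]] [fK [_ fKd]].
by move=> k; exact (@transfer_det_gt0 X G K M GF KF Gdet fG fK fGb fGd fKd k).
Qed.

End Quotients.

(** * Coxeter groups of simplicial cones *)

Lemma signr_inj (R : realType) (b b' : bool) : (-1) ^+ b = (-1) ^+ b' :> R -> b = b'.
Proof. by case: b; case: b' => //; rewrite expr0 expr1 => h; exfalso; lra. Qed.

Definition rdot (R : realType) (J : 'M[R]_4) (b b' : 'rV[R]_4) : R :=
  (b *m J *m b'^T) 0 0.

(* The rows [a i] are the unit normals of the faces of a simplicial cone with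
   edges the columns of [V], with dihedral angles [pi / m i j]. *)
Record coxeter_data (R : realType) (J V : 'M[R]_4) (a : 'I_4 -> 'rV[R]_4)
    (c : 'I_4 -> R) (m : 'I_4 -> 'I_4 -> nat) : Prop := CoxeterData {
  cox_sym : J^T = J;
  cox_unit : V \in unitmx;
  cox_row : forall i, a i *m V = c i *: delta_mx 0 i;
  cox_gt0 : forall i, 0 < c i;
  cox_norm : forall i, rdot J (a i) (a i) = 1;
  cox_angle : forall i j, i != j -> rdot J (a i) (a j) = - cos (pi / (m i j)%:R);
  cox_ge2 : forall i j, i != j -> (1 < m i j)%N;
  cox_labelC : forall i j, m i j = m j i }.

Section Coxeter.
Variables (R : realType) (J V : 'M[R]_4) (a : 'I_4 -> 'rV[R]_4) (c : 'I_4 -> R).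
Variable m : 'I_4 -> 'I_4 -> nat.
Implicit Types (g h v : 'M[R]_4) (b : 'rV[R]_4) (x y : 'cV[R]_4) (i j : 'I_4) (w : seq 'I_4).

Hypothesis CD : coxeter_data J V a c m.
Local Notation rdot := (rdot J).

Lemma aVE i l : (a i *m V) 0 l = c i * (l == i)%:R.
Proof. by rewrite (cox_row CD) !mxE. Qed.

Lemma rdotDl b b' d : rdot (b + b') d = rdot b d + rdot b' d.
Proof. by rewrite /rdot !mulmxDl mxE. Qed.
Lemma rdotZl (k : R) b d : rdot (k *: b) d = k * rdot b d.
Proof. by rewrite /rdot -!scalemxAl mxE. Qed.
(** Acting on rows from the right, the reflection of forms that negates [a i]; acting on columns
    from the left, the reflection of points in the plane [a i *m x = 0]. J need not be invertible
    for this. *)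
Definition refl i : 'M[R]_4 := 1%:M - 2 *: (J *m (a i)^T *m a i).

Lemma row_refl b i : b *m refl i = b - (2 * rdot b (a i)) *: a i.
Proof.
rewrite /refl mulmxBr mulmx1 -scalemxAr !mulmxA [b *m J *m _]mx11_scalar.
by rewrite mul_scalar_mx scalerA.
Qed.

Lemma col_refl x i : refl i *m x = x - (2 * (a i *m x) 0 0) *: (J *m (a i)^T).
Proof.
rewrite /refl mulmxBl mul1mx -scalemxAl -!mulmxA {1}[a i *m x]mx11_scalar.
by rewrite !mul_mx_scalar -scalemxAr scalerA.
Qed.

Lemma refl_fix x i : (a i *m x) 0 0 = 0 -> refl i *m x = x.
Proof. by move=> e; rewrite col_refl e mulr0 scale0r subr0. Qed.

Lemma row_ext g h : (forall b, b *m g = b *m h) -> g = h.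
Proof. by move=> e; apply/row_matrixP => i; rewrite !rowE e. Qed.

Lemma self_refl i : a i *m refl i = - a i.
Proof. by rewrite row_refl (cox_norm CD) mulr1 scaler_nat mulr2n opprD addNKr. Qed.

Lemma reflK i : refl i *m refl i = 1%:M.
Proof.
apply: row_ext => b; rewrite mulmxA [b *m refl i]row_refl mulmxBl -scalemxAl self_refl row_refl mulmx1.
by rewrite scalerN opprK subrK.
Qed.

Lemma reflKl i g : refl i *m (refl i *m g) = g.
Proof. by rewrite mulmxA reflK mul1mx. Qed.

Lemma det_refl i : \det (refl i) = -1.
Proof.
have -> : refl i = 1%:M + (- 2 *: (J *m (a i)^T)) *m a i.
  by rewrite /refl -scalemxAl scaleNr.
rewrite det_one_add_mul -scalemxAr mxE mulmxA -/(rdot _ _) (cox_norm CD); lra.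
Qed.

(** * Words in the reflections and their length *)

Fixpoint wprod w : 'M[R]_4 := if w is i :: w' then refl i *m wprod w' else 1%:M.

Lemma wprod_cat w w' : wprod (w ++ w') = wprod w *m wprod w'.
Proof. by elim: w => [|i w IH] /=; rewrite ?mul1mx // IH mulmxA. Qed.

Lemma wprod_rev w : wprod (rev w) *m wprod w = 1%:M.
Proof.
elim: w => [|i w IH] /=; first by rewrite mulmx1.
by rewrite rev_cons -cats1 wprod_cat /= mulmx1 -mulmxA reflKl IH.
Qed.

Lemma wprod_unit w : wprod w \in unitmx.
Proof. by have [] := mulmx1_unit (wprod_rev w). Qed.

Lemma wprod_inv w : invmx (wprod w) = wprod (rev w).
Proof. by rewrite -[LHS]mul1mx -(wprod_rev w) mulmxK ?wprod_unit. Qed.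

Lemma det_wprod w : \det (wprod w) = (-1) ^+ size w.
Proof. by elim: w => [|i w IH] /=; rewrite ?det1 // det_mulmx det_refl IH exprS. Qed.

Definition words : set 'M[R]_4 := range wprod.

Lemma words_refl i g : words g -> words (refl i *m g).
Proof. by move=> [w _ <-]; exists (i :: w). Qed.

Lemma words_mul g h : words g -> words h -> words (g *m h).
Proof. by move=> [w _ <-] [w' _ <-]; exists (w ++ w'); rewrite ?wprod_cat. Qed.

Lemma words1 : words 1%:M. Proof. by exists [::]. Qed.

Lemma words_inv g : words g -> words (invmx g).
Proof. by move=> [w _ <-]; exists (rev w); rewrite ?wprod_inv. Qed.

Lemma words_unit g : words g -> g \in unitmx.
Proof. by move=> [w _ <-]; exact: wprod_unit. Qed.

Definition has_word g n := exists w, size w = n /\ wprod w = g.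

(** The length of a shortest word; the value 0 is a default for matrices that are not words. *)
Definition len g : nat :=
  if pselect (exists n, `[< has_word g n >]) is left h then ex_minn h else 0%N.

Lemma len_word g : words g -> exists2 w, size w = len g & wprod w = g.
Proof.
move=> [w _ hw]; rewrite /len; case: pselect => [h|[]]; last first.
  by exists (size w); apply/asboolP; exists w.
by case: ex_minnP => n /asboolP[w' [<- <-]] _; exists w'.
Qed.

Lemma len_le w : (len (wprod w) <= size w)%N.
Proof.
rewrite /len; case: pselect => // h.
by case: ex_minnP => n _; apply; apply/asboolP; exists w.
Qed.

Lemma len_le_cat w g : words g -> (len (wprod w *m g) <= size w + len g)%N.
Proof. by move=> /len_word[w' <- <-]; rewrite -wprod_cat -size_cat; exact: len_le. Qed.

Lemma odd_len w : odd (len (wprod w)) = odd (size w).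
Proof.
have [w' sw' e] := @len_word (wprod w) (imageT _ _); rewrite -sw'.
have := congr1 determinant e; rewrite !det_wprod -signr_odd -[in RHS]signr_odd.
exact: signr_inj.
Qed.

(** The length cannot stay the same: a reflection changes the sign of the determinant, hence the
    parity. *)
Lemma len_refl i g : words g ->
  len (refl i *m g) = (len g).+1 \/ len g = (len (refl i *m g)).+1.
Proof.
move=> hg; have h1 := len_le_cat [:: i] hg; have h2 := len_le_cat [:: i] (words_refl i hg).
move: h1 h2; rewrite /= mulmx1 reflKl.
have : odd (len (refl i *m g)) = ~~ odd (len g).
  by have [w _ <-] := hg; rewrite (odd_len w) (odd_len (i :: w)).
lia.
Qed.

Lemma len_gt0 g : words g -> (0 < len g)%N -> exists i, (len (refl i *m g) < len g)%N.
Proof.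
move=> /len_word[[|i w] <- <-] //= _; exists i; rewrite reflKl ltnS; exact: len_le.
Qed.

Lemma len_eq0 g : words g -> len g = 0%N -> g = 1%:M.
Proof. by move=> /len_word[[|i w] <- <-]. Qed.

(** * Dihedral subgroups and the braid relation *)

Fixpoint alt i j n : seq 'I_4 := if n is n'.+1 then i :: alt j i n' else [::].

Lemma size_alt i j n : size (alt i j n) = n.
Proof. by elim: n i j => //= n IH i j; rewrite IH. Qed.

Lemma alt_cat i j n k :
  alt i j (n + k) = alt i j n ++ (if odd n then alt j i k else alt i j k).
Proof. by elim: n i j => //= n IH i j; rewrite IH; case: (odd n). Qed.

Lemma alt_rcons i j n : alt i j n.+1 = alt i j n ++ [:: if odd n then j else i].
Proof. by have := alt_cat i j n 1; rewrite addn1 => ->; case: (odd n). Qed.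

(* The Chebyshev polynomial U_(k-1) at [cos (pi / m i j)]. *)
Definition chi i j (k : nat) : R := sin (k%:R * (pi / (m i j)%:R)) / sin (pi / (m i j)%:R).

Section Dihedral.
Variables (i j : 'I_4).
Hypothesis ij : i != j.

Let th : R := pi / (m i j)%:R.

Let m_gt1 : (1 < m i j)%N. Proof. exact: (cox_ge2 CD). Qed.

Let m_neq0 : (m i j)%:R != 0 :> R. Proof. by rewrite pnatr_eq0 -lt0n ltnW. Qed.

Let th_bound : 0 < th < pi.
Proof.
rewrite /th divr_gt0 ?pi_gt0 ?ltr0n ?(ltnW m_gt1) //= ltr_pdivrMr ?ltr0n ?(ltnW m_gt1) //.
by rewrite ltr_pMr ?pi_gt0 // ltr1n.
Qed.

Lemma sin_th_gt0 : 0 < sin (pi / (m i j)%:R : R).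
Proof. exact: sin_gt0_pi. Qed.

Lemma chi_rec k : chi i j k.+2 = 2 * cos th * chi i j k.+1 - chi i j k.
Proof.
rewrite /chi -/th mulrA -mulrBl; congr (_ / _).
have -> : k.+2%:R * th = k.+1%:R * th + th by rewrite -natr1; ring.
have -> : k%:R * th = k.+1%:R * th - th by rewrite -natr1; ring.
rewrite sinD sinB; ring.
Qed.

Lemma chi0 : chi i j 0 = 0. Proof. by rewrite /chi -/th mul0r sin0 mul0r. Qed.
Lemma chi1 : chi i j 1 = 1. Proof. by rewrite /chi -/th mul1r divff // gt_eqF // sin_th_gt0. Qed.

Lemma chi_ge0 k : (k <= m i j)%N -> 0 <= chi i j k.
Proof.
move=> km; rewrite /chi -/th divr_ge0 ?(ltW sin_th_gt0) //; apply: sin_ge0_pi.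
have /andP[t0 _] := th_bound; rewrite mulr_ge0 ?(ltW t0) //=.
rewrite /th mulrCA ler_piMr ?pi_ge0 // ler_pdivrMr ?ltr0n ?(ltnW m_gt1) // mul1r.
by rewrite ler_nat.
Qed.

Lemma chim : chi i j (m i j) = 0.
Proof. by rewrite /chi -/th /th mulrCA mulfV // mulr1 sinpi mul0r. Qed.

Lemma chimS : chi i j (m i j).+1 = -1.
Proof.
rewrite /chi -/th -natr1 mulrDl mul1r {1}/th mulrCA mulfV // mulr1 addrC sinDpi mulNr.
by rewrite divff // gt_eqF // sin_th_gt0.
Qed.

Lemma chimP : chi i j (m i j).-1 = 1.
Proof.
have := chi_rec (m i j).-1; rewrite (prednK (ltnW m_gt1)) chim chimS mulr0 sub0r.
by move/oppr_inj.
Qed.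

End Dihedral.

(** Both reflections act in the plane of [a i] and [a j], through a second-order recurrence that
    exchanges i and j. Hence the Chebyshev coefficients, and the induction on two consecutive values
    of k. *)
Lemma row_alt k : forall i j, i != j -> a i *m wprod (alt j i k) =
  chi i j k.+1 *: (if odd k then a j else a i) + chi i j k *: (if odd k then a i else a j).
Proof.
have rec i j k' : i != j -> chi i j k'.+2 = 2 * cos (pi / (m i j)%:R) * chi i j k'.+1 - chi i j k'.
  by move=> _; exact: chi_rec.
have chiC i j k' : chi i j k' = chi j i k' by rewrite /chi (cox_labelC CD).
have step i j g : i != j -> a i *m (refl j *m g) =
    a i *m g + (2 * cos (pi / (m i j)%:R)) *: (a j *m g).
  by move=> ij; rewrite mulmxA row_refl (cox_angle CD) // mulrN scaleNr opprK mulmxDl -scalemxAl.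
suff: (forall i j, i != j -> a i *m wprod (alt j i k) =
    chi i j k.+1 *: (if odd k then a j else a i) + chi i j k *: (if odd k then a i else a j)) /\
  (forall i j, i != j -> a i *m wprod (alt j i k.+1) =
    chi i j k.+2 *: (if odd k.+1 then a j else a i) + chi i j k.+1 *: (if odd k.+1 then a i else a j)).
  by case.
elim: k => [|k [IH1 IH2]]; split=> i j ij.
- by rewrite /= chi1 // chi0 scale1r scale0r addr0 mulmx1.
- by rewrite [LHS]/= step // !mulmx1 rec // chi1 // chi0 mulr1 subr0 scale1r addrC.
- exact: IH2.
- have ji : j != i by rewrite eq_sym.
  have -> : wprod (alt j i k.+2) = refl j *m wprod (alt i j k.+1) by [].
  rewrite step // (IH2 _ _ ji) [wprod _]/= [a i *m (_ *m _)]mulmxA self_refl mulNmx (IH1 _ _ ij).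
  rewrite !(chiC j i) (rec i j k.+1) // (rec i j k) //.
  by apply/rowP => l; rewrite /= !negbK; case: (odd k); rewrite !mxE; ring.
Qed.

Lemma row_orth w b : (forall i, i \in w -> rdot b (a i) = 0) -> b *m wprod w = b.
Proof.
elim: w => [|i w IH] h /=; first by rewrite mulmx1.
rewrite mulmxA row_refl h ?inE ?eqxx // mulr0 scale0r subr0; apply: IH => j jw.
by apply: h; rewrite inE jw orbT.
Qed.

Lemma alt_sub i j n k : k \in alt i j n -> (k == i) || (k == j).
Proof. by elim: n i j => //= n IH i j; rewrite inE => /orP[->//|/IH]; rewrite orbC. Qed.

Lemma braid_self i j : i != j ->
  a i *m wprod (alt j i (m i j)) = a i *m wprod (alt i j (m i j)).
Proof.
move=> ij; have m1 := cox_ge2 CD ij; rewrite row_alt // chim // chimS // scale0r addr0 scaleN1r.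
have := chim ij; have := chimP ij; case: (m i j) m1 => // n _; rewrite [n.+1.-1]/= => c1 c2.
rewrite [wprod (alt i j _)]/= mulmxA self_refl mulNmx row_alt // c1 c2 scale0r scale1r add0r.
by rewrite /=; case: (odd n).
Qed.

(** The two products agree on [a i] and [a j] and fix every row orthogonal to both. These rows span
    everything because the Gram determinant of [a i], [a j] is a nonzero squared sine. *)
Lemma braid i j : i != j -> wprod (alt j i (m i j)) = wprod (alt i j (m i j)).
Proof.
move=> ij; have ji : j != i by rewrite eq_sym.
pose C := cos (pi / (m i j)%:R) : R.
have C1 : 1 - C ^+ 2 != 0.
  have := sin2cos2 (pi / (m i j)%:R : R); rewrite /C => <-.
  by rewrite sqrf_eq0 gt_eqF // sin_th_gt0.
apply: row_ext => b.
pose p := rdot b (a i); pose q := rdot b (a j).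
(* The solution of the Gram system [s - C t = p], [t - C s = q]. *)
pose s := (p + C * q) / (1 - C ^+ 2); pose t := q + C * s.
pose b' := b - s *: a i - t *: a j.
have h k : (k == i) || (k == j) -> rdot b' (a k) = 0.
  have nZ d e f : rdot (d - e *: f) (a k) = rdot d (a k) - e * rdot f (a k).
    by rewrite rdotDl -scaleNr rdotZl mulNr.
  rewrite /b' !nZ => /orP[]/eqP->; rewrite (cox_norm CD) (cox_angle CD) // -?[m j i](cox_labelC CD) -/C -/p -/q /t.
    by rewrite /s; field.
  by rewrite /s; field.
have eb : b = b' + s *: a i + t *: a j by rewrite addrAC /b' !subrK.
rewrite eb; clear eb; move: b' h => b' h.
rewrite !mulmxDl -!scalemxAl braid_self //.
have -> : a j *m wprod (alt j i (m i j)) = a j *m wprod (alt i j (m i j)).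
  by rewrite (cox_labelC CD) braid_self.
have hw w : (forall k, k \in w -> (k == i) || (k == j)) -> b' *m wprod w = b'.
  by move=> hw; apply: row_orth => k /hw /h.
by rewrite !hw // => k /alt_sub //; rewrite orbC.
Qed.

(** * Positive roots and Tits' theorem *)

(** As [a i *m V] is a positive multiple of [delta_mx 0 i], this says that b is a nonnegative
    combination of the [a i]. *)
Definition pos b := forall l, 0 <= (b *m V) 0 l.

Lemma posD b b' : pos b -> pos b' -> pos (b + b').
Proof. by move=> h h' l; rewrite mulmxDl mxE addr_ge0. Qed.

Lemma posZ (k : R) b : 0 <= k -> pos b -> pos (k *: b).
Proof. by move=> k0 h l; rewrite -scalemxAl mxE mulr_ge0. Qed.

Lemma pos_a i : pos (a i).
Proof. by move=> l; rewrite (cox_row CD) !mxE eqxx /= mulr_ge0 ?ler0n // ltW // (cox_gt0 CD). Qed.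

(** The longest alternating prefix that can be removed at full gain of length is split off; by
    maximality neither reflection shortens the remainder v. *)
Lemma strip g i j : words g -> i != j -> (len g < len (refl i *m g))%N ->
  (len (refl j *m g) < len g)%N ->
  exists k v, [/\ words v, g = wprod (alt j i k) *m v, len g = (k + len v)%N, (0 < k)%N &
    forall l, (l == i) || (l == j) -> (len v < len (refl l *m v))%N].
Proof.
move=> hg ij gi gj.
pose P k := `[< exists v, [/\ words v, g = wprod (alt j i k) *m v & len g = (k + len v)%N] >].
have P1 : P 1%N.
  apply/asboolP; exists (refl j *m g); rewrite /= mulmx1 reflKl; split=> //; first exact: words_refl.
  by have := len_refl j hg; lia.
have Pb k : P k -> (k <= len g)%N by move=> /asboolP[v [_ _ ->]]; rewrite leq_addr.
have exP : exists k, P k by exists 1%N.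
case: (ex_maxnP exP Pb) => k /asboolP[v [hv ev lv]] kmax.
have k0 : (0 < k)%N by apply: kmax.
have next : (len v < len (refl (if odd k then i else j) *m v))%N.
  rewrite ltnNge; apply/negP => h.
  have : P k.+1.
    apply/asboolP; exists (refl (if odd k then i else j) *m v); split; first exact: words_refl.
      by rewrite alt_rcons wprod_cat /= mulmx1 -mulmxA reflKl.
    by have := len_refl (if odd k then i else j) hv; lia.
  by move/kmax; rewrite ltnn.
have prev : (len v < len (refl (if odd k then j else i) *m v))%N.
  case: k k0 ev lv {kmax next} => // k _ ev lv.
  have e : g = wprod (alt j i k) *m (refl (if odd k then i else j) *m v).
    by rewrite ev alt_rcons wprod_cat /= mulmx1 -mulmxA.
  have := len_le_cat (alt j i k) (words_refl (if odd k then i else j) hv).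
  by rewrite -e size_alt lv /=; case: (odd k) => /=; lia.
exists k, v; split=> // l /orP[]/eqP->; by move: next prev; case: (odd k).
Qed.

(** After [strip], induction makes [a i *m v] and [a j *m v] positive, and [row_alt] combines them
    with coefficients that are nonnegative as long as [k < m i j]. A longer prefix would let the
    braid relation shorten [refl i *m g]. *)
Theorem tits n g : words g -> len g = n -> forall i, (len g < len (refl i *m g))%N -> pos (a i *m g).
Proof.
elim/ltn_ind: n g => n IH g hg gn i gi.
have [g0|g0] := posnP (len g).
  by rewrite (len_eq0 hg g0) mulmx1; exact: pos_a.
have [j gj] := len_gt0 hg g0.
have ij : i != j by apply/eqP => ij; move: gi gj; rewrite ij; lia.
have [k [v [hv ev lv k0 hl]]] := strip hg ij gi gj.
have vn : (len v < n)%N by lia.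
have pi : pos (a i *m v) by apply: (IH _ vn) => //; apply: hl; rewrite eqxx.
have pj : pos (a j *m v) by apply: (IH _ vn) => //; apply: hl; rewrite eqxx orbT.
have km : (k < m i j)%N.
  rewrite ltnNge; apply/negP => mk.
  have m0 : (0 < m i j)%N by have := cox_ge2 CD ij; lia.
  move: ev; rewrite -(subnKC mk) alt_cat; set r := if _ then _ else _ => ev.
  have e : refl i *m g = wprod (alt j i (m i j).-1 ++ r) *m v.
    rewrite ev !wprod_cat braid // !mulmxA; congr (_ *m _ *m _).
    by rewrite -[in LHS](prednK m0) /= reflKl.
  have := len_le_cat (alt j i (m i j).-1 ++ r) hv; rewrite -e size_cat size_alt.
  have : size r = (k - m i j)%N by rewrite /r; case: ifP => _; rewrite size_alt.
  lia.
rewrite ev mulmxA row_alt // mulmxDl -!scalemxAl.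
by apply: posD; apply: posZ; rewrite ?chi_ge0 // 1?ltnW //; case: (odd k).
Qed.

Lemma tits_le g i : words g -> (len (refl i *m g) < len g)%N -> pos (- (a i *m g)).
Proof.
move=> hg h; have := @tits _ _ (words_refl i hg) erefl i.
by rewrite reflKl mulmxA self_refl mulNmx; apply.
Qed.

(** * Parabolic subgroups and the closed chamber *)

Definition words_in (S : pred 'I_4) : set 'M[R]_4 := [set g | exists2 w, all S w & wprod w = g].

Lemma words_in_words S g : words_in S g -> words g.
Proof. by move=> [w _ <-]; exists w. Qed.

Lemma words_in_refl (S : pred 'I_4) i g : S i -> words_in S g -> words_in S (refl i *m g).
Proof. by move=> Si [w Sw <-]; exists (i :: w) => //=; rewrite Si. Qed.

Lemma words_in_mul (S : pred 'I_4) g h : words_in S g -> words_in S h -> words_in S (g *m h).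
Proof.
by move=> [w hw <-] [w' hw' <-]; exists (w ++ w'); rewrite ?all_cat ?hw // wprod_cat.
Qed.

Lemma words_in1 (S : pred 'I_4) : words_in S 1%:M.
Proof. by exists [::]. Qed.

Lemma words_in_sub (S S' : pred 'I_4) g : subpred S S' -> words_in S g -> words_in S' g.
Proof. by move=> SS [w hw <-]; exists w => //; exact: sub_all hw. Qed.

Lemma words_in_inv (S : pred 'I_4) g : words_in S g -> words_in S (invmx g).
Proof. by move=> [w hw <-]; exists (rev w); rewrite ?all_rev // wprod_inv. Qed.

Lemma words_in_fix (S : pred 'I_4) g x : words_in S g -> (forall i, S i -> (a i *m x) 0 0 = 0) -> g *m x = x.
Proof.
move=> [w + <-] h; elim: w => [|i w IH] /=; first by rewrite mul1mx.
by move=> /andP[Si Sw]; rewrite -mulmxA IH // refl_fix // h.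
Qed.

Lemma coef_words (S : pred 'I_4) g b l : words_in S g -> ~~ S l -> (b *m g *m V) 0 l = (b *m V) 0 l.
Proof.
move=> [w + <-] nS; elim: w b => [|i w IH] b /=; first by rewrite mulmx1.
move=> /andP[Si Sw]; rewrite mulmxA IH // row_refl mulmxBl -scalemxAl (cox_row CD) !mxE eqxx /=.
rewrite (_ : l == i = false); first by rewrite mulr0 mulr0 subr0.
by apply/negbTE; apply: contraNneq nS => ->.
Qed.

(** A shortest word uses letters of S only: for i outside S, [coef_words] keeps the i-th coordinate
    of [a i *m g] positive, whereas a descent makes it nonpositive. Each step therefore comes with a
    positive root [a i *m v]. *)
Lemma parabolic_ind (S : pred 'I_4) (Q : 'M[R]_4 -> Prop) : Q 1%:M ->
  (forall i v, S i -> words_in S v -> pos (a i *m v) -> Q v -> Q (refl i *m v)) ->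
  forall g, words_in S g -> Q g.
Proof.
move=> Q1 Qs g; have [n] := ubnP (len g); elim: n g => // n IH g; rewrite ltnS => gn hg.
have wg := words_in_words hg.
have [g0|g0] := posnP (len g); first by rewrite (len_eq0 wg g0).
have [i gi] := len_gt0 wg g0.
have Si : S i.
  apply/negPn/negP => nS; have := tits_le wg gi i.
  rewrite mulNmx mxE (coef_words _ hg nS) aVE eqxx mulr1 oppr_ge0 leNgt.
  by rewrite (cox_gt0 CD).
have hv := words_in_refl Si hg.
rewrite -(reflKl i g); apply: Qs => //; last by apply: IH => //; lia.
rewrite mulmxA self_refl mulNmx; exact: tits_le.
Qed.

(** Each reflection of a shortest word adds [-2 rdot b (a i) >= 0] times the positive root
    [a i *m v]. *)
Lemma dominant (S : pred 'I_4) b g : (forall i, S i -> rdot b (a i) <= 0) -> words_in S g ->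
  pos (b *m g - b).
Proof.
move=> hb; apply: (@parabolic_ind S (fun g => pos (b *m g - b))) => [|i v Si hv pv IH].
  by move=> l; rewrite mulmx1 subrr mul0mx mxE.
rewrite mulmxA row_refl mulmxBl -scalemxAl addrAC -scaleNr; apply: posD => //.
by apply: posZ => //; rewrite oppr_ge0 pmulr_rle0 // hb.
Qed.

Definition chamber x := forall l, 0 <= (invmx V *m x) l 0.

Lemma a_eval i x : (a i *m x) 0 0 = c i * (invmx V *m x) i 0.
Proof.
have -> : a i *m x = a i *m V *m (invmx V *m x) by rewrite -[RHS]mulmxA mulKVmx // (cox_unit CD).
by rewrite (cox_row CD) -scalemxAl mxE -rowE mxE.
Qed.

Lemma a_ge0 i x : chamber x -> 0 <= (a i *m x) 0 0.
Proof. by move=> h; rewrite a_eval mulr_ge0 // ltW // (cox_gt0 CD). Qed.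

Lemma pos_eval b x : pos b -> chamber x -> 0 <= (b *m x) 0 0.
Proof.
move=> hb hx; have -> : b *m x = b *m V *m (invmx V *m x) by rewrite -[RHS]mulmxA mulKVmx // (cox_unit CD).
rewrite mxE sumr_ge0 // => l _.
exact: mulr_ge0.
Qed.

Theorem chamber_rigid g x : words g -> chamber x -> chamber (g *m x) ->
  g *m x = x /\ words_in (fun i => (a i *m x) 0 0 == 0) g.
Proof.
move=> hg hx; have [n] := ubnP (len g); elim: n g hg => // n IH g hg; rewrite ltnS => gn hy.
have [g0|g0] := posnP (len g).
  by rewrite (len_eq0 hg g0) mul1mx; split=> //; exact: words_in1.
have [i gi] := len_gt0 hg g0.
have e : (a i *m (g *m x)) 0 0 = 0.
  apply/eqP; rewrite eq_le a_ge0 // andbT.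
  by have := pos_eval (tits_le hg gi) hx; rewrite mulNmx mxE oppr_ge0 mulmxA.
have e' : refl i *m g *m x = g *m x by rewrite -mulmxA refl_fix.
have [||e1 e2] := IH _ (words_refl i hg); rewrite ?e' //; first by lia.
have e3 : g *m x = x by rewrite -e' e1.
split=> //; rewrite -(reflKl i g); apply: words_in_refl => //.
by rewrite -{1}e3 e.
Qed.

End Coxeter.

(** * Coxeter simplices, the tessellation and the solid *)

Section Normals.
Variable R : realType.
Implicit Types (X : geometry) (x y z u w : 'cV[R]_4) (g h k : 'M[R]_4) (b : 'rV[R]_4).

Lemma rdot_normal X b b' : rdot (Jn R X) b b' = normal_prod X b b'.
Proof. by rewrite normal_prodE -JnE /bl trmxK. Qed.

Lemma bl_dual X x u b : space X x -> (b *m x) 0 0 = 0 ->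
  bl (pform X x) u (Jn R X *m b^T) = (b *m u) 0 0.
Proof.
move=> hx hb; rewrite /bl -mulmxA pform_dual // -(trmx11 (b *m u)) trmx_mul //.
Qed.

Lemma normal_pair_ge0 X x b : space X x -> (b *m x) 0 0 = 0 -> 0 <= normal_prod X b b.
Proof.
move=> hx hb; have := @pform_ge0 R X x (Jn R X *m b^T) hx.
by rewrite !bl_dual // => /(_ hb); rewrite mulmxA -rdot_normal.
Qed.

Lemma normal_gt0 X x b : space X x -> (b *m x) 0 0 = 0 -> b != 0 -> 0 < normal_prod X b b.
Proof.
move=> hx hb b0; rewrite lt_neqAle (normal_pair_ge0 hx hb) andbT; apply/eqP => /esym h.
have := @pform_eq0 R X x (Jn R X *m b^T) hx.
rewrite !bl_dual // => /(_ hb); rewrite mulmxA => e.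
have {}e : Jn R X *m b^T = 0 by rewrite -rdot_normal in h; exact: e.
move: b0; rewrite -[b]trmxK -(pform_dual hx hb) e mulmx0 trmx0.
by rewrite eqxx.
Qed.

Lemma row_lin (s s' : R) b b' x :
  ((s *: b + s' *: b') *m x) 0 0 = s * (b *m x) 0 0 + s' * (b' *m x) 0 0.
Proof. by rewrite mulmxDl -!scalemxAl !mulrow4 !mxE !sum4; ring. Qed.

(** The sum of squares of [hyp_identity], extended to the closed light cone so that it applies to
    ideal vertices. *)
Lemma hyp_bf x y : 0 < x 0 0 -> sdot x x <= x 0 0 ^+ 2 -> 0 < y 0 0 -> sdot y y <= y 0 0 ^+ 2 ->
  0 <= bf Hyperbolic x y /\ (bf Hyperbolic x y = 0 -> y 0 0 *: x = x 0 0 *: y).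
Proof.
move=> px qx py qy; pose d i := x 0 0 * y i 0 - y 0 0 * x i 0.
have e : d o1 ^+ 2 + d o2 ^+ 2 + d o3 ^+ 2 + x 0 0 ^+ 2 * (y 0 0 ^+ 2 - sdot y y) +
   y 0 0 ^+ 2 * (x 0 0 ^+ 2 - sdot x x) = 2 * (x 0 0 * y 0 0 * bf Hyperbolic x y).
  by rewrite /d /bf !sdotE /=; ring.
have p1 : 0 <= x 0 0 ^+ 2 * (y 0 0 ^+ 2 - sdot y y) by rewrite mulr_ge0 ?sqr_ge0 ?subr_ge0.
have p2 : 0 <= y 0 0 ^+ 2 * (x 0 0 ^+ 2 - sdot x x) by rewrite mulr_ge0 ?sqr_ge0 ?subr_ge0.
have s1 := sqr_ge0 (d o1); have s2 := sqr_ge0 (d o2); have s3 := sqr_ge0 (d o3).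
split.
  by rewrite -(pmulr_rge0 _ (mulr_gt0 px py)); lra.
move=> b0; rewrite b0 !mulr0 in e.
have [d1 d2 d3 _] : [/\ d o1 = 0, d o2 = 0, d o3 = 0 & 0 = 0 :> R].
  by apply: sum4_sqr_eq0; rewrite expr0n addr0; lra.
by apply: eq_vec4; rewrite !mxE; [ring|move: d1|move: d2|move: d3]; rewrite /d; lra.
Qed.

End Normals.

(** * Auxiliary facts on finite sets and linear spans *)

Section FiniteSets.
Variable R : realType.

Lemma finite_argmin (T : choiceType) (A : set T) (f : T -> R) : finite_set A -> A !=set0 ->
  exists2 t, A t & forall t', A t' -> f t <= f t'.
Proof.
move=> /finite_seqP[s ->]; elim: s => [|t s IH] [v] //= _.
have [[v' v's]|s0] := pselect ([set` s] !=set0); last first.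
  exists t => [|t']; rewrite inE ?eqxx // => /orP[/eqP->//|t's].
  by case: s0; exists t'.
have [w ws hw] := IH (ex_intro _ v' v's).
case: (leP (f t) (f w)) => h.
  exists t => [|t']; rewrite inE ?eqxx // => /orP[/eqP->//|/hw]; exact: le_trans.
exists w => [|t']; rewrite inE; first by rewrite ws orbT.
by move=> /orP[/eqP->|/hw//]; exact: ltW.
Qed.

Lemma near_finite (T : choiceType) (U : topologicalType) (y : U) (A : set T) (P : T -> U -> Prop) :
  finite_set A -> (forall t, A t -> \forall z \near y, P t z) ->
  \forall z \near y, forall t, A t -> P t z.
Proof.
move=> /finite_seqP[s ->]; elim: s => [|t s IH] h; first by apply: filterE.
have h1 := h t (mem_head _ _).
have h2 : \forall z \near y, forall t, [set` s] t -> P t z.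
  by apply: IH => v vs; apply: h; rewrite /= inE vs orbT.
by apply: filterS2 h1 h2 => z p1 p2 v /=; rewrite inE => /orP[/eqP->//|/p2].
Qed.

End FiniteSets.

Section Spans.
Variable R : realType.

Lemma rank_inj m n (B : 'M[R]_(m, n)) : (forall t : 'cV_n, B *m t = 0 -> t = 0) -> \rank B = n.
Proof.
move=> inj; rewrite -mxrank_tr; apply/eqP; rewrite -[_ == _]/(row_free B^T) -kermx_eq0.
apply/eqP/row_matrixP=> i; rewrite row0; apply: (can_inj (@trmxK _ _ _)); rewrite trmx0; apply: inj.
by apply: (can_inj (@trmxK _ _ _)); rewrite trmx_mul trmxK -row_mul mulmx_ker row0 trmx0.
Qed.

Lemma spans_dim_rank d n (S : set 'cV[R]_4) (C : 'M[R]_(4, n)) :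
  spans_dim d S -> (forall j, S (col j C)) -> (\rank C <= d)%N.
Proof.
move=> [B [_ _ hB]] hC.
have ht j : exists t, col j C = B *m t by exact: hB.
have [t et] := boolp.choice ht.
have -> : C = B *m \matrix_(i, j) t j i 0.
  apply/matrixP => i j; have := et j => /(congr1 (fun m : 'cV_4 => m i 0)).
  by rewrite !mxE => ->; apply: eq_bigr => k _; rewrite !mxE.
exact: mulmx_max_rank.
Qed.

End Spans.

(** * The axis of a rotation *)

Section Axis.
Variable R : realType.
Implicit Types (x u : 'cV[R]_4) (g J : 'M[R]_4).

(* With P the projection onto the fixed line, M = g - 1 + P satisfies
   (1 - g + P)^T J g = J M and 1 - g + P = M (2 P - 1), and det (2 P - 1) = -1;
   hence det M = - det M. *)
Lemma rotation_axis J g x : J^T = J -> J \in unitmx -> g^T *m J *m g = J -> g *m x = x ->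
  bl J x x != 0 -> \det g = 1 -> exists u, [/\ g *m u = u, u != 0 & bl J x u = 0].
Proof.
move=> Js Ju hg gx xx dg; set c := bl J x x in xx.
have [xi xiE] : {xi : 'rV[R]_4 | xi = c^-1 *: (x^T *m J)} by eexists.
have xix : xi *m x = 1%:M.
  rewrite xiE -scalemxAl; apply/matrixP => i j; rewrite !ord1 mxE [1%:M _ _]mxE eqxx.
  by rewrite -/(bl J x x) -/c mulVf.
have xig : xi *m g = xi.
  by rewrite xiE -scalemxAl -{1}gx trmx_mul -!mulmxA [g^T *m _]mulmxA hg.
have [P PE] : {P | P = x *m xi} by eexists.
have gP : g *m P = P by rewrite PE mulmxA gx.
have Pg : P *m g = P by rewrite PE -mulmxA xig.
have PP : P *m P = P by rewrite PE mulmxA -(mulmxA x) xix mulmx1.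
have PJ : P^T *m J = J *m P.
  by rewrite PE trmx_mul xiE linearZ /= trmx_mul trmxK Js -!scalemxAr -!scalemxAl !mulmxA.
have [M ME] : {M | M = g - 1%:M + P} by eexists.
have [A AE] : {A | A = 1%:M - g + P} by eexists.
have MA : M *m (2 *: P - 1%:M) = A.
  rewrite ME AE mulmxBr mulmx1 -scalemxAr !mulmxDl mulNmx mul1mx gP PP subrr add0r.
  by apply/matrixP => i j; rewrite !mxE; ring.
have AM : A^T *m J *m g = J *m M.
  rewrite ME AE !linearD /= linearN /= trmx1 !mulmxDl mul1mx !mulNmx hg PJ -[J *m P *m g]mulmxA Pg.
  by rewrite mulmxN mulmx1.
have d2 : \det (2 *: P - 1%:M) = -1 :> R.
  have -> : 2 *: P - 1%:M = (-1) *: (1%:M + x *m (- 2 *: xi)).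
    by rewrite -scalemxAr -PE; apply/matrixP => i j; rewrite !mxE; ring.
  rewrite detZ det_one_add_mul -scalemxAl xix [X in 1 + X]mxE [1%:M _ _]mxE eqxx mulr1n; ring.
have dJ : \det J != 0 by rewrite -unitfE -unitmxE.
have dM : \det M = 0.
  have h1 := congr1 (fun B => \det B) MA; have h2 := congr1 (fun B => \det B) AM.
  move: h1 h2; rewrite !det_mulmx det_tr dg d2 => h1 h2.
  have : \det A = \det M by apply: (mulfI dJ); rewrite -h2; ring.
  by rewrite -h1 => h; lra.
have /eqP/det0P[v v0 hv] : \det M^T = 0 by rewrite det_tr.
have Mv : M *m v^T = 0 by rewrite -[M]trmxK -trmx_mul hv trmx0.
have xiv : xi *m v^T = 0.
  have : xi *m (M *m v^T) = 0 by rewrite Mv mulmx0.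
  by rewrite mulmxA ME mulmxDr mulmxBr xig mulmx1 subrr add0r PE mulmxA xix mul1mx.
exists v^T; split.
- by move: Mv; rewrite ME PE mulmxDl -mulmxA xiv mulmx0 addr0 mulmxBl mul1mx => /subr0_eq.
- by rewrite trmx_eq0.
- have /eqP : (xi *m v^T) 0 0 = 0 by rewrite xiv mxE.
  by rewrite xiE -scalemxAl mxE mulf_eq0 invr_eq0 (negbTE xx) => /eqP.
Qed.

End Axis.

(** If [f i = f j], index j can be skipped, and A would be an image of n - 1 indices. This turns
    condition (3) into the distinctness of the listed points. *)
Lemma card_image_II_inj (U : Type) (A : set U) n (f : nat -> U) : (A #= `I_n)%card ->
  A `<=` f @` `I_n -> forall i j, (i < j)%N -> (j < n)%N -> f i <> f j.
Proof.
move=> An Af i j ij jn e; pose g m := f (if (m < j)%N then m else m.+1).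
have Ag : A `<=` g @` `I_(n.-1).
  move=> z /Af[m /= mn <-]; have [mj|jm|->] := ltngtP m j.
  - by exists m; rewrite /g /= ?mj //; lia.
  - exists m.-1; first by rewrite /=; lia.
    by rewrite /g; case: ltnP => h; [lia|rewrite prednK //; lia].
  - by exists i; rewrite /g /= ?ij //; lia.
have := card_le_trans (subset_card_le Ag) (card_image_le g `I_(n.-1)).
by rewrite (card_le_eql An) card_le_II; lia.
Qed.

Lemma mulmx_continuous (R : realType) (g : 'M[R]_4) : continuous (fun z : 'cV[R]_4 => g *m z).
Proof.
have -> : (fun z : 'cV[R]_4 => g *m z) = (fun z : 'cV[R]_4 =>
    z 0 0 *: col 0 g + (z o1 0 *: col o1 g + (z o2 0 *: col o2 g + z o3 0 *: col o3 g))).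
  by apply/funext => z; apply/colP => i; rewrite mxE sum4 !mxE; ring.
move=> z; have c i : (fun w : 'cV[R]_4 => w i 0 *: col i g) @ z --> z i 0 *: col i g.
  apply: (@cvgZ _ _ _ _ (nbhs_filter z)); last exact: (@cvg_cst _ _ _ _ (nbhs_filter z)).
  exact: (@coord_continuous R 4 1 i 0 z).
by do 3!apply: (@cvgD _ _ _ _ (nbhs_filter z)) => //.
Qed.

(** * Unit normals of the simplex *)

Section CoxeterSimplex.
Variables (R : realType) (X : geometry) (V : 'M[R]_4) (p q r : nat).
Hypotheses (hp : (3 <= p)%N) (hq : (3 <= q)%N) (hr : (3 <= r)%N).
Hypothesis hV : linear_coxeter_simplex X V p q r.
Implicit Types (x y z u w : 'cV[R]_4) (g h k : 'M[R]_4) (b : 'rV[R]_4) (i j l : 'I_4).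

Lemma simplex_unit : V \in unitmx. Proof. by case: hV => -[]. Qed.

Lemma bf_comb (t : 'cV[R]_4) : bf X (V *m t) (V *m t) =
  \sum_i \sum_j t i 0 * t j 0 * bf X (col i V) (col j V).
Proof. by rewrite /bf !sum4 !sdotE !mxE !sum4; ring. Qed.

Lemma vertex_coord i : X = Hyperbolic -> 0 < V 0 i /\ sdot (col i V) (col i V) <= V 0 i ^+ 2.
Proof.
move=> XH; have [[_ /(_ i)]] := hV; rewrite {1 2}XH => +  _ => -[[h1 h2]|[_ h1 h2]].
  by move: h1 h2; rewrite !mxE => h1 h2; split=> //; lra.
by move: h1 h2; rewrite !mxE => h1 h2; split=> //; rewrite h2.
Qed.

Lemma bf_vertices_ge0 i j : X = Hyperbolic -> 0 <= bf X (col i V) (col j V).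
Proof.
move=> XH; have [pi qi] := vertex_coord i XH; have [pj qj] := vertex_coord j XH.
by rewrite XH; have [] := @hyp_bf R (col i V) (col j V); rewrite ?mxE.
Qed.

Lemma bf_vertices_gt0 i j : X = Hyperbolic -> i != j -> 0 < bf X (col i V) (col j V).
Proof.
move=> XH ij; rewrite lt_neqAle bf_vertices_ge0 // andbT; apply/eqP => /esym.
have [pi qi] := vertex_coord i XH; have [pj qj] := vertex_coord j XH.
rewrite XH; have [||||_ h /h] := @hyp_bf R (col i V) (col j V); rewrite ?mxE //.
rewrite !colE !scalemxAr => /(can_inj (mulKmx simplex_unit)) /(congr1 (fun m : 'cV_4 => m i 0)).
rewrite !mxE eqxx (negbTE ij) mulr1 mulr0 => e.
by move: pj; rewrite e ltxx.
Qed.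

(** Why two positive coefficients: a hyperbolic vertex may be ideal, with [bf] equal to 0, but two
    different vertices always have a positive product. *)
Lemma cone_comb (t : 'cV[R]_4) i j : (forall l, 0 <= t l 0) -> 0 < t i 0 -> 0 < t j 0 -> i != j ->
  cone X (V *m t).
Proof.
move=> t0 ti tj ij.
have [XS|XnS] := pselect (X = Spherical).
  have : V *m t != 0.
    apply/eqP => e; move: ti; rewrite -(mulKmx simplex_unit t) e mulmx0 mxE ltxx //.
  rewrite XS /cone /bf /= mul1r sdotE => vt; split=> //.
  rewrite lt_neqAle !addr_ge0 ?andbT -?expr2 ?sqr_ge0 //; apply/eqP => /esym.
  rewrite !addrA => /sum4_sqr_eq0[*]; move/eqP: vt; apply.
  by apply: eq_vec4; rewrite [RHS]mxE.
have [XE|XnE] := pselect (X = Euclidean).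
  have v0 l : V 0 l = 1.
    have [[_ /(_ l)]] := hV; rewrite {1 2}XE => + _ => -[/=|[]//].
    by rewrite mxE.
  have : 0 < (V *m t) 0 0.
    rewrite mxE (bigD1 i) //= v0 mul1r ltr_pwDl // sumr_ge0 // => l _.
    by rewrite v0 mul1r.
  by rewrite XE /cone /bf /= mul0r addr0 => h; split=> //; rewrite mulr_gt0.
have XH : X = Hyperbolic by case: (X) XnS XnE.
split.
  rewrite bf_comb pair_bigA /= (bigD1 (i, j)) //= ltr_pwDl //.
    by rewrite !mulr_gt0 // bf_vertices_gt0.
  by apply: sumr_ge0 => l _; rewrite !mulr_ge0 // bf_vertices_ge0.
rewrite XH /= mxE (bigD1 i) //= ltr_pwDl //.
  by rewrite mulr_gt0 // (vertex_coord i XH).1.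
by apply: sumr_ge0 => l _; rewrite mulr_ge0 // ltW // (vertex_coord l XH).1.
Qed.

Lemma two_others i j : exists l l', [/\ l != l', (l != i) && (l' != i) & (l != j) && (l' != j)].
Proof.
move: i j; apply: ord4P; apply: ord4P;
 first [by exists 0, o1 | by exists 0, o2 | by exists 0, o3 | by exists o1, o2
   | by exists o1, o3 | by exists o2, o3].
Qed.

Lemma face_form_mul i u : (face_form V i *m u) 0 0 = (invmx V *m u) i 0.
Proof. by rewrite /face_form -row_mul mxE. Qed.

(** The projected midpoint of two other vertices, which is in the space even if both are ideal.
    Through it the indefinite form becomes definite on the normals of the two planes. *)
Lemma common_point i j : exists2 x, space X x &
  (face_form V i *m x) 0 0 = 0 /\ (face_form V j *m x) 0 0 = 0.
Proof.
have [l [l' [ll /andP[li l'i] /andP[lj l'j]]]] := two_others i j.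
pose t : 'cV[R]_4 := delta_mx l 0 + delta_mx l' 0.
have ct : cone X (V *m t).
  apply: (@cone_comb t l l') => // [k||]; rewrite !mxE ?eqxx /=.
  - by rewrite addr_ge0 ?ler0n.
  - by rewrite ltr_pwDl ?ltr01 ?ler0n.
  - by rewrite ltr_wpDl ?ltr01 ?ler0n.
have [c c0 rc] := rho_scale ct; exists (rho X (V *m t)); first exact: rho_space.
rewrite !face_form_mul rc -!scalemxAr !mulKmx ?simplex_unit // !mxE.
by rewrite ![_ == l]eq_sym ![_ == l']eq_sym !(negbTE li, negbTE l'i, negbTE lj, negbTE l'j) /= addr0 mulr0.
Qed.

Lemma face_form_neq0 i : face_form V i != 0.
Proof.
apply/eqP => e; have := face_form_mul i (V *m delta_mx i 0).
by rewrite e mul0mx mulKmx ?simplex_unit // !mxE eqxx => /eqP; rewrite eq_sym oner_eq0.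
Qed.

Definition nsq i : R := normal_prod X (face_form V i) (face_form V i).

Lemma nsq_gt0 i : 0 < nsq i.
Proof.
have [x hx [h _]] := common_point i i; exact: (normal_gt0 hx h (face_form_neq0 i)).
Qed.

Definition nf_row i : 'rV[R]_4 := (Num.sqrt (nsq i))^-1 *: face_form V i.

Definition label i j : nat :=
  if (i < j)%N then symbol_label p q r i j else symbol_label p q r j i.

Lemma normal_prodZ (s s' : R) b b' :
  normal_prod X (s *: b) (s' *: b') = s * s' * normal_prod X b b'.
Proof. by rewrite !normal_prodE /nf !sdotE !mxE; ring. Qed.

Lemma normal_prodC b b' : normal_prod X b b' = normal_prod X b' b.
Proof. by rewrite !normal_prodE /nf !sdotE !mxE; ring. Qed.

(** Cauchy-Schwarz holds because the Gram-Schmidt combination b vanishes at a common point of the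
    planes and so has nonnegative norm. It puts the argument of [acos] in [-1, 1]. *)
Lemma normal_cs i j : normal_prod X (face_form V i) (face_form V j) ^+ 2 <= nsq i * nsq j.
Proof.
have [x hx [hi hj]] := common_point i j.
rewrite -subr_ge0 -(pmulr_rge0 _ (nsq_gt0 j)); set n := normal_prod _ _ _.
pose b := nsq j *: face_form V i - n *: face_form V j.
have hb : (b *m x) 0 0 = 0.
  by rewrite /b -scaleNr row_lin hi hj !mulr0 addr0.
have := normal_pair_ge0 hx hb.
suff -> : normal_prod X b b = nsq j * (nsq i * nsq j - n ^+ 2) by [].
rewrite /b /n /nsq !normal_prodE /nf !sdotE !mxE; ring.
Qed.

Lemma label_symbol i j : (i < j)%N ->
  normal_prod X (face_form V i) (face_form V j) =
  - cos (pi / (symbol_label p q r i j)%:R) * Num.sqrt (nsq i * nsq j).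
Proof.
move=> ij; have [_ /(_ i j ij) <-] := hV; rewrite /dihedral_angle -/(nsq i) -/(nsq j).
have s0 : 0 < Num.sqrt (nsq i * nsq j) by rewrite sqrtr_gt0 mulr_gt0 // nsq_gt0.
rewrite acosK; first by rewrite !mulNr opprK divfK // gt_eqF.
have := normal_cs i j; set n := normal_prod _ _ _ => h.
rewrite in_itv /= -ler_norml normrM normfV normrN (gtr0_norm s0) ler_pdivrMr // mul1r.
by rewrite -sqrtr_sqr ler_wsqrtr.
Qed.

Lemma label_ge2 i j : i != j -> (1 < label i j)%N.
Proof.
move: i j; apply: ord4P; apply: ord4P => // _; rewrite /label /symbol_label /=; lia.
Qed.

Lemma labelC i j : label i j = label j i.
Proof.
rewrite /label; case: (ltngtP i j) => // e.
by have -> : i = j by apply: val_inj.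
Qed.

Lemma coxeter_simplex_data :
  coxeter_data (Jn R X) V nf_row (fun i => (Num.sqrt (nsq i))^-1) label.
Proof.
have sgt i : 0 < Num.sqrt (nsq i) by rewrite sqrtr_gt0 nsq_gt0.
have symb i j : (i < j)%N -> rdot (Jn R X) (nf_row i) (nf_row j) = - cos (pi / (label i j)%:R).
  move=> ij; rewrite rdot_normal normal_prodZ label_symbol // /label ij.
  rewrite sqrtrM ?ltW ?nsq_gt0 // mulrC -mulrA [X in _ * X](_ : _ = 1) ?mulr1 //.
  by have := sgt i; have := sgt j => h1 h2; field; rewrite !gt_eqF.
split.
- exact: Jn_tr.
- exact: simplex_unit.
- by move=> i; rewrite /nf_row -scalemxAl /face_form -row_mul mulVmx ?simplex_unit // rowE mulmx1.
- by move=> i; rewrite invr_gt0.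
- move=> i; rewrite rdot_normal normal_prodZ -/(nsq i) -invfM -expr2 sqr_sqrtr ?mulVf //.
    by rewrite gt_eqF // nsq_gt0.
  by rewrite ltW // nsq_gt0.
- move=> i j ij; case: (ltngtP i j) => e; first exact: symb.
    rewrite rdot_normal normal_prodC -rdot_normal labelC; exact: symb.
  by move: ij; rewrite (_ : i = j) ?eqxx //; apply: val_inj.
- exact: label_ge2.
- exact: labelC.
Qed.

Local Notation J := (Jn R X).
Local Notation a := nf_row.
Local Notation s := (refl J a).
Local Notation Gam := (words J a).
Local Notation rdot := (rdot J).
Local Notation T := (apex_group X V).
Local Notation Sigma := (solid X V).

Let VU : V \in unitmx := simplex_unit.

Lemma CD : coxeter_data J V a (fun i => (Num.sqrt (nsq i))^-1) label.
Proof. exact: coxeter_simplex_data. Qed.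

Lemma sqrt_nsq_gt0 i : 0 < Num.sqrt (nsq i).
Proof. by rewrite sqrtr_gt0 nsq_gt0. Qed.

Lemma simplexE x : simplex X V x <-> space X x /\ chamber V x.
Proof.
split=> [[hx [t [t0 e]]]|[hx hc]]; split=> //.
  by rewrite e => l; rewrite mulKmx.
by exists (invmx V *m x); rewrite mulKVmx.
Qed.

Lemma a_zero i x : (a i *m x) 0 0 = 0 <-> (invmx V *m x) i 0 = 0.
Proof.
rewrite (a_eval CD); split=> [/eqP|->]; last by rewrite mulr0.
by rewrite mulf_eq0 invr_eq0 gt_eqF ?sqrt_nsq_gt0 // => /eqP.
Qed.

Lemma a_lt0 i x : ((a i *m x) 0 0 < 0) = ((invmx V *m x) i 0 < 0).
Proof. by rewrite (a_eval CD) pmulr_rlt0 // invr_gt0 sqrt_nsq_gt0. Qed.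

Lemma a_gt0 i x : (0 < (a i *m x) 0 0) = (0 < (invmx V *m x) i 0).
Proof. by rewrite (a_eval CD) pmulr_rgt0 // invr_gt0 sqrt_nsq_gt0. Qed.

Lemma simplex_faceE i x : simplex_face X V i x <->
  [/\ space X x, chamber V x & (a i *m x) 0 0 = 0].
Proof.
split=> [[hx [t [t0 ti e]]]|[hx hc /a_zero h]]; split=> //.
- by rewrite e => l; rewrite mulKmx.
- by apply/a_zero; rewrite e mulKmx.
- by exists (invmx V *m x); rewrite mulKVmx.
Qed.

(** * The reflections generate the Coxeter group *)

Lemma wall_point i : exists2 x, space X x & (a i *m x) 0 0 = 0.
Proof.
have [x hx [h _]] := common_point i i; exists x => //; apply/a_zero.
by rewrite -face_form_mul.
Qed.

Lemma refl_isometry i : isometry X (s i).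
Proof.
have [x hx ax] := wall_point i.
have sx : s i *m x = x by exact: refl_fix.
apply: (pform_isometry hx); rewrite sx //; apply: bl_ext => u w.
rewrite -bl_mul !col_refl !blE (bl_dual _ hx ax) (pform_sym _ x (J *m (a i)^T)) !(bl_dual _ hx ax).
by rewrite mulmxA -[in X in _ + X]/(rdot (a i) (a i)) (cox_norm CD); ring.
Qed.

Lemma refl_neq1 i : s i <> 1%:M.
Proof.
move=> /(congr1 determinant); rewrite (det_refl CD) det1 => /eqP.
by rewrite eq_sym -addr_eq0 -mulr2n pnatr_eq0.
Qed.

(** Fixing the face pointwise, g fixes its linear span, so [g *m w = w + (a i *m w) n] for a single
    vector n. Invariance of the form makes n a multiple of the normal, with coefficient 0 or -2. *)
Lemma reflection_uniq i g : isometry X g ->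
  (forall x, simplex_face X V i x -> g *m x = x) -> g = 1%:M \/ g = s i.
Proof.
move=> hg fixg.
pose f : 'cV[R]_4 := \col_l (l != i)%:R.
have face_fix (t : 'cV[R]_4) : (forall l, 0 <= t l 0) -> t i 0 = 0 ->
    (forall l, l != i -> 0 < t l 0) -> g *m (V *m t) = V *m t.
  move=> t0 ti tl; have [l [l' [ll /andP[li l'i] _]]] := two_others i i.
  have ct := cone_comb t0 (tl _ li) (tl _ l'i) ll.
  have [c c0 rc] := rho_scale ct.
  have := fixg (rho X (V *m t)); rewrite rc -scalemxAr => H.
  have /H : simplex_face X V i (c *: (V *m t)).
    split; first by rewrite -rc; exact: rho_space.
    exists (c *: t); split; last by rewrite -scalemxAr.
      by move=> k; rewrite mxE mulr_ge0 // ltW.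
    by rewrite mxE ti mulr0.
  by apply: scalerI; rewrite gt_eqF.
have ff : g *m (V *m f) = V *m f.
  by apply: face_fix => [l||l li]; rewrite !mxE ?eqxx // ?ler0n // li.
(* Vertex j may be ideal, so it is reached as the difference of two vectors with positive
   coefficients off i. *)
have fe j : j != i -> g *m (V *m delta_mx j 0) = V *m (delta_mx j 0 : 'cV[R]_4).
  move=> ji; have : g *m (V *m (f + delta_mx j 0)) = V *m (f + delta_mx j 0).
    apply: face_fix => [l||l li]; rewrite !mxE.
    - by rewrite addr_ge0 ?ler0n.
    - by rewrite eqxx eq_sym (negbTE ji) addr0.
    - by rewrite li ltr_pwDl ?ltr01 ?ler0n.
  by rewrite (mulmxDr V) (mulmxDr g) ff => /addrI.
pose n : 'cV[R]_4 := Num.sqrt (nsq i) *: (g *m (V *m delta_mx i 0) - V *m delta_mx i 0).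
have gE w : g *m w = w + (a i *m w) 0 0 *: n.
  have -> : (a i *m w) 0 0 *: n = (invmx V *m w) i 0 *: (g *m (V *m delta_mx i 0) - V *m delta_mx i 0).
    by rewrite /n scalerA (a_eval CD) mulrAC mulVf ?mul1r // gt_eqF // sqrt_nsq_gt0.
  rewrite -{1 2}(mulKVmx VU w); move: (invmx V *m w) => t.
  have -> : t = \sum_j t j 0 *: delta_mx j 0.
    by rewrite [LHS]matrix_sum_delta; apply: eq_bigr => j _; rewrite big_ord1.
  rewrite !mulmx_sumr (bigD1 i) //= [in RHS](bigD1 i) //= [X in _ + X = _](eq_bigr
    (fun j => V *m (t j 0 *: delta_mx j 0))); last first.
    by move=> j ji; rewrite -!scalemxAr fe.
  have -> : (\sum_j t j 0 *: (delta_mx j 0 : 'cV[R]_4)) i 0 = t i 0.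
    rewrite summxE (bigD1 i) //= !mxE eqxx mulr1 big1 ?addr0 // => j ji.
    by rewrite !mxE eq_sym (negbTE ji) mulr0.
  rewrite -!scalemxAr addrAC; congr (_ + _).
  by rewrite scalerBr addrC subrK.
have [x hx ax] := wall_point i.
clearbody n.
have gx : g *m x = x by rewrite gE ax scale0r addr0.
have := isometry_pform hg hx; rewrite gx => gJ.
pose B := bl (pform X x).
have BE u w : (a i *m w) 0 0 * B u n + (a i *m u) 0 0 * B n w +
   (a i *m u) 0 0 * (a i *m w) 0 0 * B n n = 0.
  have : B (g *m u) (g *m w) = B u w by rewrite /B bl_mul gJ.
  by rewrite !gE /B !blE; lra.
pose m := J *m (a i)^T.
have am : (a i *m m) 0 0 = 1 by rewrite /m mulmxA; exact: (cox_norm CD i).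
have Bm u : B u m = (a i *m u) 0 0 by exact: bl_dual.
have Bn u : B u n = - (B n n / 2) * (a i *m u) 0 0.
  have := BE m m; have := BE u m; rewrite am (pform_sym _ x n m : B n m = B m n) => h1 h2.
  by nra.
have en : n = - (B n n / 2) *: m.
  apply: subr0_eq; apply: (bl_nondeg (pform_unit hx)) => u; rewrite -/B.
  by rewrite /B !blE -/B Bn Bm subrr.
(* The two roots are the identity and the reflection. *)
have : B n n * (B n n - 4) = 0.
  have : B n n = (B n n / 2) ^+ 2.
    have an : (a i *m n) 0 0 = - (B n n / 2) by rewrite {1}en -scalemxAr mxE am mulr1.
    by have := Bn n; rewrite an => e; rewrite [LHS]e; ring.
  move=> e; rewrite mulrBr; nra.
move=> /eqP; rewrite mulf_eq0 subr_eq0 => /orP[]/eqP v.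
  left; apply: (can_inj (mulmxK (isometry_unit (isometry1 R X)))); apply/matrixP => k l.
  have := gE (delta_mx l 0); rewrite en v mul0r oppr0 scale0r scaler0 addr0 -colE.
  by move=> /(congr1 (fun w : 'cV_4 => w k 0)); rewrite !mulmx1 !mxE eqxx andbT.
right; apply/matrixP => k l.
have := gE (delta_mx l 0); rewrite en v.
have -> : - (4 / 2) = -2 :> R by field.
have := col_refl J a (delta_mx l 0) i; rewrite -/m => e1 e2.
have : g *m delta_mx l 0 = s i *m (delta_mx l 0 : 'cV[R]_4).
  by rewrite e1 e2 scalerA mulrC mulNr scaleNr.
by rewrite -!colE => /(congr1 (fun w : 'cV_4 => w k 0)); rewrite [LHS]mxE [RHS]mxE.
Qed.

Lemma coxeter_groupE : coxeter_group X V = Gam.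
Proof.
have gg : mx_group Gam.
  split; [exact: (words_unit CD)|exact: words1|exact: words_mul|exact: (words_inv CD)].
apply/seteqP; split=> [g|g [w _ <-]].
  apply=> /=; split=> // h [i [hi h1 hf]].
  have [e|->] := reflection_uniq hi hf; first by case: h1.
  by exists [:: i] => //=; rewrite mulmx1.
move=> A [[_ A1 AM _] hA]; elim: w => [|i w IH] //=.
apply: AM => //; apply: hA; exists i; split.
- exact: refl_isometry.
- exact: refl_neq1.
- by move=> x /simplex_faceE[_ _ h]; exact: refl_fix.
Qed.

Lemma Gam_group : isometry_group X Gam.
Proof.
split; first by split; [exact: (words_unit CD)|exact: words1|exact: words_mul|exact: (words_inv CD)].
move=> g [w _ <-]; elim: w => [|i w IH] /=; first exact: isometry1.
by apply: isometry_mul => //; exact: refl_isometry.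
Qed.

Lemma Gam_isometry g : Gam g -> isometry X g.
Proof. exact: (Gam_group).2. Qed.

(** * The tessellation by translates of the simplex *)

Definition center : 'cV[R]_4 := rho X (V *m const_mx 1).

Lemma center_cone : cone X (V *m const_mx 1).
Proof. by apply: (@cone_comb _ 0 o1) => // *; rewrite mxE. Qed.

Lemma center_space : space X center. Proof. exact: rho_space center_cone. Qed.

Lemma center_gt0 i : 0 < (invmx V *m center) i 0.
Proof.
have [c c0] := rho_scale center_cone; rewrite -/center => ->.
by rewrite -scalemxAr mulKmx // !mxE mulr1.
Qed.

Lemma center_chamber : chamber V center.
Proof. by move=> l; exact/ltW/center_gt0. Qed.

Lemma center_rigid g : Gam g -> chamber V (g *m center) -> g = 1%:M.
Proof.
move=> hg hc; have [_ [[|i w] /=]] := chamber_rigid CD hg center_chamber hc; first by move=> _ <-.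
by move=> /andP[/eqP /a_zero h] _; have := center_gt0 i; rewrite h ltxx.
Qed.

Lemma interior_open x : (forall i, 0 < (invmx V *m x) i 0) ->
  \forall z \near x, forall i, 0 < (invmx V *m z) i 0.
Proof.
move=> h; have n i : \forall z \near x, 0 < (a i *m z) 0 0.
  by apply: near_row_gt0; rewrite a_gt0.
apply: filterS (filterI (filterI (n 0) (n o1)) (filterI (n o2) (n o3))) => z [[z0 z1] [z2 z3]].
by apply: ord4P; rewrite -a_gt0.
Qed.

Lemma chord_coord_lt y z (e : R) : 0 < e <= 1 -> (forall i, `|y i 0 - z i 0| < e) ->
  chord X y z < 4 * e.
Proof.
move=> /andP[e0 e1] h; rewrite /chord /nf sdotE !mxE.
have sq i : (y i 0 - z i 0) * (y i 0 - z i 0) < e.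
  have := h i; rewrite ltr_norml => /andP[h1 h2]; nra.
have := sq 0; have := sq o1; have := sq o2; have := sq o3.
have : sg R X * ((y 0 0 - z 0 0) * (y 0 0 - z 0 0)) <= (y 0 0 - z 0 0) * (y 0 0 - z 0 0).
  apply: ler_piMl; first by rewrite -expr2 sqr_ge0.
  by case: (X) => //=; lra.
lra.
Qed.

(** The orbit of [center] is uniformly separated, since a chord ball around [center] lies inside the
    chamber. With coordinates confined to a box, rounding them on a grid of mesh e is injective and
    has finitely many values. *)
Lemma orbit_finite (c : R) : finite_set [set g | Gam g /\ chord X center (g *m center) <= c].
Proof.
have [d d0 hd] := chord_near center_space (interior_open center_gt0).
pose e : R := Num.min 1 (d / 4).
have e0 : 0 < e by rewrite lt_min ltr01 divr_gt0.
have sep g h : Gam g -> Gam h -> (forall i, `|(g *m center) i 0 - (h *m center) i 0| < e) -> g = h.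
  move=> hg hh near_gh; have ig := Gam_isometry hg; have ih := Gam_isometry hh.
  have hk : Gam (invmx g *m h) by apply: words_mul => //; exact: words_inv CD _ hg.
  have gU := words_unit CD hg.
  have lt1 : chord X center (invmx g *m h *m center) < d.
    rewrite -(isometry_chord ig center_space (isometry_space (Gam_isometry hk) center_space)).
    rewrite !mulmxA mulmxV // mul1mx.
    apply: (@lt_le_trans _ _ (4 * e)); last by have := ge_min (d / 4) 1 (d / 4); rewrite /e lexx orbT; lra.
    by apply: chord_coord_lt => //; rewrite e0 /e ge_min lexx.
  have hs := isometry_space (Gam_isometry hk) center_space.
  have kc : chamber V (invmx g *m h *m center) by move=> l; exact/ltW/hd.
  by rewrite -[h](mulKVmx gU) (center_rigid hk kc) mulmx1.
(* B comes from [coord_bound], with the chord from [base] estimated through [center] by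
   [chord_triangle]. *)
pose s0 := chord X (base R) center + c; pose B : R := 1 + (2 * s0 + s0 ^+ 2 / 4) / 2.
have bound g i : Gam g -> chord X center (g *m center) <= c -> `|(g *m center) i 0| <= B.
  move=> hg hc; have hs := isometry_space (Gam_isometry hg) center_space.
  apply: le_trans (coord_bound i hs) _; rewrite /B lerD2l ler_pM2r ?invr_gt0 //.
  have := chord_triangle (space_base R X) center_space hs.
  have := chord_ge0 (space_base R X) center_space; have := chord_ge0 center_space hs.
  rewrite /s0 => c1 c2 /= h; apply: le_trans h _; nra.
pose N := Num.trunc ((2 * B) / e).
pose f g : {ffun 'I_4 -> 'I_N.+1} := [ffun i => inord (Num.trunc (((g *m center) i 0 + B) / e))].
have finj : {in [set g | Gam g /\ chord X center (g *m center) <= c] &, injective f}.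
  move=> g h; rewrite !inE => -[hg cg] [hh ch] fgh; apply: sep => // i.
  have := congr1 (fun F : {ffun 'I_4 -> 'I_N.+1} => F i : nat) fgh; rewrite !ffunE.
  have tb k : Gam k -> chord X center (k *m center) <= c ->
      0 <= ((k *m center) i 0 + B) / e /\ leq (Num.trunc (((k *m center) i 0 + B) / e)) N.
    move=> hk ck; have := bound k i hk ck; rewrite ler_norml => /andP[b1 b2]; split.
      by rewrite divr_ge0 ?(ltW e0) //; lra.
    by apply: le_truncn; rewrite ler_pM2r ?invr_gt0 //; lra.
  have [g0 gN] := tb g hg cg; have [h0 hN] := tb h hh ch.
  rewrite !inordK ?ltnS // => E.
  have := truncn_itv g0; have := truncn_itv h0; rewrite E => /andP[a1 a2] /andP[b1 b2].
  rewrite ltr_norml -(ltr_pM2r (_ : 0 < e^-1)) ?invr_gt0 // -[X in _ && X](ltr_pM2r (_ : 0 < e^-1)) ?invr_gt0 //.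
  move: a1 a2 b1 b2; rewrite -natr1; set n := (Num.trunc _)%:R.
  rewrite !mulrDl mulNr mulfV ?gt_eqF // => a1 a2 b1 b2.
  by apply/andP; split; lra.
rewrite -(eq_finite_set (inj_card_eq finj)); exact: finite_finset.
Qed.

Lemma orbit_finite_at y (c : R) : space X y ->
  finite_set [set g | Gam g /\ chord X center (g *m y) <= c].
Proof.
move=> hy; pose t := chord X y center + c.
apply: sub_finite_set (orbit_finite (2 * (c + chord X y center) + (c + chord X y center) ^+ 2 / 4)).
move=> g [hg hc]; split=> //; have ig := Gam_isometry hg.
have hgy := isometry_space ig hy; have hgc := isometry_space ig center_space.
have := chord_triangle center_space hgy hgc; rewrite (isometry_chord ig hy center_space) /=.
have := chord_ge0 center_space hgy; have := chord_ge0 hy center_space => c1 c2 h.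
by apply: le_trans h _; nra.
Qed.

(** The squared chord changes by [4 (a i z) (a i center)], a negative number. *)
Lemma reflect_closer i z : space X z -> (a i *m z) 0 0 < 0 ->
  chord X center (s i *m z) < chord X center z.
Proof.
move=> hz az; have [x hx ax] := wall_point i.
have hsz := isometry_space (refl_isometry i) hz.
rewrite (pform_chord x center_space hsz) (pform_chord x center_space hz) col_refl.
set m := J *m (a i)^T; rewrite opprD opprK addrA.
have [d ed] : {d : 'cV[R]_4 | d = center - z} by exists (center - z).
have mm : bl (pform X x) m m = 1 by rewrite bl_dual // /m mulmxA; exact: (cox_norm CD i).
have dm : bl (pform X x) d m = (a i *m center) 0 0 - (a i *m z) 0 0.
  by rewrite bl_dual // ed mulmxBr [LHS]mxE [X in _ + X]mxE.
rewrite -ed !blE mm (pform_sym _ x m) dm.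
have : 0 < (a i *m center) 0 0 by rewrite a_gt0 center_gt0.
by nra.
Qed.

(** A Dirichlet argument: the orbit point closest to [center] exists by finiteness, and it lies in
    the chamber since a reflection in a violated wall would bring it closer. *)
Lemma covering y : space X y -> exists g, [/\ Gam g, chamber V (g *m y) &
  forall h, Gam h -> chord X center (g *m y) <= chord X center (h *m y)].
Proof.
move=> hy; pose A := [set g | Gam g /\ chord X center (g *m y) <= chord X center y].
have A1 : A 1%:M by split; [exact: words1|rewrite mul1mx].
have [g [hg gy] gmin] := @finite_argmin R _ A (fun g => chord X center (g *m y))
  (orbit_finite_at _ hy) (ex_intro _ _ A1).
have gmin' h : Gam h -> chord X center (g *m y) <= chord X center (h *m y).
  move=> hh; case: (leP (chord X center (h *m y)) (chord X center y)) => hc.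
    exact: gmin.
  exact: ltW (le_lt_trans gy hc).
exists g; split=> // l; rewrite leNgt -a_lt0; apply/negP => neg.
have hgy := isometry_space (Gam_isometry hg) hy.
have := reflect_closer hgy neg; rewrite ltNge mulmxA gmin' //.
exact: words_refl.
Qed.

Lemma chamber_closest w g : space X w -> chamber V w -> Gam g ->
  chord X center w <= chord X center (g *m w).
Proof.
move=> hw cw hg; have [g0 [hg0 c0 min0]] := covering hw.
have [e _] := chamber_rigid CD hg0 cw c0; rewrite e in min0; exact: min0.
Qed.

(** Finitely many h matter: z is within t' of [center], and so is [h *m z], being the closest point
    of its orbit; hence [h *m center] stays bounded. Each of these h that takes y out of the closed
    chamber does so on a neighbourhood. *)
Lemma orbit_chamber_near y : space X y -> \forall z \near y, space X z ->
  forall h, Gam h -> chamber V (h *m z) -> chamber V (h *m y).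
Proof.
move=> hy; pose t := chord X center y + 1; pose t' := 2 * t + t ^+ 2 / 4.
pose F := [set h | Gam h /\ chord X center (h *m center) <= 2 * (2 * t') + (2 * t') ^+ 2 / 4].
have cy0 := chord_ge0 center_space hy.
have n1 : \forall z \near y, forall h, F h -> ~ chamber V (h *m y) -> ~ chamber V (h *m z).
  apply: near_finite; first exact: orbit_finite.
  move=> h hF.
  have [cy|ncy] := pselect (chamber V (h *m y)); first by apply: filterE => z; case.
  have [i hi] : exists i, (a i *m (h *m y)) 0 0 < 0.
    apply: contrapT => hn; apply: ncy => l; rewrite leNgt -a_lt0; apply/negP => neg.
    by apply: hn; exists l.
  have := near_row_gt0 (a := - (a i *m h)) (x := y); rewrite mulNmx mxE oppr_gt0 -mulmxA.
  move=> /(_ hi); apply: filterS => z; rewrite mulNmx mxE oppr_gt0 -mulmxA => neg _ cz.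
  by have := a_ge0 CD i cz; rewrite leNgt neg.
apply: filterS2 n1 (near_chord X y ltr01) => z nz yz hz h hh cz.
apply: contrapT => ncy; apply: (nz h) => //; split=> //.
have ih := Gam_isometry hh; have hhz := isometry_space ih hz.
have hhc := isometry_space ih center_space.
have z0 := chord_ge0 hy hz.
have z1 : chord X center z <= t'.
  have := chord_triangle center_space hy hz => /= h1; apply: le_trans h1 _.
  by rewrite /t' /t; nra.
have z2 : chord X center (h *m z) <= t'.
  have hi : Gam (invmx h) by exact: words_inv CD _ hh.
  by have := chamber_closest hhz cz hi; rewrite mulKmx ?(words_unit CD hh) // => /le_trans; apply.
have := chord_triangle center_space hhz hhc; rewrite (isometry_chord ih hz center_space).
rewrite (chord_sym _ z) /= => h1; apply: le_trans h1 _.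
have := chord_ge0 center_space hhz; have := chord_ge0 center_space hz; nra.
Qed.

Lemma Gam_properly_discontinuous : properly_discontinuous X Gam.
Proof.
move=> C CX Cc.
have [B hB] : exists B, forall z, C z -> chord X center z <= B.
  have : compact ((fun z => chord X center z) @` C).
    apply: continuous_compact => //; apply: continuous_subspaceT => z.
    exact: (@chord_cvg R X _ _ (nbhs_filter z) id z (@cvg_id _ (nbhs z)) center).
  move=> /compact_bounded[M [_ hM]]; exists (M + 1) => z Cz.
  have := hM (M + 1); rewrite ltrDl ltr01 => /(_ isT (chord X center z)) /= h.
  by apply: le_trans (ler_norm _) (h _); exists z.
apply: sub_finite_set (orbit_finite (2 * (2 * B) + (2 * B) ^+ 2 / 4)).
move=> g [hg [_ [[z Cz <-] Cgz]]]; split=> //; have ig := Gam_isometry hg.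
have hz := CX _ Cz; have hgz := CX _ Cgz.
have := chord_triangle center_space hgz (isometry_space ig center_space).
rewrite (isometry_chord ig hz center_space) (chord_sym _ z) /= => h; apply: le_trans h _.
have := hB _ Cz; have := hB _ Cgz.
have := chord_ge0 center_space hz; have := chord_ge0 center_space hgz; nra.
Qed.

(** * The apex group and the solid *)

Definition link : pred 'I_4 := fun i => i != 0.

Lemma apex_coord i : (invmx V *m apex V) i 0 = (i == 0)%:R.
Proof. by rewrite /apex colE mulKmx // mxE andbT. Qed.

Lemma apex_chamber : chamber V (apex V).
Proof. by move=> l; rewrite apex_coord ler0n. Qed.

Lemma apex_groupE : T = words_in J a link.
Proof.
apply/seteqP; split=> g.
  move=> [hg gv]; rewrite coxeter_groupE in hg.
  have [|_] := chamber_rigid CD hg apex_chamber; first by rewrite gv; exact: apex_chamber.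
  apply: words_in_sub => i /eqP/a_zero; rewrite apex_coord => /eqP.
  by rewrite pnatr_eq0 eqb0.
move=> hg; split; first by rewrite coxeter_groupE; exact: words_in_words hg.
apply: words_in_fix hg _ => i i0; apply/a_zero.
by rewrite apex_coord (negbTE i0).
Qed.

Lemma T_Gam g : T g -> Gam g.
Proof. by rewrite apex_groupE; exact: words_in_words. Qed.

Lemma T_isometry g : T g -> isometry X g.
Proof. by move=> /T_Gam/Gam_isometry. Qed.

Lemma T_unit g : T g -> g \in unitmx.
Proof. by move=> /T_Gam; exact: (words_unit CD). Qed.

Lemma T1 : T 1%:M. Proof. by rewrite apex_groupE; exact: words_in1. Qed.

Lemma T_mul g h : T g -> T h -> T (g *m h).
Proof. by rewrite apex_groupE; exact: words_in_mul. Qed.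

Lemma T_inv g : T g -> T (invmx g).
Proof. by rewrite apex_groupE; exact: (words_in_inv CD). Qed.

Lemma T_refl i : i != 0 -> T (s i).
Proof. by move=> i0; rewrite apex_groupE; exists [:: i]; rewrite /= ?mulmx1 // /link i0. Qed.

Lemma solidP z : Sigma z <-> space X z /\ exists2 g, T g & chamber V (g *m z).
Proof.
split=> [[g Tg [w /simplexE[hw cw] <-]]|[hz [g Tg cz]]].
  split; first exact: isometry_space (T_isometry Tg) hw.
  by exists (invmx g); [exact: T_inv|rewrite mulKmx // T_unit].
exists (invmx g); first exact: T_inv.
exists (g *m z); last by rewrite mulKmx // T_unit.
by apply/simplexE; split=> //; exact: isometry_space (T_isometry Tg) hz.
Qed.

Lemma solid_space z : Sigma z -> space X z. Proof. by move/solidP => []. Qed.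

Lemma solid_chamber z : space X z -> chamber V z -> Sigma z.
Proof. by move=> hz cz; apply/solidP; split=> //; exists 1%:M; rewrite ?mul1mx //; exact: T1. Qed.

Lemma solid_T g z : T g -> Sigma z -> Sigma (g *m z).
Proof.
move=> Tg /solidP[hz [h Th cz]]; apply/solidP; split; first exact: isometry_space (T_isometry Tg) hz.
exists (h *m invmx g); first by apply: T_mul => //; exact: T_inv.
by rewrite mulmxA mulmxKV // T_unit.
Qed.

Lemma translateP g (A : set 'cV[R]_4) z : g \in unitmx -> translate g A z <-> A (invmx g *m z).
Proof.
move=> gU; split=> [[w Aw <-]|h]; first by rewrite mulKmx.
by exists (invmx g *m z); rewrite ?mulKVmx.
Qed.

Lemma translate_solid g : T g -> translate g Sigma = Sigma.
Proof.
move=> Tg; apply/seteqP; split=> z.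
  by move=> [w hw <-]; exact: solid_T.
by move=> hz; apply/translateP; [exact: T_unit|apply: solid_T => //; exact: T_inv].
Qed.

Lemma angleE i j : i != j -> rdot (a i) (a j) = - cos (pi / (label i j)%:R).
Proof. exact: (cox_angle CD). Qed.

Lemma angle_le0 i j : i != j -> rdot (a i) (a j) <= 0.
Proof.
move=> ij; rewrite angleE // oppr_le0; have m2 := cox_ge2 CD ij.
have m0 : 0 < (label i j)%:R :> R by rewrite ltr0n; lia.
apply: cos_ge0_pihalf; apply/andP; split.
  apply: (@le_trans _ _ 0); first by rewrite oppr_le0 divr_ge0 ?pi_ge0.
  by rewrite divr_ge0 ?pi_ge0 // ltW.
by rewrite ler_pM2l ?pi_gt0 // lef_pV2 ?posrE // ler_nat.
Qed.

Lemma right_angle i j : i != j -> label i j = 2%N -> rdot (a i) (a j) = 0.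
Proof. by move=> ij e; rewrite angleE // e cos_pihalf oppr0. Qed.

Lemma cos_label n : (3 <= n)%N -> 0 < cos (pi / n%:R : R) < 1.
Proof.
move=> n3; have n0 : 0 < n%:R :> R by rewrite ltr0n; lia.
have p0 := pi_gt0 R.
have h : 0 < (pi : R) / n%:R < pi / 2.
  by rewrite divr_gt0 //= ltr_pM2l // ltf_pV2 ?posrE // ltr_nat.
apply/andP; split.
  by apply: cos_gt0_pihalf; case/andP: h => h1 ->; rewrite andbT; lra.
case/andP: h => h1 h2.
have m0 : (0 : R) \in `[0, pi] by rewrite in_itv /= lexx ltW.
have m1 : (pi : R) / n%:R \in `[0, pi] by rewrite in_itv /=; apply/andP; split; lra.
by rewrite -[X in _ < X]cos0 ltr_cos.
Qed.

Lemma a_refl_orth i j x : i != j -> label i j = 2%N ->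
  (a i *m (s j *m x)) 0 0 = (a i *m x) 0 0.
Proof. by move=> ij e; rewrite mulmxA (row_refl J) right_angle // mulr0 scale0r subr0. Qed.

Lemma a_refl_self i x : (a i *m (s i *m x)) 0 0 = - (a i *m x) 0 0.
Proof. by rewrite mulmxA (self_refl CD) mulNmx mxE. Qed.

Lemma refl_comm i j : i != j -> label i j = 2%N -> s i *m s j = s j *m s i.
Proof. by move=> ij e; have := braid CD ij; rewrite e /= !mulmx1 => ->. Qed.

(** By [dominant], such a form can only grow when moved by the apex group, so its sign on the
    simplex is its sign on the solid. This is the source of the supporting planes. *)
Lemma solid_form b z : (forall i, i != 0 -> rdot b (a i) <= 0) -> pos V b -> Sigma z ->
  0 <= (b *m z) 0 0.
Proof.
move=> hb pb /solidP[hz [g Tg cz]].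
have Ti := T_inv Tg; rewrite apex_groupE in Ti.
have := pos_eval CD (dominant CD hb Ti) cz; have := pos_eval CD pb cz.
rewrite mulmxBl -mulmxA mulKmx ?T_unit // [X in _ -> 0 <= X -> _]mxE [X in _ + X]mxE.
lra.
Qed.

Lemma solid_a0 z : Sigma z -> 0 <= (a 0 *m z) 0 0.
Proof.
by apply: solid_form; [move=> i i0; apply: angle_le0; rewrite eq_sym|exact: (pos_a CD)].
Qed.

(** * Independent points on a face *)

Section Frames.
Variables (d : nat) (f : 'I_d -> 'I_4).
Hypothesis finj : injective f.
Hypothesis d1 : (1 < d)%N.

(* The vertices [f j] may be ideal, so they are moved towards their sum. *)
Definition frame_coord (j : 'I_d) : 'cV[R]_4 :=
  \col_l (\sum_k (l == f k)%:R + (l == f j)%:R).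

Lemma frame_coord_ge0 (j : 'I_d) l : 0 <= frame_coord j l 0.
Proof. by rewrite mxE addr_ge0 ?ler0n // sumr_ge0. Qed.

Lemma frame_coordE (j : 'I_d) (k : 'I_d) : frame_coord j (f k) 0 = 1 + (j == k)%:R.
Proof.
rewrite mxE (bigD1 k) //= eqxx big1 ?addr0; last first.
  by move=> l lk; rewrite (inj_eq finj) eq_sym (negbTE lk).
by rewrite (inj_eq finj) eq_sym.
Qed.

Lemma frame_coord0 (j : 'I_d) l : (forall k : 'I_d, l != f k) -> frame_coord j l 0 = 0.
Proof.
by move=> h; rewrite mxE big1 ?add0r ?(negbTE (h j)) // => k _; rewrite (negbTE (h k)).
Qed.

Lemma frame_cone (j : 'I_d) : cone X (V *m frame_coord j).
Proof.
have [k kj] : exists k : 'I_d, k != j.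
  by case: j => [[|n] hn]; [exists (Ordinal d1)|exists (Ordinal (ltnW d1))].
apply: (@cone_comb _ (f j) (f k)); first exact: frame_coord_ge0.
- by rewrite frame_coordE ltr_pwDl ?ltr01 ?ler0n.
- by rewrite frame_coordE ltr_pwDl ?ltr01 ?ler0n.
- by rewrite (inj_eq finj) eq_sym.
Qed.

Definition frame_pt (j : 'I_d) : 'cV[R]_4 := rho X (V *m frame_coord j).
Definition frame_mx : 'M[R]_(4, d) := \matrix_(i, j) frame_pt j i 0.

Lemma col_frame (j : 'I_d) : col j frame_mx = frame_pt j.
Proof. by apply/colP => i; rewrite !mxE. Qed.

Lemma frame_pt_space (j : 'I_d) : space X (frame_pt j). Proof. exact/rho_space/frame_cone. Qed.

Definition frame_scale (j : 'I_d) : R := (Num.sqrt (bf X (V *m frame_coord j) (V *m frame_coord j)))^-1.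

Lemma frame_scale_gt0 (j : 'I_d) : 0 < frame_scale j.
Proof. by have [h _] := frame_cone j; rewrite invr_gt0 sqrtr_gt0. Qed.

Lemma frame_pt_coord (j : 'I_d) l : (invmx V *m frame_pt j) l 0 = frame_scale j * frame_coord j l 0.
Proof. by rewrite /frame_pt /rho -/(frame_scale j) -scalemxAr mulKmx // mxE. Qed.

Lemma frame_chamber (j : 'I_d) : chamber V (frame_pt j).
Proof. by move=> l; rewrite frame_pt_coord mulr_ge0 ?frame_coord_ge0 // ltW // frame_scale_gt0. Qed.

Lemma frame_solid (j : 'I_d) : Sigma (frame_pt j).
Proof. by apply: solid_chamber; [exact: frame_pt_space|exact: frame_chamber]. Qed.

Lemma frame_pt_a0 (j : 'I_d) l : (forall k : 'I_d, l != f k) -> (a l *m frame_pt j) 0 0 = 0.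
Proof. by move=> h; apply/a_zero; rewrite frame_pt_coord frame_coord0 // mulr0. Qed.

Lemma frame_mul_coord (t : 'cV[R]_d) l : (invmx V *m (frame_mx *m t)) l 0 =
  \sum_j frame_scale j * t j 0 * frame_coord j l 0.
Proof.
have -> : frame_mx *m t = \sum_j t j 0 *: frame_pt j.
  by apply/colP => i; rewrite mxE summxE; apply: eq_bigr => j _; rewrite !mxE mulrC.
rewrite mulmx_sumr summxE; apply: eq_bigr => j _.
by rewrite -scalemxAr mxE frame_pt_coord mulrCA mulrA.
Qed.

Lemma frame_mul_coordE (t : 'cV[R]_d) (k : 'I_d) : (invmx V *m (frame_mx *m t)) (f k) 0 =
  \sum_j frame_scale j * t j 0 + frame_scale k * t k 0.
Proof.
rewrite frame_mul_coord (eq_bigr (fun j : 'I_d => frame_scale j * t j 0 +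
    frame_scale j * t j 0 * (j == k)%:R)); last first.
  by move=> j _; rewrite frame_coordE mulrDr mulr1.
rewrite big_split /=; congr (_ + _); rewrite (bigD1 k) //= eqxx mulr1 big1 ?addr0 //.
by move=> j /negbTE->; rewrite mulr0.
Qed.

Lemma frame_rank : \rank frame_mx = d.
Proof.
apply: rank_inj => t ht.
have e (k : 'I_d) : \sum_j frame_scale j * t j 0 + frame_scale k * t k 0 = 0.
  by rewrite -frame_mul_coordE ht mulmx0 mxE.
(* Summing the d equations gives [(d + 1) S = 0]. *)
have S0 : \sum_j frame_scale j * t j 0 = 0.
  have : \sum_k (\sum_j frame_scale j * t j 0 + frame_scale k * t k 0) = 0.
    by apply: big1 => k _.
  rewrite big_split /= sumr_const card_ord -[X in _ + X]mulr1n -mulrnDr => /eqP.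
  by rewrite -mulr_natr mulf_eq0 pnatr_eq0 addn1 orbF => /eqP.
apply/colP => k; have := e k; rewrite S0 add0r mxE => /eqP.
by rewrite mulf_eq0 gt_eqF ?frame_scale_gt0 // => /eqP.
Qed.

Lemma frame_span x : (forall l, (forall k : 'I_d, l != f k) -> (invmx V *m x) l 0 = 0) ->
  exists t : 'cV[R]_d, x = frame_mx *m t.
Proof.
move=> hx; pose c (k : 'I_d) := (invmx V *m x) (f k) 0.
(* The scaled coefficients t_k must satisfy [S + t_k = c k] with S their sum; summing gives
   [S = m]. *)
pose m := (\sum_k c k) / d.+1%:R.
exists (\col_k ((c k - m) / frame_scale k)).
have fs (k : 'I_d) : frame_scale k * ((c k - m) / frame_scale k) = c k - m.
  by rewrite mulrCA mulfV ?mulr1 // gt_eqF // frame_scale_gt0.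
rewrite -[LHS](mulKVmx VU) -[RHS](mulKVmx VU); congr (V *m _).
apply/colP => l.
case: (pickP (fun k : 'I_d => l == f k)) => [k /eqP->|nl]; last first.
  rewrite hx; last by move=> k; rewrite nl.
  rewrite frame_mul_coord big1 // => j _; rewrite frame_coord0 ?mulr0 // => k.
  by rewrite nl.
rewrite frame_mul_coordE [(\col__ _) k 0]mxE fs (eq_bigr (fun j : 'I_d => c j - m)); last first.
  by move=> j _; rewrite mxE fs.
rewrite sumrB sumr_const card_ord -/(c k).
have : \sum_k c k = m + m *+ d.
  by rewrite -mulrS -mulr_natr /m divfK // pnatr_eq0.
by move=> ->; rewrite addrK addrC subrK.
Qed.

Lemma frame_spans (S : set 'cV[R]_4) : (forall j : 'I_d, S (frame_pt j)) ->
  (forall x, S x -> forall l, (forall k : 'I_d, l != f k) -> (a l *m x) 0 0 = 0) -> spans_dim d S.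
Proof.
move=> h1 h2; exists frame_mx; split.
- exact: frame_rank.
- by move=> j; rewrite col_frame.
- by move=> x Sx; apply: frame_span => l hl; apply/a_zero; exact: h2.
Qed.

Lemma frame_dim_le n (S : set 'cV[R]_4) : spans_dim n S -> (forall j : 'I_d, S (frame_pt j)) -> (d <= n)%N.
Proof.
by move=> hS h; rewrite -frame_rank; apply: (spans_dim_rank hS) => j; rewrite col_frame.
Qed.

End Frames.

(** * Facets, edges and vertices of the solid *)

Lemma poly_face_translate n g (A S : set 'cV[R]_4) : g \in unitmx -> translate g A = A ->
  poly_face n A S -> poly_face n A (translate g S).
Proof.
move=> gU gA [u [u0 -> [B [rB cB sB]]]]; exists (u *m invmx g).
have Ai z : A z -> A (invmx g *m z) by rewrite -{1}gA => /translateP-/(_ gU).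
split.
- by move=> z Az; rewrite -mulmxA; apply: u0; exact: Ai.
- apply/seteqP; split=> z.
    move=> /translateP-/(_ gU)[/= Az uz]; rewrite -mulmxA; split=> //.
    by rewrite -gA; apply/translateP.
  by move=> [Az uz]; apply/translateP => //; split; [exact: Ai|rewrite mulmxA].
- exists (g *m B); split.
  + by rewrite -[RHS]rB -mxrank_tr trmx_mul mxrankMfree ?mxrank_tr // row_free_unit unitmx_tr.
  + by move=> j; exists (col j B) => //; rewrite !colE mulmxA.
  + move=> z [w Sw <-]; have [t ->] := sB w Sw; exists t; by rewrite mulmxA.
Qed.

Lemma in_edge_translate g x : T g -> in_edge_interior Sigma x -> in_edge_interior Sigma (g *m x).
Proof.
move=> Tg [[E [fE Ex]] nv]; have gU := T_unit Tg; split.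
  exists (translate g E); split; last by exists x.
  by apply: poly_face_translate => //; exact: translate_solid.
move=> W fW Wgx; apply: (nv (translate (invmx g) W)).
  apply: poly_face_translate => //; first by rewrite unitmx_inv.
  by apply: translate_solid; exact: T_inv.
by exists (g *m x); rewrite ?mulKmx.
Qed.

Definition facet : set 'cV[R]_4 := [set z | Sigma z /\ (a 0 *m z) 0 0 = 0].

Lemma facet_face : poly_face 2 Sigma facet.
Proof.
exists (a 0); split; [exact: solid_a0|by []|].
apply: (@frame_spans 3 (lift ord0)) => //; first exact: lift_inj.
  move=> j; split; first by apply: frame_solid => //; exact: lift_inj.
  by apply: frame_pt_a0 => //; exact: lift_inj.
move=> x [_ h] l hl; have -> : l = 0; last exact: h.
by case: (unliftP ord0 l) => // k e; have := hl k; rewrite e eqxx.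
Qed.

Lemma facet_refl : Sigma `&` translate (s 0) Sigma = facet.
Proof.
apply/seteqP; split=> z.
  move=> [Sz [w Sw e]]; split=> //; apply/eqP; rewrite eq_le (solid_a0 Sz) andbT.
  by rewrite -e a_refl_self oppr_le0 solid_a0.
by move=> [Sz h]; split=> //; exists z => //; exact: refl_fix.
Qed.

Lemma solid_spans n : spans_dim n Sigma -> (4 <= n)%N.
Proof.
move=> h; by apply: (@frame_dim_le 4 id _ _ n Sigma h) => // j; exact: frame_solid.
Qed.

Definition edge_coord (j : 'I_2) : 'I_4 := lift ord0 (lift ord0 j).

Lemma edge_coord_inj : injective edge_coord.
Proof. by move=> i j /lift_inj/lift_inj. Qed.

Lemma edge_coordP l : (forall k : 'I_2, l != edge_coord k) -> l = 0 \/ l = o1.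
Proof.
case: (unliftP ord0 l) => [k ->|->]; last by left.
case: (unliftP ord0 k) => [m ->|-> _]; last by right; exact: val_inj.
by move=> /(_ m); rewrite eqxx.
Qed.

Lemma edge_coordN (k : 'I_2) : (0 != edge_coord k) && (o1 != edge_coord k).
Proof. by []. Qed.

Definition edge : set 'cV[R]_4 :=
  [set z | [/\ Sigma z, (a 0 *m z) 0 0 = 0 & (a o1 *m z) 0 0 = 0]].

Lemma edge_frame (j : 'I_2) : edge (frame_pt edge_coord j).
Proof.
have ei := edge_coord_inj.
split; [exact: frame_solid| |]; apply: frame_pt_a0 => // k;
  by have /andP[] := edge_coordN k.
Qed.

(** The supporting form is [a 0 + a 0 *m s o1], the sum of the forms of the two facets meeting along
    the edge. As [C > 0], it vanishes on the solid only where both walls do. *)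
Lemma edge_face : poly_face 1 Sigma edge.
Proof.
pose C := cos (pi / (label 0 o1)%:R) : R.
have /andP[C0 _] : 0 < C < 1 by exact: cos_label.
have e01 : rdot (a 0) (a o1) = - C by rewrite angleE.
have e0 z : (a 0 *m (s o1 *m z)) 0 0 = (a 0 *m z) 0 0 + 2 * C * (a o1 *m z) 0 0.
  by rewrite mulmxA (row_refl J) e01 mulrN scaleNr opprK -[a 0]scale1r row_lin scale1r mul1r.
have H z : Sigma z -> 0 <= (a 0 *m z) 0 0 /\ 0 <= (a 0 *m z) 0 0 + 2 * C * (a o1 *m z) 0 0.
  by move=> Sz; split; [exact: solid_a0|rewrite -e0; apply: solid_a0; apply: solid_T => //; exact: T_refl].
exists (2 *: a 0 + (2 * C) *: a o1); split.
- by move=> z /H[h1 h2]; rewrite row_lin; lra.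
- apply/seteqP; split=> z.
    by move=> [Sz h0 h1]; split=> //; rewrite row_lin h0 h1 !mulr0 addr0.
  move=> [Sz]; rewrite row_lin => h; have [h1 h2] := H z Sz.
  have z0 : (a 0 *m z) 0 0 = 0 by lra.
  split=> //; apply: (mulfI (lt0r_neq0 C0)); rewrite mulr0; lra.
- apply: (frame_spans edge_coord_inj) => //; first exact: edge_frame.
  by move=> x [_ h0 h1] l /edge_coordP[]->.
Qed.

Lemma edge_dim_le n S : spans_dim n S -> (forall j : 'I_2, S (frame_pt edge_coord j)) -> (2 <= n)%N.
Proof. by move=> h; apply: (frame_dim_le edge_coord_inj). Qed.

Lemma coord_row_eq0 (u : 'rV[R]_4) : (forall l, (u *m col l V) 0 0 = 0) -> u = 0.
Proof.
move=> h; rewrite -(mulmxK VU u) (_ : u *m V = 0) ?mul0mx //.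
by apply/rowP => l; have := h l; rewrite colE mulmxA -colE !mxE.
Qed.

Lemma near_line_ge0 y (d : 'cV[R]_4) (u : 'rV[R]_4) b (P : set 'cV[R]_4) : space X y ->
  (\forall z \near y, space X z -> 0 <= (b *m z) 0 0 -> P z) ->
  (forall z, P z -> 0 <= (u *m z) 0 0) ->
  (u *m y) 0 0 = 0 -> (b *m y) 0 0 = 0 -> (b *m d) 0 0 = 0 ->
  exists2 e : R, 0 < e & forall c, `|c| < e -> 0 <= c * (u *m d) 0 0.
Proof.
move=> hy hP hu uy byy bd; have [e e0 he] := near_line d hy hP.
exists e => // c hc; have [cc Pc] := he c hc; have [k k0 ek] := rho_scale cc.
have bz : 0 <= (b *m rho X (y + c *: d)) 0 0.
  rewrite ek -scalemxAr mulmxDr -scalemxAr [X in 0 <= X]mxE [X in _ * X]mxE byy add0r.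
  by rewrite [X in _ * X]mxE bd mulr0 mulr0.
have := hu _ (Pc (rho_space cc) bz); rewrite ek -scalemxAr mulmxDr -scalemxAr.
rewrite [X in 0 <= X -> _]mxE [X in _ * X]mxE uy add0r [X in _ * X]mxE.
by rewrite (pmulr_rge0 _ k0).
Qed.

(** A supporting form vanishing at y must vanish on the whole linear span of the edge, too large for
    a vertex. If y is also on wall [o3] it is the midpoint of the edge, whose other half lies in the
    reflected simplex. *)
Lemma in_edge_interior_edge y : space X y -> chamber V y ->
  (a 0 *m y) 0 0 = 0 -> (a o1 *m y) 0 0 = 0 -> (a o2 *m y) 0 0 != 0 ->
  in_edge_interior Sigma y.
Proof.
move=> hy cy y0 y1 y2; split.
  by exists edge; split; [exact: edge_face|split=> //; exact: solid_chamber].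
move=> W [u [u0 -> h]] [Sy uy].
have t2 : 0 < (invmx V *m y) o2 0.
  by rewrite lt_neqAle cy andbT eq_sym; apply: contra_neq y2 => e; apply/a_zero.
have cl z : z = V *m (invmx V *m z) by rewrite mulKVmx.
have crd c l z (k : 'I_4) : (invmx V *m (z + c *: col l V)) k 0 = (invmx V *m z) k 0 + c * (k == l)%:R.
  by rewrite mulmxDr -scalemxAr colE mulKmx // !mxE andbT.
have line l : exists2 e : R, 0 < e & forall c, `|c| < e ->
   cone X (y + c *: col l V) by have [e e0 he] := near_line (col l V) hy filterT; exists e => // c /he[].
have ray g l c : T g -> cone X (y + c *: col l V) -> (forall k : 'I_4, 0 <= (invmx V *m y) k 0 + c * (k == l)%:R) ->
    0 <= (u *m (g *m (y + c *: col l V))) 0 0.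
  move=> Tg cc hk; have [k k0 ek] := rho_scale cc.
  have Sz : Sigma (rho X (y + c *: col l V)).
    apply: solid_chamber; first exact: rho_space.
    by move=> i; rewrite ek -scalemxAr mxE crd mulr_ge0 // ltW.
  have := u0 _ (solid_T Tg Sz); rewrite ek -!scalemxAr [X in 0 <= X -> _]mxE.
  by rewrite pmulr_rge0.
have uE c l : (u *m (y + c *: col l V)) 0 0 = c * (u *m col l V) 0 0.
  by rewrite mulmxDr -scalemxAr [LHS]mxE uy add0r mxE.
(* [u] is nonnegative at [y + c V_2] for [c] of either sign, and in the
   directions [V_3] and [s o3 *m V_3 = k2 V_2 - V_3]. *)
have uV2 : (u *m col o2 V) 0 0 = 0.
  have [e e0 he] := line o2; pose c := Num.min (e / 2) ((invmx V *m y) o2 0).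
  have c0 : 0 < c by rewrite lt_min divr_gt0.
  have ce : c < e by apply: (@le_lt_trans _ _ (e / 2)); [rewrite ge_min lexx|lra].
  have ct : c <= (invmx V *m y) o2 0 by rewrite ge_min lexx orbT.
  have H c' : `|c'| <= c -> 0 <= c' * (u *m col o2 V) 0 0.
    move=> c'c; rewrite -uE -[X in u *m X]mul1mx; apply: ray; first exact: T1.
      by apply: he; apply: le_lt_trans c'c ce.
    move=> k; have := cy k; case: eqP => [->|_]; last by rewrite mulr0 addr0.
    move: c'c; rewrite ler_norml mulr1 => /andP[h1 h2] _; lra.
  have := H c; have := H (- c); rewrite normrN gtr0_norm // lexx => /(_ isT) h1 /(_ isT) h2.
  by nra.
have uV3 : (u *m col o3 V) 0 0 = 0.
  have [y3|y3] := eqVneq ((invmx V *m y) o3 0) 0; last first.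
    have := uy; rewrite [y in u *m y]cl //.
    have -> : invmx V *m y = (invmx V *m y) o2 0 *: delta_mx o2 0 + (invmx V *m y) o3 0 *: delta_mx o3 0.
      move/a_zero: y0 => y0; move/a_zero: y1 => y1.
      by apply: eq_vec4; rewrite ?y0 ?y1 !mxE /= ?mulr0 ?mulr1 ?addr0 ?add0r.
    rewrite mulmxDr -!scalemxAr -!colE mulmxDr -!scalemxAr [X in X = _ -> _]mxE [X in X + _]mxE uV2 mulr0 add0r.
    by rewrite mxE => /eqP; rewrite mulf_eq0 (negbTE y3) => /eqP.
  have [e e0 he] := line o3.
  have c0 : 0 < e / 2 by rewrite divr_gt0.
  have cc : cone X (y + (e / 2) *: col o3 V) by apply: he; rewrite gtr0_norm //; lra.
  have hk (k : 'I_4) : 0 <= (invmx V *m y) k 0 + e / 2 * (k == o3)%:R.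
    by rewrite addr_ge0 // mulr_ge0 ?ler0n // ltW.
  have h1 := ray _ _ _ T1 cc hk; rewrite mul1mx uE pmulr_rge0 // in h1.
  have T3 : T (s o3) by exact: T_refl.
  have h2 := ray _ _ _ T3 cc hk.
  have s3y : s o3 *m y = y by apply: refl_fix; apply/a_zero.
  pose k2 := (invmx V *m (s o3 *m col o3 V)) o2 0.
  have s3V : s o3 *m col o3 V = k2 *: col o2 V - col o3 V.
    rewrite [LHS]cl // -[RHS](mulKVmx VU); congr (V *m _).
    have c3 l : (invmx V *m col o3 V) l 0 = (l == o3)%:R by rewrite colE mulKmx // mxE andbT.
    have z0 : (invmx V *m (s o3 *m col o3 V)) 0 0 = 0.
      by apply/a_zero; rewrite a_refl_orth //; apply/a_zero; rewrite c3.
    have z1 : (invmx V *m (s o3 *m col o3 V)) o1 0 = 0.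
      by apply/a_zero; rewrite a_refl_orth //; apply/a_zero; rewrite c3.
    have z3 : (invmx V *m (s o3 *m col o3 V)) o3 0 = -1.
      have := a_refl_self o3 (col o3 V); rewrite !(a_eval CD) c3 eqxx -mulrN.
      by apply: mulfI; rewrite invr_eq0 gt_eqF // sqrt_nsq_gt0.
    have dl l : invmx V *m col l V = delta_mx l 0 by rewrite colE mulKmx.
    have k2E : (invmx V *m (s o3 *m col o3 V)) o2 0 = k2 by [].
    rewrite mulmxBr -scalemxAr !dl; clearbody k2.
    by apply: eq_vec4; rewrite ?z0 ?z1 ?z3 ?k2E !mxE /= ?mulr0 ?mulr1 ?subr0 ?sub0r ?oppr0.
  move: h2; rewrite mulmxDr -scalemxAr s3y s3V mulmxDr -scalemxAr mulmxBr -scalemxAr.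
  rewrite [X in 0 <= X -> _]mxE uy add0r [X in 0 <= X -> _]mxE [X in _ * X]mxE [X in _ * (X + _)]mxE uV2 mulr0 add0r.
  by rewrite pmulr_rge0 // mxE oppr_ge0 => h2; apply/eqP; rewrite eq_le h1 h2.
suff : (2 <= 1)%N by [].
apply: (edge_dim_le h) => j; have [Sj /a_zero j0 /a_zero j1] := edge_frame j.
split=> //; rewrite [frame_pt _ _]cl //.
have -> : invmx V *m frame_pt edge_coord j = (invmx V *m frame_pt edge_coord j) o2 0 *: delta_mx o2 0
    + (invmx V *m frame_pt edge_coord j) o3 0 *: delta_mx o3 0.
  by apply: eq_vec4; rewrite ?j0 ?j1 !mxE /= ?mulr0 ?mulr1 ?addr0 ?add0r.
move: (_ o2 0) (_ o3 0) => c2 c3.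
rewrite mulmxDr -!scalemxAr -!colE mulmxDr -!scalemxAr.
by rewrite [LHS]mxE [X in X + _]mxE [X in _ + X]mxE uV2 uV3 !mulr0 addr0.
Qed.

Lemma vertex_uniq y z : space X y -> chamber V y -> (a 0 *m y) 0 0 = 0 -> (a o1 *m y) 0 0 = 0 ->
  (a o2 *m y) 0 0 = 0 -> space X z -> chamber V z -> (a 0 *m z) 0 0 = 0 -> (a o1 *m z) 0 0 = 0 ->
  (a o2 *m z) 0 0 = 0 -> z = y.
Proof.
move=> hy cy /a_zero y0 /a_zero y1 /a_zero y2 hz cz /a_zero z0 /a_zero z1 /a_zero z2.
have y3 : 0 < (invmx V *m y) o3 0.
  rewrite lt_neqAle cy andbT eq_sym; apply: contra_neq (space_neq0 hy) => y3.
  rewrite -[y](mulKVmx VU) (_ : invmx V *m y = 0) ?mulmx0 //.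
  by apply: eq_vec4; rewrite ?y0 ?y1 ?y2 ?y3 !mxE.
have [c cE] : {c | c = (invmx V *m z) o3 0 / (invmx V *m y) o3 0} by eexists.
have zE : z = c *: y.
  rewrite -[z](mulKVmx VU) -[y in RHS](mulKVmx VU) scalemxAr; congr (V *m _).
  by apply: eq_vec4; rewrite [RHS]mxE ?y0 ?y1 ?y2 ?z0 ?z1 ?z2 ?mulr0 // cE divfK // gt_eqF.
have c0 : 0 <= c by rewrite cE divr_ge0 // ltW.
by rewrite zE (space_scale c0 hy) ?scale1r // -zE.
Qed.

(** A supporting form that vanishes at y and is nonnegative at [y + c d] for small c of both signs
    vanishes on d. With [b = 0] no half-space is imposed. *)
Lemma near_line_eq0 y (d : 'cV[R]_4) (u : 'rV[R]_4) b : space X y ->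
  (\forall z \near y, space X z -> 0 <= (b *m z) 0 0 -> Sigma z) ->
  (forall z, Sigma z -> 0 <= (u *m z) 0 0) ->
  (u *m y) 0 0 = 0 -> (b *m y) 0 0 = 0 -> (b *m d) 0 0 = 0 -> (u *m d) 0 0 = 0.
Proof.
move=> hy hP hu uy byy bd; have [e e0 he] := near_line_ge0 hy hP hu uy byy bd.
have := he (e / 2); have := he (- (e / 2)); rewrite normrN gtr0_norm ?divr_gt0 //.
have -> : e / 2 < e by lra.
rewrite mulNr => /(_ isT) h1 /(_ isT) h2.
have /eqP : e / 2 * (u *m d) 0 0 = 0 by lra.
by rewrite mulf_eq0 gt_eqF ?divr_gt0 // => /eqP.
Qed.

Lemma near_orbit y : space X y -> chamber V y -> \forall z \near y, space X z ->
  exists2 g, words_in J a (fun i => (a i *m y) 0 0 == 0) g & chamber V (g *m z).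
Proof.
move=> hy cy; apply: (@filterS _ _ (nbhs_filter y) _ _ _ (orbit_chamber_near hy)) => z hz sz.
have [g [Gg cg _]] := covering sz.
have cgy := hz sz g Gg cg.
by exists g => //; case: (chamber_rigid CD Gg cy cgy).
Qed.

Lemma near_solid y : space X y -> chamber V y -> (a 0 *m y) 0 0 != 0 ->
  \forall z \near y, space X z -> Sigma z.
Proof.
move=> hy cy y0; apply: (@filterS _ _ (nbhs_filter y) _ _ _ (near_orbit hy cy)) => z hz sz.
apply/solidP; split=> //; have [g gS cg] := hz sz; exists g => //.
by rewrite apex_groupE; apply: words_in_sub gS => i; apply: contraTneq => ->.
Qed.

Lemma label_orth i : i != 0 -> i != o1 -> (0 != i) && (label 0 i == 2%N).
Proof. by elim/ord4P: i. Qed.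

(** Node 0 is adjacent to [o1] only, so without that letter [s 0] commutes with the rest and can be
    moved to the front. *)
Lemma words_in_facet (S : pred 'I_4) g : words_in J a S g -> ~~ S o1 ->
  exists2 t, words_in J a (fun i => S i && (i != 0)) t & g = t \/ g = s 0 *m t.
Proof.
move=> [w wS <-] S1; elim: w wS => [|i w IH] /=.
  by exists 1%:M; [exact: words_in1|left].
move=> /andP[Si /IH[t tS e]].
have [i0|i0] := eqVneq i 0.
  by exists t => //; rewrite i0; case: e => ->; [right|left; rewrite (reflKl CD)].
have i1 : i != o1 by apply: contraTneq Si => ->.
exists (s i *m t); first by apply: words_in_refl => //; rewrite Si.
case: e => ->; [by left|right; rewrite !mulmxA; congr (_ *m _)].
by have /andP[h /eqP e] := label_orth i0 i1; rewrite (refl_comm h e).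
Qed.

Lemma near_facet y : space X y -> chamber V y -> (a o1 *m y) 0 0 != 0 ->
  \forall z \near y, space X z -> 0 <= (a 0 *m z) 0 0 -> Sigma z.
Proof.
move=> hy cy y1; apply: (@filterS _ _ (nbhs_filter y) _ _ _ (near_orbit hy cy)) => z hz sz z0.
apply/solidP; split=> //; have [g gS cg] := hz sz.
have [|t tS gE] := words_in_facet gS; first exact: y1.
have Tt : T t by rewrite apex_groupE; apply: words_in_sub tS => i /andP[].
exists t => //; case: gE cg => [->//|-> cg].
have a0t : (a 0 *m (t *m z)) 0 0 = (a 0 *m z) 0 0.
  rewrite mulmxA; congr ((_ *m _) 0 0); case: tS => w wS <-.
  apply: row_orth => i /(allP wS)/andP[Si i0].
  have i1 : i != o1 by apply: contraTneq Si => ->.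
  by have /andP[h /eqP e] := label_orth i0 i1; exact: right_angle.
rewrite -mulmxA in cg; have := a_ge0 CD 0 cg; rewrite a_refl_self a0t => z0'.
have t0 : (a 0 *m (t *m z)) 0 0 = 0 by rewrite a0t; lra.
by rewrite refl_fix in cg.
Qed.

Lemma vertex_face y : space X y -> chamber V y -> (a 0 *m y) 0 0 = 0 -> (a o1 *m y) 0 0 = 0 ->
  (a o2 *m y) 0 0 = 0 -> poly_face 0 Sigma [set y].
Proof.
move=> hy cy y0 y1 y2.
pose cp := cos (pi / p%:R) : R; pose cq := cos (pi / q%:R) : R; pose cr := cos (pi / r%:R) : R.
have /andP[cp0 cp1] : 0 < cp < 1 by exact: cos_label.
have /andP[cq0 cq1] : 0 < cq < 1 by exact: cos_label.
have /andP[cr0 cr1] : 0 < cr < 1 by exact: cos_label.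
have q0 : 0 < 1 - cq ^+ 2 by nra.
(* d1 and d2 solve the linear system making U orthogonal to [a o1] and [a o2], with determinant
   [1 - cq ^+ 2]. *)
have [d1 d1E] : {d1 | d1 = cp / (1 - cq ^+ 2)} by eexists.
have [d2 d2E] : {d2 | d2 = cq * d1} by eexists.
have d10 : 0 < d1 by rewrite d1E divr_gt0.
have d20 : 0 < d2 by rewrite d2E mulr_gt0.
have d1K : d1 * (1 - cq ^+ 2) = cp by rewrite d1E divfK // gt_eqF.
(* [U] is invariant under [s o1] and [s o2], and [rdot U (a o3) < 0]; so, on the
   solid, it vanishes at [y] only. *)
pose U := a 0 + (d1 *: a o1 + d2 *: a o2).
have rU i : rdot U (a i) = rdot (a 0) (a i) + (d1 * rdot (a o1) (a i) + d2 * rdot (a o2) (a i)).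
  by rewrite !rdotDl !rdotZl.
have U1 : rdot U (a o1) = 0.
  rewrite rU (cox_norm CD) !angleE // [label 0 o1]/= [label o2 o1]/= -/cp -/cq; nra.
have U2 : rdot U (a o2) = 0.
  rewrite rU (cox_norm CD) !angleE // [label 0 o2]/= [label o1 o2]/= cos_pihalf -/cq d2E; lra.
have U3 : rdot U (a o3) = - (d2 * cr).
  by rewrite rU !angleE // [label 0 o3]/= [label o1 o3]/= [label o2 o3]/= cos_pihalf -/cr; ring.
have Ule (i : 'I_4) : i != 0 -> rdot U (a i) <= 0.
  by elim/ord4P: i => // _; rewrite ?U1 ?U2 ?U3 // oppr_le0 mulr_ge0 // ltW.
have pU : pos V U.
  apply: posD; first exact: (pos_a CD).
  by apply: posD; apply: posZ; rewrite ?ltW //; exact: (pos_a CD).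
have Uv z : (U *m z) 0 0 = (a 0 *m z) 0 0 + (d1 * (a o1 *m z) 0 0 + d2 * (a o2 *m z) 0 0).
  by rewrite -row_lin mulmxDl mxE.
have Uy : (U *m y) 0 0 = 0 by rewrite Uv y0 y1 y2 !mulr0 !addr0.
clearbody U.
(* Along a shortest word U only increases at y, so a total of 0 makes every increment 0: each letter
   is [o1] or [o2], or is [o3] with y on its wall, and fixes y. *)
have fixy g : words_in J a link g -> (U *m (g *m y)) 0 0 = 0 -> g *m y = y.
  move: g; apply: (parabolic_ind CD (Q := fun g => (U *m (g *m y)) 0 0 = 0 -> g *m y = y)).
    by rewrite mul1mx.
  move=> i v li vS pv IH; have pvy := pos_eval CD pv cy.
  have dv := pos_eval CD (dominant CD Ule vS) cy.
  move: dv; rewrite mulmxBl [X in 0 <= X -> _]mxE [X in _ + X]mxE Uy subr0 => dv.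
  have Ui := Ule i li; rewrite -mulmxA in pvy.
  rewrite -mulmxA mulmxA (row_refl J) mulmxBl -scalemxAl [X in X = 0 -> _]mxE [X in _ + X]mxE.
  rewrite [X in - X]mxE => e.
  have h : 0 <= - (rdot U (a i) * (a i *m (v *m y)) 0 0) by rewrite -mulNr mulr_ge0 // oppr_ge0.
  have sum0 (A B C : R) : 0 <= A -> 0 <= - (B * C) -> A - 2 * B * C = 0 -> A = 0 by lra.
  rewrite -mulmxA in dv.
  have vy : v *m y = y by apply: IH; exact: sum0 dv h e.
  rewrite vy in e h *; apply: refl_fix; move: li e h; rewrite /link.
  clear pvy pv Ui; elim/ord4P: i => // _; rewrite U3 Uy => e h.
  have /eqP : (d2 * cr) * (a o3 *m y) 0 0 = 0 by lra.
  by rewrite mulf_eq0 gt_eqF ?mulr_gt0 // => /eqP.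
exists U; split.
- by move=> z Sz; exact: solid_form Ule pU Sz.
- apply/seteqP; split=> z.
    by move=> ->; split=> //; exact: solid_chamber.
  move=> [/solidP[hz [g Tg cz]] Uz].
  have Ti := T_inv Tg; rewrite apex_groupE in Ti.
  have dv := pos_eval CD (dominant CD Ule Ti) cz; have pv := pos_eval CD pU cz.
  move: dv; rewrite mulmxBl -mulmxA mulKmx ?T_unit // [X in 0 <= X -> _]mxE [X in _ + X]mxE Uz sub0r oppr_ge0 => dv.
  have : (U *m (g *m z)) 0 0 = 0 by apply/eqP; rewrite eq_le dv.
  rewrite Uv; have := a_ge0 CD 0 cz; have := a_ge0 CD o1 cz; have := a_ge0 CD o2 cz => w2 w1 w0 e.
  have m1 : 0 <= d1 * (a o1 *m (g *m z)) 0 0 by rewrite mulr_ge0 // ltW.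
  have m2 : 0 <= d2 * (a o2 *m (g *m z)) 0 0 by rewrite mulr_ge0 // ltW.
  have e0 : (a 0 *m (g *m z)) 0 0 = 0 by lra.
  have e1 : (a o1 *m (g *m z)) 0 0 = 0 by apply: (mulfI (lt0r_neq0 d10)); rewrite mulr0; lra.
  have e2 : (a o2 *m (g *m z)) 0 0 = 0 by apply: (mulfI (lt0r_neq0 d20)); rewrite mulr0; lra.
  have gzy : g *m z = y by apply: vertex_uniq => //; exact: isometry_space (T_isometry Tg) hz.
  have ez : z = invmx g *m y by rewrite -gzy mulKmx // T_unit.
  by rewrite ez; apply: fixy => //; rewrite -ez.
- exists y; split.
  + by rewrite -mxrank_tr rank_rV trmx_eq0 (space_neq0 hy).
  + by move=> j; apply/colP => i; rewrite mxE ord1.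
  + by move=> x ->; exists 1%:M; rewrite mulmx1.
Qed.

(** Off wall 0, y is interior to the solid, and off wall [o1] it is interior to the facet; a
    supporting form would then vanish on 4 or 3 dimensions instead of 2. On wall [o2] as well, y is
    a vertex. *)
Lemma in_edge_interiorP y : space X y -> chamber V y ->
  in_edge_interior Sigma y <-> [/\ (a 0 *m y) 0 0 = 0, (a o1 *m y) 0 0 = 0 & (a o2 *m y) 0 0 != 0].
Proof.
move=> hy cy; split; last by case; exact: in_edge_interior_edge.
move=> [[E [[u [u0 Ee hE]] Ey]] nv]; have uy : (u *m y) 0 0 = 0 by move: Ey; rewrite Ee => -[].
rewrite Ee in hE.
have y0 : (a 0 *m y) 0 0 = 0.
  apply/eqP/negPn/negP => y0.
  have u0E : u = 0.
    apply: coord_row_eq0 => l; apply: (near_line_eq0 (b := 0) hy _ u0 uy); rewrite ?mul0mx ?mxE //.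
    by apply: (@filterS _ _ (nbhs_filter y) _ _ _ (near_solid hy cy y0)) => z hz sz _; exact: hz.
  suff : (4 <= 2)%N by [].
  apply: solid_spans; congr (spans_dim 2 _): hE; apply/seteqP; split=> z; first by case.
  by move=> Sz; split=> //; rewrite u0E mul0mx mxE.
have y1 : (a o1 *m y) 0 0 = 0.
  apply/eqP/negPn/negP => y1.
  suff : (3 <= 2)%N by [].
  apply: (@frame_dim_le 3 (lift ord0) _ _ _ _ hE) => //; first exact: lift_inj.
  move=> j.
  have finj : injective (lift (ord0 : 'I_4)) by exact: lift_inj.
  have Sj : Sigma (frame_pt (lift ord0) j) by apply: frame_solid.
  split => //; apply: (near_line_eq0 (b := a 0) hy (near_facet hy cy y1) u0 uy y0).
  by apply: frame_pt_a0.
split=> //; apply/eqP => y2; exact: (nv _ (vertex_face hy cy y0 y1 y2)).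
Qed.

(** * Side pairings *)

Section SidePairing.
Variable K : set 'M[R]_4.
Hypotheses (Kgp : mx_group K) (KG : K `<=` Gam).

Let KU k : K k -> k \in unitmx. Proof. by case: Kgp => + _ _ _; apply. Qed.
Let K1 : K 1%:M. Proof. by case: Kgp. Qed.
Let KM k k' : K k -> K k' -> K (k *m k'). Proof. by case: Kgp => _ _ + _; apply. Qed.
Let KV k : K k -> K (invmx k). Proof. by case: Kgp => _ _ _; apply. Qed.

Let Gam_inv g : Gam g -> Gam (invmx g). Proof. exact: (words_inv CD). Qed.
Let Gam_unit g : Gam g -> g \in unitmx. Proof. exact: (words_unit CD). Qed.

(** The orbit of y is locally discrete: by [orbit_chamber_near], [g *m y] is in the chamber too,
    hence equals y. *)
Lemma near_orbit_fixed y : space X y -> chamber V y ->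
  \forall z \near y, space X z -> forall g, Gam g -> g *m z = y -> z = y.
Proof.
move=> hy cy; apply: (@filterS _ _ (nbhs_filter y) _ _ _ (orbit_chamber_near hy)) => z hz sz g Gg e.
have cgy : chamber V (g *m y) by apply: (hz sz g Gg); rewrite e.
have [gy _] := chamber_rigid CD Gg cy cgy.
by apply: (can_inj (mulKmx (Gam_unit Gg))); rewrite e gy.
Qed.

(** Walls have no interior: moving z towards the barycentre of a closed chamber containing it makes
    all coordinates positive. *)
Lemma near_interior_chamber z (P : set 'cV[R]_4) : space X z -> (\forall z' \near z, P z') ->
  exists z', [/\ space X z', P z' & exists2 g, Gam g & forall i, 0 < (invmx V *m (g *m z')) i 0].
Proof.
move=> hz hP; have [g [Gg cg _]] := covering hz.
have [e e0 he] := near_line (invmx g *m (V *m const_mx 1)) hz hP.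
have [cc Pc] := he (e / 2) ltac:(rewrite gtr0_norm ?divr_gt0 //; lra).
have [c c0 cE] := rho_scale cc.
eexists; split; [exact: rho_space cc|exact: Pc|exists g => // i].
rewrite cE -!scalemxAr mulmxDr -scalemxAr mulKVmx ?Gam_unit // mulmxDr -scalemxAr mulKmx; last exact: simplex_unit.
rewrite [X in 0 < X]mxE mulr_gt0 // [X in 0 < X]mxE ltr_wpDl ?cg // [X in 0 < X]mxE [const_mx _ _ _]mxE mulr1.
by rewrite divr_gt0.
Qed.

Lemma interior_rigid g x : Gam g -> (forall i, 0 < (invmx V *m x) i 0) -> chamber V (g *m x) -> g = 1%:M.
Proof.
move=> Gg x0 cg; have cx : chamber V x by move=> i; exact: ltW.
have [_ [w wx <-]] := chamber_rigid CD Gg cx cg; case: w wx => //= i w /andP[/eqP h _].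
have := x0 i; rewrite -a_gt0 h ltxx //.
Qed.

(** * Rotations about an edge *)

(** The rotation by [2 pi / p] about the edge; as [s o1] preserves the solid, it carries the solid
    to its neighbour across the facet. *)
Definition edge_rotation : 'M[R]_4 := s 0 *m s o1.
Local Notation rot := edge_rotation.

Lemma edge_rotation_word n : rot ^+ n = wprod J a (alt 0 o1 n.*2).
Proof. by elim: n => [|n IH] //; rewrite exprS IH doubleS /= mulmxA. Qed.

Lemma rev_alt i j n : rev (alt i j n) = if odd n then alt i j n else alt j i n.
Proof.
elim: n => // n IH; rewrite [in LHS]alt_rcons rev_cat IH /=.
by case: (odd n).
Qed.

Lemma edge_rotation_order : rot ^+ p = 1.
Proof.
have br := braid CD (i := 0) (j := o1) isT; rewrite [label _ _]/= in br.
rewrite edge_rotation_word -addnn alt_cat wprod_cat.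
have := wprod_rev CD (alt 0 o1 p); rewrite rev_alt.
by case: (odd p); rewrite ?br.
Qed.

Lemma sin_edge_neq0 (k : nat) : (0 < k)%N -> (k < p.*2)%N -> k != p -> sin (k%:R * (pi / p%:R)) != 0 :> R.
Proof.
move=> k0 k2 kp; have p0 : 0 < p%:R :> R by rewrite ltr0n; lia.
have pos n : (0 < n)%N -> (n < p)%N -> 0 < sin (n%:R * (pi / p%:R)) :> R.
  move=> n0 np; apply: sin_gt0_pi; rewrite mulr_gt0 ?ltr0n ?divr_gt0 ?pi_gt0 //=.
  by rewrite mulrCA gtr_pMr ?pi_gt0 // ltr_pdivrMr // mul1r ltr_nat.
have [h|h|e] := ltngtP k p; [by rewrite gt_eqF ?pos| |by rewrite e eqxx in kp].
have -> : k%:R * (pi / p%:R) = (k - p)%:R * (pi / p%:R) + pi :> R.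
  by rewrite -{1}(subnK (ltnW h)) natrD mulrDl; congr (_ + _); field; rewrite gt_eqF.
by rewrite sinDpi oppr_eq0 gt_eqF // pos //; lia.
Qed.

(** The apex group leaves coordinate 0 of every form unchanged. Applied to [a o1] this forces
    [2 n = p]; but then the rotation sends [a 0] to its opposite. *)
Lemma edge_rotation_notin n : (0 < n)%N -> (n < p)%N -> ~ T (rot ^+ n).
Proof.
move=> n0 np Tn; rewrite apex_groupE edge_rotation_word in Tn.
have lin (c1 c2 : R) (b b' : 'rV[R]_4) :
    ((c1 *: b + c2 *: b') *m V) 0 0 = c1 * (b *m V) 0 0 + c2 * (b' *m V) 0 0.
  by rewrite mulmxDl -!scalemxAl [LHS]mxE [X in X + _]mxE [X in _ + X]mxE.
have lab : label o1 0 = p /\ label 0 o1 = p by [].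
have c0 := cox_gt0 CD 0.
have := coef_words CD (a o1) Tn (l := 0) isT.
rewrite (row_alt CD) // odd_double lin !(aVE CD).
rewrite mulr0 mulr0 add0r mulr1 => /eqP; rewrite mulf_eq0 (gt_eqF c0) orbF /chi lab.1.
rewrite mulf_eq0 invr_eq0 => /orP[|]; last first.
  by rewrite gt_eqF // -lab.1; exact: (sin_th_gt0 CD).
have [n2p _|n2p] := eqVneq n.*2 p; last by rewrite (negbTE (sin_edge_neq0 _ _ n2p)) //; lia.
have := coef_words CD (a 0) Tn (l := 0) isT.
have -> : n.*2 = (n.*2.-1).+1 by lia.
rewrite [wprod _ _ _]/= mulmxA (self_refl CD) mulNmx (row_alt CD) // n2p.
have -> : odd p.-1 by rewrite -n2p; lia.
rewrite prednK; last by lia.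
have := chim CD (i := 0) (j := o1) isT; rewrite lab.2 => ->.
have := chimP CD (i := 0) (j := o1) isT; rewrite lab.2 => ->.
rewrite scale0r add0r scale1r mulNmx mxE !(aVE CD) mulr1; lra.
Qed.

(** Here [s 0 = rot *m s o1], [s o1] inverts [rot] and [s o3] commutes with it, so all powers of
    [rot] can be collected on the left. *)
Lemma edge_words (S : pred 'I_4) g : S o1 -> ~~ S o2 -> words_in J a S g ->
  exists n t, [/\ (n < p)%N, words_in J a (fun i => S i && (i != 0)) t & g = rot ^+ n *m t].
Proof.
move=> S1 S2 [w wS <-].
(* The exponent [p.-1 * n] stands for -n. *)
have s1E n : s o1 *m rot ^+ n = rot ^+ (p.-1 * n) *m s o1.
  have r1 : s o1 *m rot = rot ^+ p.-1 *m s o1.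
    have h : rot ^+ p.-1 *m rot = 1%:M by rewrite -[_ *m _]exprSr prednK ?edge_rotation_order //; lia.
    have h' : rot *m (s o1 *m s 0) = 1%:M by rewrite /rot !mulmxA -(mulmxA (s 0)) (reflK CD) mulmx1 (reflK CD).
    have -> : rot ^+ p.-1 = s o1 *m s 0 by rewrite -[LHS]mulmx1 -h' mulmxA h mul1mx.
    by rewrite /rot !mulmxA.
  elim: n => [|n IH]; first by rewrite muln0 !expr0 mulmx1 mul1mx.
  by rewrite exprS [_ *m (_ * _)]mulmxA r1 -mulmxA IH mulmxA -[rot ^+ _ *m rot ^+ _]exprD -mulnS.
suff [n [t [tS ->]]] : exists n t, words_in J a (fun i => S i && (i != 0)) t /\ wprod J a w = rot ^+ n *m t.
  exists (n %% p)%N, t; split=> //; first by rewrite ltn_mod; lia.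
  by rewrite expr_mod // edge_rotation_order.
elim: w wS => [|i w IH] /=.
  by exists 0%N, 1%:M; split; [exact: words_in1|rewrite mulmx1].
move=> /andP[Si /IH[n [t [tS ->]]]].
have s1t : words_in J a (fun i => S i && (i != 0)) (s o1 *m t) by apply: words_in_refl => //; rewrite S1.
have [i0|i0] := eqVneq i 0.
  exists (1 + p.-1 * n)%N, (s o1 *m t); split=> //.
  rewrite i0 exprD expr1 -[rot * _]/(rot *m _) -[rot *m _ *m _]mulmxA [rot ^+ (p.-1 * n) *m (s o1 *m t)]mulmxA -s1E.
  by rewrite /rot -!mulmxA (reflKl CD).
have [i1|i1] := eqVneq i o1.
  by exists (p.-1 * n)%N, (s o1 *m t); split=> //; rewrite i1 !mulmxA s1E.
have i2 : i != o2 by apply: contraTneq Si => ->.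
exists n, (s i *m t); split; first by apply: words_in_refl => //; rewrite Si.
have i3 : i = o3 by clear -i0 i1 i2; move: i0 i1 i2; elim/ord4P: i.
have c0 : s o3 *m rot = rot *m s o3.
  have e0 : s o3 *m s 0 = s 0 *m s o3 by exact: refl_comm.
  have e1 : s o3 *m s o1 = s o1 *m s o3 by exact: refl_comm.
  by rewrite /rot mulmxA e0 -mulmxA e1 mulmxA.
rewrite i3 !mulmxA; congr (_ *m _); exact: (commrX n (c0 : GRing.comm (s o3) rot)).
Qed.

Lemma edge_rotation_fix n y : (a 0 *m y) 0 0 = 0 -> (a o1 *m y) 0 0 = 0 -> rot ^+ n *m y = y.
Proof.
move=> y0 y1; elim: n => [|n IH]; first by rewrite expr0 mul1mx.
by rewrite exprS -[_ * _]/(_ *m _) -mulmxA IH /rot -mulmxA !refl_fix.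
Qed.

Lemma Gam_rotation n : Gam (rot ^+ n).
Proof. by rewrite edge_rotation_word; exists (alt 0 o1 n.*2). Qed.

Lemma solid_meet t (u : 'M[R]_4) : T t -> T u ->
  Sigma `&` translate (t *m s 0 *m u) Sigma = translate t (facet).
Proof.
move=> Tt Tu; rewrite -facet_refl //; apply/seteqP; split=> z.
  move=> [Sz [w Sw wz]]; apply/(translateP _ _ (T_unit Tt)); split.
    by apply: solid_T => //; exact: T_inv.
  exists (u *m w); first exact: solid_T.
  by rewrite -wz -!mulmxA mulKmx // T_unit.
move=> [w [Sw [w' Sw' we]] <-]; split; first exact: solid_T.
exists (invmx u *m w'); first by apply: solid_T => //; exact: T_inv.
by rewrite -mulmxA mulKVmx ?T_unit // -mulmxA we.
Qed.

(** * Transversals, side pairings and edge cycles *)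

(** A translate of the solid containing [g *m center] gives the decomposition of g. It is unique
    because the apex is interior to the solid, so an element of K fixing it makes interiors
    overlap. *)
Lemma fundamental_transversal : space X (apex V) -> fundamental_region X K Sigma -> transversal Gam K T.
Proof.
move=> hv [_ cov dis].
split=> [t /T_Gam//|g Gg].
have hc : space X (g *m center) by apply: (isometry_space (Gam_isometry Gg)); exact: center_space.
move: (hc); rewrite -cov => -[k Kk [w /solidP[hw [t Tt cw]] e]].
have ek : t *m invmx k *m g = 1%:M.
  apply: center_rigid.
    by apply: words_mul => //; apply: words_mul; [exact: T_Gam|apply: (words_inv CD); exact: KG].
  by rewrite -mulmxA -e -mulmxA mulKmx // KU.
have gE : g = k *m invmx t.
  apply: (can_inj (mulKmx (T_unit Tt))); rewrite -(mulKVmx (KU Kk) g).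
  have -> : t *m (k *m (invmx k *m g)) = t *m k *m invmx t *m (t *m invmx k *m g).
    by rewrite -!mulmxA mulKmx ?T_unit.
  by rewrite ek mulmx1 !mulmxA.
exists (invmx t); split; first by split; [exact: T_inv|exists k].
move=> t' [Tt' [k' Kk' e']].
have tU := T_unit Tt; have k'U := KU Kk'; have t'U := T_unit Tt'.
have kt : invmx k' *m k = t' *m t.
  apply: (can_inj (mulKmx k'U)); rewrite mulKVmx // mulmxA -e' gE -mulmxA mulVmx // mulmx1 //.
have Kk2 : K (invmx k' *m k) by apply: KM => //; exact: KV.
have T2 : T (invmx k' *m k) by rewrite kt; exact: T_mul.
have [e1|ne1] := pselect (invmx k' *m k = 1%:M).
  by apply: (can_inj (mulmxK tU)); rewrite mulVmx // -kt e1.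
suff : set0 (apex V) by [].
rewrite -(dis _ Kk2 ne1).
have ia : rel_interior X Sigma (apex V).
  split=> //; apply: near_solid => //; first exact: apex_chamber.
  by apply/eqP => /a_zero; rewrite apex_coord => /eqP; rewrite oner_eq0.
by split=> //; exists (apex V) => //; case: T2.
Qed.

(** It remains to exclude [g = 1], for which S would be the whole solid and span 4 dimensions
    instead of 3. *)
Lemma side_pairing_free : fixed_point_free X K -> forall S g, side_pairing K Sigma S g ->
  forall x, paired_face g S x -> g *m x <> x.
Proof.
move=> Kfree S g [fS Kg gS] x Sgx gx.
have [e|ne] := pselect (g = 1%:M).
  have ES : S = Sigma.
    rewrite -gS e; apply/seteqP; split=> z; first by case.
    by move=> Sz; split=> //; exists z; rewrite ?mul1mx.
  case: fS => u [_ _]; rewrite ES => /solid_spans; by [].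
apply: (Kfree g x Kg ne _ gx).
by move: Sgx; rewrite /paired_face /= gx -gS => -[/solid_space].
Qed.

Lemma pairing_class_orbit x z : pairing_class K Sigma x z -> Sigma z /\ exists2 k, K k & z = k *m x.
Proof.
move=> [Sz h]; split=> //; elim: h => {x z Sz}.
- by move=> x z [S [g [[_ Kg _] _ ->]]]; exists g.
- by move=> x; exists 1%:M; rewrite ?mul1mx.
- by move=> x z _ [k Kk ->]; exists (invmx k); [exact: KV|rewrite mulKmx // KU].
- by move=> x y z _ [k Kk ->] _ [k' Kk' ->]; exists (k' *m k); [exact: KM|rewrite mulmxA].
Qed.

Hypothesis tr : transversal Gam K T.

Lemma tr_dec g : Gam g -> exists k t, [/\ K k, T t & g = k *m t].
Proof. by move=> /tr.2[t [[Tt [k Kk e]] _]]; exists k, t. Qed.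

Lemma tr_uniq k k' t t' : K k -> K k' -> T t -> T t' -> k *m t = k' *m t' -> k = k' /\ t = t'.
Proof.
move=> Kk Kk' Tt Tt' e.
have [t0 [_ u]] := tr.2 _ (words_mul (KG Kk) (T_Gam Tt)).
have e1 : t0 = t by apply: u; split=> //; exists k.
have e2 : t0 = t' by apply: u; split=> //; exists k'.
have tt : t = t' by rewrite -e1 -e2.
by split=> //; move: e; rewrite -tt => /(can_inj (mulmxK (T_unit Tt))).
Qed.

Lemma tr_meet k : K k -> T k -> k = 1%:M.
Proof.
move=> Kk Tk; suff [] : 1%:M = k /\ k = 1%:M by [].
by apply: tr_uniq => //; [exact: T1|rewrite mul1mx mulmx1].
Qed.

(* [kf n] carries the solid to the copy [translate (t *m rot ^+ n) Sigma], the
   n-th one around the edge through [t *m y]; crossing the face between two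
   consecutive copies is a side pairing. *)
Lemma edge_cycle t y : T t -> space X y -> chamber V y ->
  (a 0 *m y) 0 0 = 0 -> (a o1 *m y) 0 0 = 0 -> (a o2 *m y) 0 0 != 0 ->
  exists kf : nat -> 'M[R]_4, [/\ kf 0%N = 1%:M, (forall n, K (kf n)),
    (forall n, Sigma (invmx (kf n) *m (t *m y))) /\
    (forall n, pairing_step K Sigma (invmx (kf n.+1) *m (t *m y)) (invmx (kf n) *m (t *m y))),
    (forall k, K k -> Sigma (k *m (t *m y)) -> exists2 n, (n < p)%N & k = invmx (kf n)) &
    (forall i j : nat, (i < j)%N -> (j < p)%N -> kf i <> kf j)].
Proof.
move=> Tt hy cy y0 y1 y2.
have dec n : exists kt : 'M[R]_4 * 'M[R]_4, [/\ K kt.1, T kt.2 & t *m rot ^+ n = kt.1 *m kt.2].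
  have [k [t' [h1 h2 h3]]] := tr_dec (words_mul (T_Gam Tt) (Gam_rotation n)).
  by exists (k, t').
have [F hF] := boolp.choice dec; pose kf n := (F n).1; pose tf n := (F n).2.
have Kf n : K (kf n) by case: (hF n).
have Tf n : T (tf n) by case: (hF n).
have ktf n : t *m rot ^+ n = kf n *m tf n by case: (hF n).
clearbody kf tf; clear F hF.
have ptE n : invmx (kf n) *m (t *m y) = tf n *m y.
  have <- : t *m rot ^+ n *m y = t *m y by rewrite -mulmxA edge_rotation_fix.
  by rewrite ktf -mulmxA mulKmx // KU.
have Sy : Sigma y by exact: solid_chamber.
exists kf; split.
- have e : kf 0%N *m tf 0%N = 1%:M *m t by rewrite -ktf expr0 mul1mx mulmx1.
  by have [] := tr_uniq (Kf 0%N) K1 (Tf 0%N) Tt e.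
- by [].
- split=> n; first by rewrite ptE; exact: solid_T.
  pose g := invmx (kf n) *m kf n.+1.
  have gE : g *m tf n.+1 = tf n *m (s 0 *m s o1).
    rewrite /g -mulmxA -ktf exprSr -[_ * rot]/(_ *m rot) mulmxA ktf.
    by rewrite !mulmxA mulVmx ?KU // mul1mx.
  have gE' : g = tf n *m s 0 *m (s o1 *m invmx (tf n.+1)).
    by rewrite -[LHS](mulmxK (T_unit (Tf n.+1))) gE !mulmxA.
  have T' : T (s o1 *m invmx (tf n.+1)) by apply: T_mul; [exact: T_refl|exact: T_inv].
  have Kg : K g by apply: KM => //; exact: KV.
  exists (translate (tf n) (facet)), g; split; first split=> //.
  + apply: (poly_face_translate (T_unit (Tf n))); last exact: facet_face.
    exact: translate_solid.
  + by rewrite gE'; exact: solid_meet.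
  + by rewrite /paired_face /= ptE mulmxA gE; exists y; [split|rewrite -!mulmxA !refl_fix].
  + by rewrite /g -mulmxA mulKVmx // KU.
- move=> k Kk Sk; have /solidP[_ [g Tg cg]] := Sk.
  have Gg : Gam (g *m k *m t) by apply: words_mul; [apply: words_mul; [exact: T_Gam|exact: KG]|exact: T_Gam].
  have cg' : chamber V (g *m k *m t *m y) by rewrite -!mulmxA.
  have [_ gS] := chamber_rigid CD Gg cy cg'.
  have y1' : (a o1 *m y) 0 0 == 0 by rewrite y1.
  have [n [u [np uS e]]] := edge_words (S := fun i => (a i *m y) 0 0 == 0) y1' y2 (words_in_inv CD gS).
  exists n => //.
  have Tu : T u by rewrite apex_groupE; apply: words_in_sub uS => i /andP[].
  have e2 : kf n *m (tf n *m u) = invmx k *m invmx g.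
    rewrite mulmxA -ktf -mulmxA -e; apply: (can_inj (mulKmx (KU Kk))).
    apply: (can_inj (mulKmx (T_unit Tg))).
    by rewrite mulKVmx ?KU // mulmxV ?T_unit // !mulmxA mulmxV // Gam_unit.
  have [] := tr_uniq (Kf n) (KV Kk) (T_mul (Tf n) Tu) (T_inv Tg) e2.
  by move=> ->; rewrite invmxK.
- move=> i j ij jp e; apply: (@edge_rotation_notin (j - i)%N); [lia|lia|].
  have e2 : rot ^+ i *m rot ^+ (j - i) = rot ^+ i *m (invmx (tf i) *m tf j).
    rewrite -[_ *m _]exprD subnKC; last by lia.
    apply: (can_inj (mulKmx (T_unit Tt))).
    by rewrite [RHS]mulmxA (ktf i) -mulmxA mulKVmx ?T_unit // ktf e.
  rewrite (can_inj (mulKmx (Gam_unit (Gam_rotation i))) e2).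
  by apply: T_mul => //; exact: T_inv.
Qed.

Lemma solid_cover x : space X x -> exists k t y, [/\ K k, T t, space X y, chamber V y & x = k *m (t *m y)].
Proof.
move=> hx; have [g [Gg cg _]] := covering hx.
have [k [t [Kk Tt e]]] := tr_dec (Gam_inv Gg).
exists k, t, (g *m x); split=> //; first exact: isometry_space (Gam_isometry Gg) hx.
by rewrite mulmxA -e mulKmx // Gam_unit.
Qed.

(** Overlapping interiors contain a point interior to a chamber. That point determines the group
    element bringing it to the simplex, so comparing the two copies puts k in the apex group, where
    the transversal leaves 1. *)
Lemma solid_fundamental_region : fundamental_region X K Sigma.
Proof.
split=> [z /solidP[]//||k Kk k1].
  apply/seteqP; split=> [z [k Kk [w /solidP[hw _] <-]]|z hz].
    exact: isometry_space (Gam_isometry (KG Kk)) hw.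
  have [k [t [y [Kk Tt hy cy ->]]]] := solid_cover hz.
  exists k => //; exists (t *m y) => //; apply: solid_T => //.
  exact: solid_chamber.
apply/seteqP; split=> // z [[hz nz] [w [hw nw] e]]; case: k1.
have n1 : \forall z' \near z, space X z' -> Sigma z' by exact: nz.
have n2 : \forall z' \near z, space X z' -> Sigma (invmx k *m z').
  have c : (fun z' : 'cV[R]_4 => invmx k *m z') @ z --> w.
    have -> : w = invmx k *m z by rewrite -e mulKmx // KU.
    exact: mulmx_continuous.
  have := c _ nw; apply: (@filterS _ _ (nbhs_filter z)) => z' h sz'; apply: h.
  exact: isometry_space (Gam_isometry (KG (KV Kk))) sz'.
have [z' [sz' [/(_ sz')Sz' /(_ sz')Skz'] [g Gg g0]]] := near_interior_chamber hz (filterI n1 n2).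
have uniq t h : Gam h -> T t -> chamber V (t *m (h *m z')) -> t *m h = g.
  move=> Gh Tt ct; have G' : Gam (t *m h *m invmx g).
    by apply: words_mul; [apply: words_mul => //; exact: T_Gam|exact: Gam_inv].
  have := interior_rigid G' g0; rewrite -!mulmxA mulKmx ?Gam_unit // => /(_ ct).
  by rewrite mulmxA => h1; rewrite -[LHS](mulmxKV (Gam_unit Gg)) h1 mul1mx.
have /solidP[_ [t Tt ct]] := Sz'; have /solidP[_ [t' Tt' ct']] := Skz'.
have e1 : t *m 1%:M = g by apply: uniq => //; [exact: words1|rewrite mul1mx].
have e2 : t' *m invmx k = g by apply: uniq => //; exact/KG/KV.
apply: tr_meet => //; have -> : k = invmx t *m t'.
  by rewrite -[k](mulKmx (T_unit Tt)) -[t in t *m k]mulmx1 e1 -e2 mulmxKV // KU.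
by apply: T_mul => //; exact: T_inv.
Qed.

Lemma pairing_class_card : fixed_point_free X K ->
  forall x, in_edge_interior Sigma x -> (pairing_class K Sigma x #= `I_p)%card.
Proof.
move=> Kfree x ex; have Sx : Sigma x by case: ex => -[E [[u [_ ->]] _ [Sx _]]] _.
have /solidP[hx [g Tg cg]] := Sx.
have gU := T_unit Tg.
have hy := isometry_space (T_isometry Tg) hx.
have [y0 y1 y2] := (in_edge_interiorP hy cg).1 (in_edge_translate Tg ex).
have [kf [kf0 Kf [Sf step] orb inj]] := edge_cycle (T_inv Tg) hy cg y0 y1 y2.
rewrite (mulKmx gU) in Sf step orb.
have -> : pairing_class K Sigma x = (fun n => invmx (kf n) *m x) @` `I_p.
  apply/seteqP; split=> z.
    move=> /pairing_class_orbit[Sz [k Kk e]].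
    by have [|n np ek] := orb k Kk; [rewrite -e|exists n; rewrite // e ek].
  move=> [n _ <-]; split=> //; elim: n => [|n IH].
    by rewrite kf0 invmx1 mul1mx; exact: rst_refl.
  by apply: rst_trans IH _; apply: rst_sym; exact: rst_step.
apply: inj_card_eq => i j; rewrite !inE /= => ip jp e.
have fin (i' j' : nat) : invmx (kf i') *m x = invmx (kf j') *m x -> kf i' = kf j'.
  move=> e'; have Kk : K (kf j' *m invmx (kf i')) by apply: KM => //; exact: KV.
  have [k1|/(Kfree _ x Kk)-/(_ hx)[]] := pselect (kf j' *m invmx (kf i') = 1%:M).
    by rewrite -[LHS]mul1mx -k1 mulmxKV // KU.
  by rewrite -mulmxA e' mulKVmx // KU.
have [ij|ji|//] := ltngtP i j; first by case: (inj i j ij jp); exact: fin.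
by case: (inj j i ji ip); exact: fin.
Qed.

(** * Freeness from the three conditions *)

Hypothesis Kdet : forall k, K k -> 0 < \det k.
Hypothesis pairing_free : forall S g, side_pairing K Sigma S g ->
  forall x, paired_face g S x -> g *m x <> x.
Hypothesis edge_card : forall x, in_edge_interior Sigma x ->
  (pairing_class K Sigma x #= `I_p)%card.

Lemma stab_trivial k t y : K k -> T t -> space X y -> chamber V y ->
  ~ [/\ (a 0 *m y) 0 0 = 0, (a o1 *m y) 0 0 = 0 & (a o2 *m y) 0 0 = 0] ->
  k *m (t *m y) = t *m y -> k = 1%:M.
Proof.
move=> Kk Tt hy cy nV ky; have Sy : Sigma y by exact: solid_chamber.
have Gh : Gam (invmx t *m k *m t).
  by apply: words_mul; [apply: words_mul; [exact/T_Gam/T_inv|exact: KG]|exact: T_Gam].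
have hyy : invmx t *m k *m t *m y = y by rewrite -!mulmxA ky mulKmx // T_unit.
have [_ hS] : invmx t *m k *m t *m y = y /\ words_in J a (fun i => (a i *m y) 0 0 == 0) (invmx t *m k *m t).
  by apply: (chamber_rigid CD Gh cy); rewrite hyy.
have kE h : invmx t *m k *m t = h -> k = t *m h *m invmx t.
  by move=> <-; rewrite mulmxA mulKVmx ?T_unit // -[RHS]mulmxA mulmxV ?T_unit // mulmx1.
have [y1|y1] := eqVneq ((a o1 *m y) 0 0) 0; last first.
  (* The conjugate of k is u, excluded by the transversal, or [s 0 *m u], a side pairing when y is
     on wall 0. *)
  have [u uS] := words_in_facet hS y1.
  have Tu : T u by rewrite apex_groupE; apply: words_in_sub uS => i /andP[].
  case=> /kE k_E; first by apply: tr_meet => //; rewrite k_E; apply: T_mul; [exact: T_mul|exact: T_inv].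
  have [y0|y0] := eqVneq ((a 0 *m y) 0 0) 0; last first.
    apply: tr_meet => //; rewrite (kE _ erefl); apply: T_mul; last exact: T_inv.
    apply: T_mul => //; rewrite apex_groupE; apply: words_in_sub hS => i.
    by apply: contraTneq => ->.
  have T' : T (u *m invmx t) by apply: T_mul => //; exact: T_inv.
  have kE' : k = t *m s 0 *m (u *m invmx t) by rewrite k_E !mulmxA.
  case: (@pairing_free (translate t (facet)) k _ (t *m y)) => //; last first.
    by rewrite /paired_face /= ky; exists y.
  split=> //.
    apply: (poly_face_translate (T_unit Tt)); last exact: facet_face.
    exact: translate_solid.
  by rewrite kE'; exact: solid_meet.
have [y0|y0] := eqVneq ((a 0 *m y) 0 0) 0; last first.
  apply: tr_meet => //; rewrite (kE _ erefl); apply: T_mul; last exact: T_inv.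
  apply: T_mul => //; rewrite apex_groupE; apply: words_in_sub hS => i.
  by apply: contraTneq => ->.
have y2 : (a o2 *m y) 0 0 != 0 by apply/eqP => y2; apply: nV.
have [kf [kf0 Kf [Sf _] orb _]] := edge_cycle Tt hy cy y0 y1 y2.
have ex : in_edge_interior Sigma (t *m y).
  by apply: in_edge_translate => //; exact: in_edge_interior_edge.
have sub : pairing_class K Sigma (t *m y) `<=` (fun n => invmx (kf n) *m (t *m y)) @` `I_p.
  move=> z /pairing_class_orbit[Sz [k' Kk' e]].
  have [|n np ek] := orb k' Kk'; first by rewrite -e.
  by exists n; rewrite // e ek.
(* An index other than 0 would repeat the point of index 0 in a list of p points covering a class of
   p elements. *)
have [|[|n] np ek] := orb k Kk; first by rewrite ky; exact: solid_T.
  by rewrite ek kf0 invmx1.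
have := card_image_II_inj (edge_card ex) sub (ltn0Sn n) np.
by rewrite kf0 -ek ky invmx1 mul1mx.
Qed.

(** A point of the axis close to y could lie in the orbit of y only by being y itself, the orbit
    being locally discrete. *)
Lemma vertex_moved k y : Gam k -> space X y -> chamber V y -> k *m y = y -> \det k = 1 ->
  exists z, [/\ space X z, k *m z = z & forall g, Gam g -> g *m z <> y].
Proof.
move=> Gk hy cy ky dk; have ik := Gam_isometry Gk.
have hJ : k^T *m pform X y *m k = pform X y by have := isometry_pform ik hy; rewrite ky.
have [u [ku u0 yu]] := rotation_axis (pform_tr X y) (pform_unit hy) hJ ky (pform_self hy) dk.
have [e e0 he] := near_line u hy (near_orbit_fixed hy cy).
have [cc nz] := he (e / 2) ltac:(rewrite gtr0_norm ?divr_gt0 //; lra).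
have hz := rho_space cc; have [c c0 cE] := rho_scale cc.
exists (rho X (y + (e / 2) *: u)); split=> //.
  by rewrite cE -scalemxAr mulmxDr -scalemxAr ky ku.
move=> g Gg gz; have := nz hz g Gg gz; rewrite cE => ez.
(* Pairing with u, which is orthogonal to y, leaves the square of u, nonzero since the form is
   definite on tangent vectors. *)
have := congr1 (bl (pform X y) y) ez; have := congr1 (bl (pform X y) u) ez.
have uy : bl (pform X y) u y = 0 by rewrite pform_sym.
rewrite !blE uy add0r => /eqP; rewrite mulf_eq0 (gt_eqF c0) /= mulf_eq0 (gt_eqF (_ : 0 < e / 2)) ?divr_gt0 //= => /eqP uu.
by rewrite (pform_eq0 hy yu uu) eqxx in u0.
Qed.

Lemma solid_fixed_point_free : fixed_point_free X K.
Proof.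
move=> k x Kk k1 hx kx; apply: (k1).
have conj k' z : K k' -> space X z -> k' *m z = z -> (forall y, space X y -> chamber V y ->
    [/\ (a 0 *m y) 0 0 = 0, (a o1 *m y) 0 0 = 0 & (a o2 *m y) 0 0 = 0] ->
    forall g, Gam g -> g *m z <> y) -> k' = 1%:M.
  move=> Kk' hz kz nV; have [k2 [t [y [Kk2 Tt hy cy e]]]] := solid_cover hz.
  have k2U := KU Kk2; have tU := T_unit Tt.
  have kc : invmx k2 *m k' *m k2 = 1%:M.
    apply: (@stab_trivial _ t y) => //; first by do 2!apply: KM => //; exact: KV.
      move=> Vy; apply: (nV y hy cy Vy (invmx t *m invmx k2)).
        by apply: words_mul; [exact/T_Gam/T_inv|exact/KG/KV].
      by rewrite e -mulmxA (mulKmx k2U) (mulKmx tU).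
    by rewrite -!mulmxA -e kz e (mulKmx k2U).
  by rewrite -[k'](mulmxK k2U) -[k' *m k2](mulKVmx k2U) (mulmxA (invmx k2)) kc mulmx1 mulmxV.
apply: (conj k x) => // y hy cy [y0 y1 y2] g Gg gx.
have gU := Gam_unit Gg; have Gc : Gam (g *m k *m invmx g).
  by apply: words_mul; [apply: words_mul => //; exact: KG|exact: Gam_inv].
have cy' : g *m k *m invmx g *m y = y by rewrite -gx -!mulmxA (mulKmx gU) kx.
have dc : \det (g *m k *m invmx g) = 1.
  rewrite !det_mulmx det_inv mulrAC mulfV ?mul1r; last by rewrite -unitfE -unitmxE.
  (* Words have determinant 1 or -1, so a positive determinant is 1, as [vertex_moved] requires. *)
  have := Kdet Kk; case: (KG Kk) => w _ <-; rewrite (det_wprod CD).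
  by case: (odd (size w)) (signr_odd R (size w)) => <-; rewrite ?expr1 ?expr0 //; lra.
have [z [hz cz nz]] := vertex_moved Gc hy cy cy' dc.
apply: k1; apply: (conj k (invmx g *m z)) => //.
- exact: isometry_space (Gam_isometry (Gam_inv Gg)) hz.
- by rewrite -{2}cz -!mulmxA (mulKmx gU).
- move=> y' hy' cy'' [z0 z1 z2] h Gh e.
  (* The simplex contains at most one vertex of the solid, so avoiding the orbit of y avoids all
     vertices. *)
  have yy' : y' = y by apply: vertex_uniq => //.
  by apply: (nz (h *m invmx g)); [apply: words_mul => //; exact: Gam_inv|rewrite -mulmxA e].
Qed.

End SidePairing.

End CoxeterSimplex.

Theorem theorem2 (R : realType) (X : geometry) (V : 'M[R]_4) (p q r : nat)
  (hp : (3 <= p)%N) (hq : (3 <= q)%N) (hr : (3 <= r)%N)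
  (hV : linear_coxeter_simplex X V p q r)
  (hv : space X (apex V))
  (M : metricType R) :
  (orientable_manifold X M /\ arises_from_solid X V M) <->
  (exists K : set 'M[R]_4,
    [/\ mx_group K /\ K `<=` coxeter_group X V,
        (forall k, K k -> orientation_preserving k),
        isometric_to_quotient X M K
      & [/\ (* (1) *)
            transversal (coxeter_group X V) K (apex_group X V),
            (* (2) *)
            (forall (S : set 'cV[R]_4) (g : 'M[R]_4),
               side_pairing K (solid X V) S g ->
               forall x, paired_face g S x -> g *m x <> x)
          & (* (3) *)
            (forall x, in_edge_interior (solid X V) x ->
               (pairing_class K (solid X V) x #= `I_p)%card)]]).
Proof.
rewrite (coxeter_groupE hp hq hr hV).
have iso K : mx_group K -> K `<=` words (Jn R X) (nf_row X V) -> isometry_group X K.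
  by move=> Kgp KG; split=> // k /KG; exact: (Gam_isometry hp hq hr hV).
split=> [[[G [Giso Gpd Gfree Gor GM]] [K [[Kgp KG] Kpd Kfree Kfund KM]]]|[K [[Kgp KG] Kdet KM [tr free card]]]].
  rewrite (coxeter_groupE hp hq hr hV) in KG.
  have tr := fundamental_transversal hp hq hr hV Kgp KG hv Kfund.
  (* Orientability is given through G, which need not be K; it is transferred along the two
     descriptions of M. *)
  exists K; split=> //; first by apply: (quotient_orientation _ _ Gor GM KM); split=> //; exact: iso.
  split=> //; first exact: (side_pairing_free hp hq hr hV Kfree).
  exact: (pairing_class_card hp hq hr hV Kgp KG tr Kfree).
have Kfree := solid_fixed_point_free hp hq hr hV Kgp KG tr Kdet free card.
have Kpd : properly_discontinuous X K.
  move=> C CX cC; apply: sub_finite_set (Gam_properly_discontinuous hp hq hr hV CX cC) => g [Kg h].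
  by split=> //; exact: KG.
split.
  exists K; split=> //; first exact: iso.
  (* Since K preserves orientation, the constant choice of sign is equivariant. *)
  exists (fun=> true); split=> [x _|g x Kg _]; first exact: (@filterE _ _ (within_filter _ (nbhs_filter x))).
  by rewrite lt_gtF //; exact: Kdet.
exists K; split=> //; first by rewrite (coxeter_groupE hp hq hr hV).
exact: (solid_fundamental_region hp hq hr hV Kgp KG tr).
Qed.
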